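(* Let $n\ge1$, $1\le p\le\infty$ and $d\ge 1$. For every $x\in\mathcal{P}^{\ge d}$ and every $t\ge0$, $$\|P_t(x)\|_p\le (d+3)e^{-td}\|x\|_p,$$ and $$\|L(x)\|_p\ge \frac{d}{4}\|x\|_p.$$
   Context: $\mathbb{F}_n$ is the free group on generators $g_1,\dots,g_n$ with unit $e$, and $\lambda$ is its left regular representation on $\ell_2(\mathbb{F}_n)$. $\widehat{\mathbb{F}}_n$ is the von Neumann algebra generated by $\{\lambda_g\}$, with canonical faithful tracial state $\tau(x)=\langle x\delta_e,\delta_e\rangle$. For $1\le p<\infty$, $\|x\|_p=\tau((x^*x)^{p/2})^{1/p}$, and $\|\cdot\|_\infty$ is the operator norm. A polynomial is a finite sum $\sum_g x_g\lambda_g$, $x_g\in\mathbb{C}$. $|g|$ denotes word length with respect to $g_1^{\pm1},\dots,g_n^{\pm1}$. $P_t(\sum_g x_g\lambda_g)=\sum_g e^{-t|g|}x_g\lambda_g$ for $t\ge0$ and $L(\sum_g x_g\lambda_g)=\sum_g|g|x_g\lambda_g$. $\mathcal{P}^{\ge d}$ is the complex linear span of $\{\lambda_g:|g|\ge d\}$ (no holomorphy is assumed). *)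

(* Defs.v *)
From HB Require Import structures.
From mathcomp Require Import all_boot all_order all_algebra.
From mathcomp Require Import all_classical all_reals all_analysis.
From mathcomp Require Import complex.
Set Implicit Arguments. Unset Strict Implicit. Unset Printing Implicit Defensive.
Import Order.TTheory GRing.Theory Num.Theory.
Local Open Scope ring_scope.
Local Open Scope classical_set_scope.

Section FreeGroupLp.
Variables (R : realType) (n : nat).

(** * The free group F_n on generators g_1..g_n, as reduced words.
    A letter (i, false) is the generator g_(i+1), (i, true) its inverse. *)
Definition letter := ('I_n * bool)%type.
Definition word := seq letter.

Definition cancels (a b : letter) : bool := (a.1 == b.1) && (a.2 != b.2).

Fixpoint reduced (w : word) : bool :=
  match w with
  | a :: ((b :: _) as w') => ~~ cancels a b && reduced w'
  | _ => true
  end.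

Definition cons_red (a : letter) (w : word) : word :=
  if w is b :: w' then (if cancels a b then w' else a :: w) else [:: a].

Definition wmul (u v : word) : word := foldr cons_red v u.
Definition winv (w : word) : word := rev (map (fun a : letter => (a.1, ~~ a.2)) w).
Definition wlen (w : word) : nat := size w.

(** * Polynomials sum_g x_g lambda_g with complex coefficients.
    An fpoly is a finite list of candidate group elements with a coefficient
    function; its coefficient at g is fcoef g if g is (reduced and) listed, else 0. *)
Record fpoly := FPoly { fsupp : seq word ; fcoef : word -> R[i] }.

Definition coef (x : fpoly) (g : word) : R[i] :=
  if (g \in fsupp x) && reduced g then fcoef x g else 0.

Definition supp (x : fpoly) : seq word := [seq g <- undup (fsupp x) | reduced g].

Definition cconj (z : R[i]) : R[i] := let: Complex a b := z in Complex a (- b).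
Definition cabs2 (z : R[i]) : R := let: Complex a b := z in a ^+ 2 + b ^+ 2.

(* product in the group algebra (lambda_a lambda_b = lambda_(ab));
   also the action lambda(x) xi on finitely supported vectors of l2(F_n) *)
Definition pmul (x y : fpoly) : fpoly :=
  FPoly [seq wmul a b | a <- supp x, b <- supp y]
        (fun g => \sum_(a <- supp x) \sum_(b <- supp y | wmul a b == g)
                     coef x a * coef y b).

Definition padj (x : fpoly) : fpoly :=
  FPoly (map winv (supp x)) (fun g => cconj (coef x (winv g))).

Definition pone : fpoly := FPoly [:: [::]] (fun _ => 1).

Definition ppow (x : fpoly) (k : nat) : fpoly := iter k (pmul x) pone.

(* canonical trace tau(x) = < x delta_e, delta_e > *)
Definition tau (x : fpoly) : R[i] := coef x [::].

Definition Pt (t : R) (x : fpoly) : fpoly :=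
  FPoly (supp x) (fun g => (expR (- t * (wlen g)%:R))%:C%C * coef x g).
Definition Lop (x : fpoly) : fpoly :=
  FPoly (supp x) (fun g => ((wlen g)%:R)%:C%C * coef x g).

Definition in_Pge (d : nat) (x : fpoly) : Prop :=
  forall g, coef x g != 0 -> (d <= wlen g)%N.

Definition l2norm (xi : fpoly) : R := Num.sqrt (\sum_(g <- supp xi) cabs2 (coef xi g)).

(* operator norm of lambda(x) on l2(F_n) (finitely supported vectors are dense) *)
Definition opnorm (x : fpoly) : R :=
  sup [set l2norm (pmul x xi) | xi in [set xi | l2norm xi <= 1]].

(* mu is the spectral distribution of x^*x w.r.t. tau: a compactly supported
   probability measure on [0, oo) whose moments are tau((x^*x)^k). *)
Definition spectral_distr (x : fpoly) (mu : probability R R) : Prop :=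
  (exists B : R, mu (~` `[0, B]) = 0%E) /\
  forall k : nat,
    tau (ppow (pmul (padj x) x) k) = (fine (\int[mu]_s (s ^+ k)%:E))%:C%C.

(* ||x||_p = tau((x^*x)^(p/2))^(1/p) = (int s^(p/2) dmu(s))^(1/p) for p < oo,
   and the operator norm for p = oo *)
Definition lpnorm_spec (x : fpoly) (p : \bar R) (r : R) : Prop :=
  match p with
  | +oo%E => r = opnorm x
  | EFin q => exists mu : probability R R, spectral_distr x mu /\
                r = powR (fine (\int[mu]_s (powR s (q / 2))%:E)) q^-1
  | -oo%E => False
  end.

Definition lpnorm (x : fpoly) (p : \bar R) : R := xget 0 [set r | lpnorm_spec x p r].

End FreeGroupLp.

(* Main.v *)
Require Import Defs.
From HB Require Import structures.
From mathcomp Require Import all_boot all_order all_algebra.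
From mathcomp Require Import all_classical all_reals all_analysis.
From mathcomp Require Import complex measurable_realfun ring lra zify.
Set Implicit Arguments. Unset Strict Implicit. Unset Printing Implicit Defensive.
Import Order.TTheory GRing.Theory Num.Theory.
Local Open Scope ring_scope.

(* On words of length at least [d] the maps [P_t] and the inverse of [L] are radial
   multipliers [lambda_g |-> f(|g|) lambda_g], where [f] may be chosen freely below [d].
   In a tree any two rays to a fixed end merge, so [f |g h^-1|] is the sum of
   [f(k) - f(k+2)] over the common part of the rays from [g] and [h]; hence a
   factorisation of the Hankel matrix [f(i+j) - f(i+j+2)] through a Hilbert-Schmidt
   pair of norm [C] makes the multiplier bounded by [C] in operator norm (Haagerup).
   For [f(k) = r^k], with zero differences below [d], one finds [C = (d+1) r^d]; for
   [f(k) = 1/k], with the difference frozen below [d], one finds [C = 4/d].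

   The multiplier [M] being symmetric for the trace, splitting [x] at height [c] of
   [|x|] gives [tau((|M x| - C c)_+) <= C tau((|x| - c)_+)] for all [c], and [v^p] is a
   positive combination of hinges [(v - c)_+]; this yields the bound for every finite
   [p].  Spectral distributions are handled through polynomials in [x^* x] only: they
   exist by Hausdorff's moment theorem, and Bernstein polynomials replace the
   functional calculus. *)

(** A multiplier with f(0) = 1 fixes the unit, so the symbol e^(-tk) taken for all k cannot have
    norm below 1. The decay e^(-td) has to come from altering the symbol below d, where x has no
    coefficient.

    The constants come from cutting the Hankel matrix into rank one pieces. For the heat symbol
    these are the d rows of index below d and one block for the other rows; each costs r^d, whence d
    + 1, within the stated d + 3. For 1/k the pieces cost at most 15/(4d) and a truncation 1/(4d),
    whence 4/d. The lower bound for L is this upper bound for its inverse, applied to L x.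

    The quantity tau((|x| - c)_+) is the least trace norm of x - x2 over the x2 of operator norm at
    most c. The hinge inequality therefore says that M acts with the same constant C at both ends of
    the L_p scale. Splitting elements in this way avoids complex interpolation, and with polynomial
    cutoffs the pieces never leave the group algebra. *)

(** * Tracial algebras *)

(* Scalars are restricted to the reals, so [tr] is the real part of the trace and
   [tr (star x * y)] a real inner product. *)
Record tracial (R : realType) (A : algType R) (star : A -> A) (tr : A -> R)
    : Prop := Tracial {
  tracial_starD : forall x y, star (x + y) = star x + star y ;
  tracial_starZ : forall (c : R) x, star (c *: x) = c *: star x ;
  tracial_starM : forall x y, star (x * y) = star y * star x ;
  tracial_starK : forall x, star (star x) = x ;
  tracial_trD : forall x y, tr (x + y) = tr x + tr y ;
  tracial_trZ : forall (c : R) x, tr (c *: x) = c * tr x ;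
  tracial_trC : forall x y, tr (x * y) = tr (y * x) ;
  tracial_tr_star : forall x, tr (star x) = tr x ;
  tracial_ge0 : forall x, 0 <= tr (star x * x) ;
  tracial_tr1 : tr 1 = 1 }.

Section TracialTheory.
Variables (R : realType) (A : algType R) (star : A -> A) (tr : A -> R).
Hypothesis T : tracial star tr.
Implicit Types (x y z b : A) (c : R) (p q : {poly R}).

Local Notation "x ^#" := (star x) (at level 2, format "x ^#").
Local Notation sq x := (tr (star x * x)).

(** Left multiplication by [x] has norm at most |c| for the trace inner product. Vectors of [A]
    suffice because they are dense in the completion. *)
Definition opbound x c := forall y, sq (x * y) <= c ^+ 2 * sq y.

Let starD := tracial_starD T.
Let starZ := tracial_starZ T.
Let starM := tracial_starM T.
Let starK := tracial_starK T.
Let trD := tracial_trD T.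
Let trZ := tracial_trZ T.
Let trC := tracial_trC T.
Let tr_star := tracial_tr_star T.
Let tr_ge0 := tracial_ge0 T.

Lemma star1 : 1^# = 1 :> A.
Proof. by rewrite -[LHS]mulr1 -[X in _ * X]starK -starM mulr1 starK. Qed.

Lemma star0 : 0^# = 0 :> A.
Proof. by rewrite -(scale0r 0) starZ !scale0r. Qed.

Lemma tr0 : tr 0 = 0.
Proof. by rewrite -(scale0r 0) trZ mul0r. Qed.

Lemma trN x : tr (- x) = - tr x.
Proof. by rewrite -scaleN1r trZ mulN1r. Qed.

Lemma trB x y : tr (x - y) = tr x - tr y.
Proof. by rewrite trD trN. Qed.

Lemma starX x k : (x ^+ k)^# = x^# ^+ k.
Proof. by elim: k => [|k IH]; rewrite ?expr0 ?star1 // exprS starM IH -exprSr. Qed.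

Lemma tr_sum (I : Type) (r : seq I) (F : I -> A) :
  tr (\sum_(i <- r) F i) = \sum_(i <- r) tr (F i).
Proof. by elim/big_rec2: _ => [|i u v _ <-]; rewrite ?tr0 ?trD. Qed.

Lemma star_sum (I : Type) (r : seq I) (F : I -> A) :
  (\sum_(i <- r) F i)^# = \sum_(i <- r) (F i)^#.
Proof. by elim/big_rec2: _ => [|i u v _ <-]; rewrite ?star0 ?starD. Qed.

Lemma tr_conjE x y : tr (x^# * y) = tr (y^# * x).
Proof. by rewrite -tr_star starM starK. Qed.

Lemma sqZ c x : sq (c *: x) = c ^+ 2 * sq x.
Proof. by rewrite starZ -scalerAl -scalerAr !trZ mulrA expr2. Qed.

Lemma tr_cauchy_schwarz x y : tr (x^# * y) ^+ 2 <= sq x * sq y.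
Proof.
have H c : 0 <= sq x * c ^+ 2 + 2 * tr (x^# * y) * c + sq y.
  apply: le_trans (tr_ge0 (c *: x + y)) _.
  rewrite starD starZ mulrDl !mulrDr -!scalerAl -!scalerAr scalerA !trD !trZ.
  rewrite (tr_conjE y x) le_eqVlt; apply/orP; left; apply/eqP; ring.
have [sx0|sx0] := eqVneq (sq x) 0.
  rewrite sx0 mul0r; have [->|t0] := eqVneq (tr (x^# * y)) 0; first by rewrite expr0n.
  (* With [sq x = 0] the quadratic is affine in [c], and at this point its value is -1. *)
  have := H (- (sq y + 1) / (2 * tr (x^# * y))).
  rewrite sx0 mul0r add0r => h; exfalso; move: h.
  have -> : 2 * tr (x^# * y) * (- (sq y + 1) / (2 * tr (x^# * y))) = - (sq y + 1).
    by field.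
  by rewrite leNgt => /negP; apply; lra.
have sxp : 0 < sq x by rewrite lt_def sx0 tr_ge0.
have := H (- tr (x^# * y) / sq x).
rewrite (_ : _ + _ = (sq x * sq y - tr (x^# * y) ^+ 2) / sq x); last by field.
by rewrite pmulr_lge0 ?invr_gt0// subr_ge0.
Qed.

Lemma tr_cauchy_schwarz_le x y c :
  0 <= c -> sq x * sq y <= c ^+ 2 -> tr (x^# * y) <= c.
Proof.
move=> c0 h; apply: le_trans (ler_norm _) _.
rewrite -(ger0_norm c0) -ler_sqr ?nnegrE// !real_normK ?num_real//.
exact: le_trans (tr_cauchy_schwarz x y) h.
Qed.

(** The arithmetic mean, in place of the product of the two norms, makes the bound additive in
    [sq y] and [sq z]: it can be summed over pieces and evaluated by traces of polynomials. *)
Lemma opbound_ip x y z c : 0 <= c -> opbound x c ->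
  tr (y^# * (x * z)) <= c * ((sq y + sq z) / 2).
Proof.
move=> c0 hx; apply: tr_cauchy_schwarz_le.
  by rewrite mulr_ge0// divr_ge0// addr_ge0.
apply: (@le_trans _ _ (sq y * (c ^+ 2 * sq z))).
  by rewrite ler_wpM2l.
rewrite mulrCA exprMn ler_wpM2l ?sqr_ge0//.
have := sqr_ge0 (sq y - sq z); nra.
Qed.

(** Cauchy-Schwarz bounds the square of <y, x x^# y> = |x^# y|^2 by c^2 |y|^2 |x^# y|^2, and one
    factor |x^# y|^2 cancels. *)
Lemma opbound_star x c : opbound x c -> opbound x^# c.
Proof.
move=> hx y; have := tr_cauchy_schwarz y (x * (x^# * y)).
have -> : tr (y^# * (x * (x^# * y))) = sq (x^# * y).
  by rewrite starM starK !mulrA.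
move=> h; have {}h := le_trans h (ler_wpM2l (tr_ge0 y) (hx _)).
have := tr_ge0 (x^# * y); rewrite le_eqVlt => /orP[/eqP <-|s0].
  by rewrite mulr_ge0// sqr_ge0.
by rewrite -(ler_pM2r s0) -mulrA mulrCA -expr2.
Qed.

Lemma opbound_le x c d : 0 <= c -> c <= d -> opbound x c -> opbound x d.
Proof.
move=> c0 cd hx y; apply: le_trans (hx y) _.
by rewrite ler_wpM2r// ler_sqr// nnegrE// (le_trans c0).
Qed.

Lemma opboundD x y c d : 0 <= c -> 0 <= d ->
  opbound x c -> opbound y d -> opbound (x + y) (c + d).
Proof.
move=> c0 d0 hx hy z; rewrite mulrDl starD mulrDl !mulrDr !trD.
rewrite (tr_conjE (y * z)).
have : tr ((x * z)^# * (y * z)) <= c * d * sq z.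
  apply: tr_cauchy_schwarz_le; first by rewrite mulr_ge0// mulr_ge0.
  by rewrite (_ : (_ ^+ 2) = (c ^+ 2 * sq z) * (d ^+ 2 * sq z)) ?ler_pM//; ring.
have := hx z; have := hy z; nra.
Qed.

(* Iterating [u_k ^ 2 <= u_0 u_(2k)] for [u_k = tr (y^# (x^# x)^k y)] controls
   the operator norm by the growth of the moments. *)
Lemma opbound_moments x c K : 0 < c ->
  (forall k, tr ((x^# * x) ^+ k) <= K * (c ^+ 2) ^+ k) -> opbound x c.
Proof.
move=> c0 hK y; set a := x^# * x in hK *.
pose u k := tr (y^# * (a ^+ k * y)).
have aE k : (a ^+ k)^# = a ^+ k by rewrite starX /a starM starK.
have u_ge0 : 0 <= u 0%N by rewrite /u expr0 mul1r.
have uS k : u k ^+ 2 <= u 0%N * u (k + k)%N.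
  rewrite /u expr0 mul1r exprD; apply: le_trans (tr_cauchy_schwarz _ _) _.
  by rewrite [(a ^+ k * y)^#]starM aE !mulrA.
have u1 : u 1%N = sq (x * y) by rewrite /u expr1 starM !mulrA.
rewrite -u1 (_ : tr (y^# * y) = u 0%N); last by rewrite /u expr0 mul1r.
have [u00|u00] := eqVneq (u 0%N) 0.
  have := uS 1%N; rewrite u00 mul0r mulr0 => h.
  by have /eqP := le_anti (introT andP (conj h (sqr_ge0 _))); rewrite expf_eq0 => /eqP ->.
have u0p : 0 < u 0%N by rewrite lt_def u00.
have K0 : 0 <= K.
  by have := hK 0%N; rewrite !expr0 mulr1 (tracial_tr1 T); apply: le_trans.
(* By traciality u_k = tr (a^k y y^#), so Cauchy-Schwarz against a^k involves [y] only through this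
   constant and the moment of order 2k. *)
pose D := Num.sqrt (K * sq (y * y^#)).
have ub k : u k <= D * (c ^+ 2) ^+ k.
  have -> : u k = tr ((a ^+ k)^# * (y * y^#)).
    by rewrite aE /u trC mulrA.
  apply: tr_cauchy_schwarz_le; first by rewrite mulr_ge0// ?sqrtr_ge0// exprn_ge0// sqr_ge0.
  rewrite exprMn sqr_sqrtr ?mulr_ge0// aE -exprD.
  rewrite mulrAC ler_wpM2r// -[(_ ^+ k) ^+ 2]exprM muln2 -addnn; exact: hK.
(* The claim is r <= 1. Doubling the exponent keeps r^(2^m) below D / u_0 for all m, which
   Bernoulli's inequality forbids when r > 1. *)
pose r := u 1%N / (u 0%N * c ^+ 2).
have r_ge0 : 0 <= r by apply: divr_ge0; rewrite ?u1 ?tr_ge0// mulr_ge0// sqr_ge0.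
have den : 0 < u 0%N * c ^+ 2 by rewrite mulr_gt0 ?exprn_gt0.
have rk m : u 0%N * (r * c ^+ 2) ^+ (2 ^ m) <= u (2 ^ m)%N.
  elim: m => [|m IH].
    by rewrite expn0 expr1 mulrCA /r divfK ?gt_eqF.
  have w0 : 0 <= u 0%N * (r * c ^+ 2) ^+ (2 ^ m).
    by rewrite mulr_ge0// exprn_ge0// mulr_ge0// sqr_ge0.
  have := uS (2 ^ m)%N; rewrite addnn -mul2n -expnS => h.
  have : (u 0%N * (r * c ^+ 2) ^+ (2 ^ m)) ^+ 2 <= u (2 ^ m)%N ^+ 2.
    by rewrite ler_sqr ?nnegrE// (le_trans w0).
  move=> /le_trans/(_ h); rewrite exprMn expr2 -mulrA ler_pM2l// -exprM -expnSr.
  done.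
have rb m : r ^+ (2 ^ m) <= D / u 0%N.
  have := le_trans (rk m) (ub _); rewrite exprMn mulrA ler_pM2r ?exprn_gt0//.
  by rewrite ler_pdivlMr// mulrC.
have [r1|r1] := leP r 1.
  by move: r1; rewrite /r ler_pdivrMr// mul1r mulrC.
exfalso.
have bern k : 1 + (r - 1) *+ k <= r ^+ k.
  elim: k => [|k IH]; first by rewrite mulr0n addr0 expr0.
  rewrite exprS mulrS; have : r * (1 + (r - 1) *+ k) <= r * r ^+ k by rewrite ler_wpM2l.
  have : 0 <= (r - 1) *+ k by rewrite mulrn_wge0// subr_ge0 ltW.
  nra.
have [m hm] : exists m : nat, D / u 0%N / (r - 1) < m%:R.
  exists (Num.truncn (D / u 0%N / (r - 1))).+1; exact: truncnS_gt.
have := le_trans (bern _) (rb m); apply/negP; rewrite -ltNge.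
rewrite -mulr_natr; move: hm; rewrite ltr_pdivrMr ?subr_gt0// => hm.
apply: (lt_trans hm); rewrite mulrC; apply: (@lt_trans _ _ (1 + (r - 1) * m%:R)).
  lra.
rewrite ltrD2l ltr_pM2l ?subr_gt0// ltr_nat; exact: ltn_expl.
Qed.

Local Notation ev := (horner_alg).

Lemma star_horner a q : a^# = a -> (ev a q)^# = ev a q.
Proof.
move=> ha; rewrite -[q]coefK poly_def linear_sum /= star_sum.
apply: eq_bigr => i _; rewrite linearZ /= rmorphXn /= horner_algX -scalerAl mul1r.
by rewrite starZ starX ha.
Qed.

(** * Traces of polynomials in [x^# x] *)

Section Moments.
Variable x : A.
Let a := x^# * x.
Let L q := tr (ev a q).

Lemma star_sqr : a^# = a.
Proof. by rewrite /a starM starK. Qed.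

Lemma sq_horner q : sq (ev a q) = L (q ^+ 2).
Proof. by rewrite (star_horner _ star_sqr) /L rmorphXn /= expr2. Qed.

Lemma star_mul_horner p q : (x * ev a p)^# * (x * ev a q) = ev a ('X * (p * q)).
Proof.
rewrite starM (star_horner _ star_sqr) mulrA -[_ * x^# * x]mulrA -/a.
have -> : ev a p * a = ev a ('X * p) by rewrite mulrC rmorphM /= horner_algX.
by rewrite -rmorphM /= mulrA.
Qed.

Lemma sq_mul_horner q : sq (x * ev a q) = L ('X * q ^+ 2).
Proof. by rewrite star_mul_horner -expr2. Qed.

(** A substitute for the duality of operator norm and trace norm: the mean multiplying [c] dominates
    the trace norm of x (pq)(a), written as the product of x p(a) and q(a), and it only involves
    traces of polynomials in [a]. *)
Lemma tr_dual_horner b c p q : 0 <= c -> opbound b c ->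
  tr (b^# * (x * ev a (p * q))) <= c * ((L (q ^+ 2) + L ('X * p ^+ 2)) / 2).
Proof.
move=> c0 hb; rewrite (_ : tr _ = tr ((ev a q)^# * (b^# * (x * ev a p)))); last first.
  by rewrite (star_horner _ star_sqr) rmorphM /= [RHS]trC -!mulrA.
apply: le_trans (opbound_ip _ _ c0 (opbound_star hb)) _.
by rewrite sq_horner sq_mul_horner.
Qed.

Lemma opbound_mul_horner q c K : 0 < c ->
  (forall k, L (('X * q ^+ 2) ^+ k) <= K * (c ^+ 2) ^+ k) ->
  opbound (x * ev a q) c.
Proof.
move=> c0 h; apply: (@opbound_moments _ _ K) => // k.
rewrite star_mul_horner -rmorphXn /= -expr2. exact: h.
Qed.

(** Even powers are moved to the two outer sides as [u]. What remains in the middle is 1, a, c^2 - a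
    or a (c^2 - a); the third is positive by the bound on [x], the fourth by the bound on [x^#]. *)
Lemma tr_bernstein_ge0 c j k : opbound x c ->
  0 <= L ('X ^+ j * ((c ^+ 2)%:P - 'X) ^+ k).
Proof.
move=> hx.
pose h : {poly R} := 'X ^+ j./2 * ((c ^+ 2)%:P - 'X) ^+ k./2.
pose u := ev a h.
have hP (s : bool) (e : bool) : odd j = s -> odd k = e ->
   'X ^+ j * ((c ^+ 2)%:P - 'X) ^+ k = h * ('X ^+ s * ((c ^+ 2)%:P - 'X) ^+ e) * h.
  move=> <- <-; rewrite -[in LHS](odd_double_half j) -[in LHS](odd_double_half k).
  by rewrite /h -!addnn !exprD; ring.
have evX : ev a 'X = a by rewrite horner_algX.
have evB : ev a ((c ^+ 2)%:P - 'X) = (c ^+ 2) *: 1 - a.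
  by rewrite rmorphB /= horner_algC evX.
have evh v w : ev a (v * w * v) = (ev a v)^# * ev a w * ev a v.
  by rewrite (star_horner _ star_sqr) !rmorphM.
have xu w : sq (w * u) = tr (u^# * (w^# * w) * u) by rewrite starM !mulrA.
rewrite /L; case ej : (odd j); case ek : (odd k);
  rewrite (hP _ _ ej ek) evh -/u ?expr0 ?expr1 ?mulr1 ?mul1r.
- rewrite rmorphM /= evX evB mulrBr -scalerAr mulr1 mulrBr mulrBl trB subr_ge0.
  rewrite -scalerAr -scalerAl trZ.
  have -> : a * a = (x^# * x)^# * (x^# * x) by rewrite star_sqr.
  rewrite -xu -mulrA; apply: le_trans (opbound_star hx _) _.
  by rewrite xu.
- by rewrite evX -xu.
- rewrite evB mulrBr mulrBl trB subr_ge0 -scalerAr mulr1 -scalerAl trZ -xu.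
  exact: hx.
- by rewrite rmorph1 mulr1.
Qed.

End Moments.
End TracialTheory.

(** * Bernstein polynomials *)

Lemma bin_ffactD (N k i : nat) : (k + i <= N)%N ->
  ('C(N, k + i) * (k + i) ^_ k = N ^_ k * 'C(N - k, i))%N.
Proof.
move=> h; have kN : (k <= N)%N by apply: leq_trans h; rewrite leq_addr.
have iN : (i <= N - k)%N by rewrite leq_subRL.
apply/eqP; rewrite -(@eqn_pmul2r (i`! * (N - (k + i))`!)) ?muln_gt0 ?fact_gt0//.
apply/eqP; have e1 := bin_fact h; have e2 := bin_fact iN.
have e3 := ffact_fact (leq_addr i k); have e4 := ffact_fact kN.
rewrite addKn in e3; rewrite -subnDA in e2.
transitivity (N`!); first by rewrite -e1 -e3; ring.
by rewrite -e4 -e2; ring.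
Qed.

Section Bernstein.
Variable R : realType.
Implicit Types (L : {poly R} -> R) (p q : {poly R}) (B : R).

(** Hausdorff's condition for [L] to be integration against a probability measure on [0, B].
    Positivity is asked only of products of powers of X and B - X, where a trace can be checked
    algebraically. *)
Record bernstein_positive B L : Prop := BernsteinPositive {
  bpD : forall p q, L (p + q) = L p + L q ;
  bpZ : forall c p, L (c *: p) = c * L p ;
  bp1 : L 1 = 1 ;
  bp_ge0 : forall j k, 0 <= L ('X ^+ j * (B%:P - 'X) ^+ k) }.

(** The value of [L] at the j-th Bernstein basis polynomial of degree N on [0, B]: the mass to be
    placed at the node B j / N. *)
Definition bweight B L (N j : nat) : R :=
  'C(N, j)%:R * L ('X ^+ j * (B%:P - 'X) ^+ (N - j)) / B ^+ N.

Lemma bp_sum B L (I : Type) (r : seq I) (F : I -> {poly R}) :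
  bernstein_positive B L -> L (\sum_(i <- r) F i) = \sum_(i <- r) L (F i).
Proof.
move=> h; elim/big_rec2: _ => [|i u v _ <-]; last by rewrite (bpD h).
by rewrite -(scale0r 0) (bpZ h) mul0r.
Qed.

Lemma bweight_ge0 B L N j : 0 < B -> bernstein_positive B L -> 0 <= bweight B L N j.
Proof.
move=> B0 h; rewrite divr_ge0 ?exprn_ge0 ?(ltW B0)// mulr_ge0//; exact: (bp_ge0 h).
Qed.

(** Multiplying X^k by B^(N-k) = ((B - X) + X)^(N-k) expands it exactly in the Bernstein basis of
    degree N. The node value (j/N)^k is replaced by a ratio of falling factorials, and
    [ffact_ratio_cvg] measures the difference. *)
Lemma bp_monomial B L N k : 0 < B -> bernstein_positive B L -> (k <= N)%N ->
  L 'X^k = B ^+ k * \sum_(j < N.+1) bweight B L N j * ((j ^_ k)%:R / (N ^_ k)%:R).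
Proof.
move=> B0 h kN; have BN0 : B != 0 by rewrite gt_eqF.
have N0 : (N ^_ k)%:R != 0 :> R by rewrite pnatr_eq0 -lt0n ffact_gt0.
have E : B ^+ (N - k) *: 'X^k =
    \sum_(i < (N - k).+1) ('X^(k + i) * (B%:P - 'X) ^+ (N - (k + i))) *+ 'C(N - k, i) :> {poly R}.
  transitivity ('X^k * ((B%:P - 'X) + 'X) ^+ (N - k) : {poly R}).
    by rewrite subrK -polyC_exp mulrC mul_polyC.
  rewrite exprDn mulr_sumr; apply: eq_bigr => i _.
  by rewrite mulrnAr subnDA exprD; congr (_ *+ _); ring.
have : B ^+ (N - k) * L 'X^k =
    \sum_(i < (N - k).+1) L ('X^(k + i) * (B%:P - 'X) ^+ (N - (k + i))) * 'C(N - k, i)%:R.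
  rewrite -(bpZ h) E (bp_sum _ _ h); apply: eq_bigr => i _.
  by rewrite -scaler_nat (bpZ h) mulrC.
move=> {}E; have BNk : B ^+ (N - k) != 0 by rewrite expf_neq0.
apply: (mulfI BNk); rewrite E mulrA -exprD subnK// mulr_sumr.
rewrite -(big_mkord xpredT (fun j => B ^+ N * (bweight B L N j * ((j ^_ k)%:R / (N ^_ k)%:R)))).
rewrite (big_cat_nat _ (n := k)) //=; last exact: leqW.
rewrite [X in _ = X + _]big1_seq ?add0r; last first.
  by move=> j /=; rewrite mem_index_iota /= => jk; rewrite ffact_small// mul0r !mulr0.
have reidx (F : nat -> R) : \sum_(k <= i < N.+1) F i = \sum_(i < (N - k).+1) F (i + k)%N.
  by rewrite -{1}[k]add0n big_addn subSn// big_mkord.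
rewrite reidx; apply: eq_bigr => i _.
have hi : (k + i <= N)%N by rewrite -leq_subRL// -ltnS.
have := congr1 (fun n : nat => n%:R : R) (bin_ffactD hi); rewrite !natrM => e.
rewrite /bweight (addnC i k); set l := L _.
rewrite [RHS](_ : _ = l * ('C(N, k + i)%:R * ((k + i) ^_ k)%:R) / (N ^_ k)%:R).
  rewrite e; field; exact: N0.
by field; rewrite N0 expf_neq0.
Qed.

Lemma bweight_sum B L N : 0 < B -> bernstein_positive B L ->
  \sum_(j < N.+1) bweight B L N j = 1.
Proof.
move=> B0 h; have := bp_monomial B0 h (leq0n N).
rewrite expr0 (bp1 h) expr0 mul1r => ->; apply: eq_bigr => j _.
by rewrite !ffactn0 divr1 mulr1.
Qed.

Lemma ffact_ratio_cvg k (e : R) : 0 < e -> exists N0, forall N j : nat,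
  (N0 <= N)%N -> (j <= N)%N ->
  `|(j ^_ k)%:R / (N ^_ k)%:R - (j%:R / N%:R) ^+ k| <= e.
Proof.
elim: k e => [|k IH] e e0.
  by exists 0%N => N j _ _; rewrite !ffactn0 divr1 expr0 subrr normr0 ltW.
have e20 : 0 < e / 2 by rewrite divr_gt0.
have [N1 h1] := IH _ e20.
have [M hM] : exists M : nat, k%:R / (e / 2) < M%:R.
  by exists (Num.truncn (k%:R / (e / 2))).+1; exact: truncnS_gt.
exists (maxn N1 (M + k).+1) => N j; rewrite geq_max => /andP[N1N MN] jN.
have kN : (k < N)%N by apply: leq_trans MN; rewrite ltnS leq_addl.
have N0 : 0 < N%:R :> R by rewrite ltr0n (leq_ltn_trans _ kN).
have Nk0 : 0 < (N - k)%:R :> R by rewrite ltr0n subn_gt0.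
have ff (a b : nat) : (a ^_ k.+1)%:R = (a ^_ k)%:R * (a - k)%:R :> R.
  by rewrite ffactnSr natrM.
rewrite !ff // invfM mulrACA exprSr.
set u := (j ^_ k)%:R / _; set u' := (j - k)%:R / _; set v' := _ ^+ k; set v := _ / N%:R.
have uv : `|u - v'| <= e / 2 by exact: h1.
have v01 : 0 <= v <= 1.
  by rewrite divr_ge0//= ler_pdivrMr// mul1r ler_nat.
have v'1 : `|v'| <= 1.
  by rewrite normrX exprn_ile1// ger0_norm; case/andP: v01.
have u'01 : `|u'| <= 1.
  by rewrite ger0_norm ?divr_ge0// ler_pdivrMr// mul1r ler_nat leq_sub2r.
have u'v : `|u' - v| <= e / 2.
  (* Both cases below err by at most k / (N - k); for j < k the truncated subtraction makes [j - k]
     zero. *)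
  have kM : k%:R / (N - k)%:R <= e / 2.
    rewrite ler_pdivrMr//; move: hM; rewrite ltr_pdivrMr// => hM.
    apply: ltW (lt_le_trans hM _); rewrite mulrC ler_wpM2l ?(ltW e20)// ler_nat.
    by rewrite leq_subRL ?(ltnW kN)// addnC ltnW.
  have [kj|jk] := leqP k j.
    apply: le_trans kM; rewrite /u' /v natrB// natrB ?(ltnW kN)//.
    move: Nk0; rewrite natrB ?(ltnW kN)// => Nk0.
    have hjN : j%:R <= N%:R :> R by rewrite ler_nat.
    rewrite (_ : _ - _ = - (k%:R * (N%:R - j%:R) / N%:R / (N%:R - k%:R))); last first.
      by field; rewrite !gt_eqF.
    rewrite normrN ger0_norm; last first.
      by rewrite !divr_ge0 ?(ltW Nk0)// mulr_ge0// subr_ge0.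
    rewrite ler_pM2r ?invr_gt0// ler_pdivrMr// ler_wpM2l//.
    by rewrite lerBlDr lerDl.
  apply: le_trans kM; rewrite /u' (eqP (ltnW jk : j - k == 0)%N) mul0r sub0r normrN ger0_norm; last by case/andP: v01.
  rewrite /v ler_pM// ?invr_ge0// ?ler_nat ?(ltnW jk)//.
  by rewrite lef_pV2 ?posrE// ler_nat leq_subr.
clearbody u u' v v'.
rewrite (_ : _ - _ = (u - v') * u' + v' * (u' - v)); last by ring.
apply: le_trans (ler_normD _ _) _; rewrite !normrM (splitr e); apply: lerD.
  by rewrite -[e / 2]mulr1; apply: ler_pM.
by rewrite -[e / 2]mul1r; apply: ler_pM.
Qed.

(** [N0] does not depend on [L]. This uniformity gives Weierstrass' theorem when [L] runs over the
    evaluations at points of [0, B]. *)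
Lemma bernstein_approx B q (e : R) : 0 < B -> 0 < e ->
  exists N0, forall N L, (N0 <= N)%N -> bernstein_positive B L ->
  `|L q - \sum_(j < N.+1) bweight B L N j * q.[B * (j%:R / N%:R)]| <= e.
Proof.
move=> B0; pose P p := forall e : R, 0 < e -> exists N0, forall N L, (N0 <= N)%N ->
  bernstein_positive B L ->
  `|L p - \sum_(j < N.+1) bweight B L N j * p.[B * (j%:R / N%:R)]| <= e.
have PD p1 p2 : P p1 -> P p2 -> P (p1 + p2).
  move=> h1 h2 d d0; have d2 : 0 < d / 2 by rewrite divr_gt0.
  have [N1 {}h1] := h1 _ d2; have [N2 {}h2] := h2 _ d2.
  exists (maxn N1 N2) => N L; rewrite geq_max => /andP[n1 n2] hL.
  rewrite (bpD hL); under eq_bigr do rewrite hornerD mulrDr.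
  rewrite big_split /= opprD addrACA (splitr d).
  by apply: le_trans (ler_normD _ _) _; apply: lerD; [exact: h1|exact: h2].
have PZ c p : P p -> P (c *: p).
  move=> h d d0; have c0 : 0 < `|c| + 1 by rewrite ltr_wpDl.
  have [N1 {}h] := h _ (divr_gt0 d0 c0).
  exists N1 => N L n1 hL; rewrite (bpZ hL).
  under eq_bigr do rewrite hornerZ mulrCA.
  rewrite -mulr_sumr -mulrBr normrM.
  apply: (@le_trans _ _ ((`|c| + 1) * (d / (`|c| + 1)))).
    by apply: ler_pM; rewrite ?lerDl//; exact: h.
  by rewrite mulrCA divff ?mulr1// gt_eqF.
have PX k : P 'X^k.
  move=> d d0; have Bk : 0 < B ^+ k by rewrite exprn_gt0.
  have [N1 h1] := ffact_ratio_cvg k (divr_gt0 d0 Bk).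
  exists (maxn N1 k) => N L; rewrite geq_max => /andP[n1 n2] hL.
  rewrite (bp_monomial B0 hL n2) mulr_sumr -sumrB.
  apply: le_trans (ler_norm_sum _ _ _) _.
  rewrite -[leRHS]mul1r -[X in _ <= X * _](bweight_sum N B0 hL) mulr_suml.
  apply: ler_sum => j _; rewrite hornerXn exprMn mulrCA -mulrBr -mulrBr.
  rewrite normrM (ger0_norm (bweight_ge0 _ _ B0 hL)) ler_wpM2l ?bweight_ge0//.
  rewrite normrM gtr0_norm//.
  rewrite mulrC -ler_pdivlMr//.
  apply: h1 => //; rewrite -ltnS; exact: ltn_ord.
move: e; rewrite -/(P q) -[q]coefK poly_def.
elim/big_rec: _ => [|i p _ hp]; last by apply: PD => //; apply: PZ.
by rewrite -(scale0r 1) -[1](expr0 'X); apply: PZ.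
Qed.

Lemma bernstein_positive_ge0 B L q : 0 < B -> bernstein_positive B L ->
  (forall s, 0 <= s <= B -> 0 <= q.[s]) -> 0 <= L q.
Proof.
move=> B0 hL hq; apply/ler_addgt0Pr => e e0.
have [N0 h] := bernstein_approx q B0 e0.
have := h N0.+1 L (leqnSn _) hL; rewrite ler_norml => /andP[h1 _].
suff : 0 <= \sum_(j < N0.+2) bweight B L N0.+1 j * q.[B * (j%:R / N0.+1%:R)] by lra.
apply: sumr_ge0 => j _; rewrite mulr_ge0 ?bweight_ge0// hq//.
rewrite mulr_ge0 ?divr_ge0 ?(ltW B0)//=.
rewrite -[leRHS]mulr1 ler_wpM2l ?(ltW B0)// ler_pdivrMr ?ltr0n// mul1r ler_nat.
by rewrite -ltnS.
Qed.

Lemma bernstein_positive_horner B s : 0 <= s <= B ->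
  bernstein_positive B (fun q => q.[s]).
Proof.
move=> /andP[s0 sB]; split => [p q|c p||j k]; rewrite ?hornerE//.
by rewrite mulr_ge0 ?exprn_ge0// subr_ge0.
Qed.

(** Bernstein's proof. With the modulus of continuity in quadratic form, averaging it over the nodes
    involves only the moments of order 0, 1 and 2 of the weights. *)
Lemma weierstrass_modulus B (f : R -> R) (e : R) : 0 < B -> 0 < e ->
  (forall e, 0 < e -> exists2 M, 0 <= M & forall s u, 0 <= s <= B -> 0 <= u <= B ->
     `|f s - f u| <= e + M * (s - u) ^+ 2) ->
  exists q : {poly R}, forall s, 0 <= s <= B -> `|f s - q.[s]| <= e.
Proof.
move=> B0 e0 hf; have e20 : 0 < e / 2 by rewrite divr_gt0.
have [M M0 {}hf] := hf _ e20.
(* When both moments are within [d], the variance s^2 - 2 s S1 + S2 is at most d (1 + 2B), so that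
   [M] times it is at most e/2. *)
pose d := e / 2 / (M + 1) / (1 + 2 * B).
have d0 : 0 < d by rewrite /d; apply: divr_gt0; [apply: divr_gt0 => //; lra|lra].
have [N1 h1] := bernstein_approx 'X B0 d0.
have [N2 h2] := bernstein_approx 'X^2 B0 d0.
pose N := (maxn N1 N2).+1.
pose node (j : nat) := B * (j%:R / N%:R).
pose w s j := bweight B (fun q => q.[s]) N j.
pose q := \sum_(j < N.+1) (f (node j) * 'C(N, j)%:R / B ^+ N) *:
  ('X^j * (B%:P - 'X) ^+ (N - j)).
exists q => s sB; have hs := bernstein_positive_horner sB.
have {}h1 := h1 N _ (leqW (leq_maxl _ _)) hs.
have {}h2 := h2 N _ (leqW (leq_maxr _ _)) hs.
have w0 j : 0 <= w s j by exact: bweight_ge0.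
have w1 : \sum_(j < N.+1) w s j = 1 by exact: bweight_sum.
have -> : f s - q.[s] = \sum_(j < N.+1) w s j * (f s - f (node j)).
  under [RHS]eq_bigr do rewrite mulrBr.
  rewrite sumrB -mulr_suml w1 mul1r; congr (_ - _).
  rewrite horner_sum; apply: eq_bigr => j _.
  by rewrite hornerZ /w /bweight; ring.
have nodeB (j : 'I_N.+1) : 0 <= node j <= B.
  rewrite /node mulr_ge0 ?divr_ge0 ?(ltW B0)//=.
  rewrite -[leRHS]mulr1 ler_wpM2l ?(ltW B0)// ler_pdivrMr ?ltr0n// mul1r ler_nat.
  by rewrite -ltnS.
apply: le_trans (ler_norm_sum _ _ _) _.
apply: (@le_trans _ _ (\sum_(j < N.+1) w s j * (e / 2 + M * (s - node j) ^+ 2))).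
  by apply: ler_sum => j _; rewrite normrM (ger0_norm (w0 j)) ler_wpM2l// hf.
set S1 := \sum_(j < _) _ in h1; set S2 := \sum_(j < _) _ in h2.
have -> : \sum_(j < N.+1) w s j * (e / 2 + M * (s - node j) ^+ 2) =
  e / 2 + M * (s ^+ 2 - 2 * s * S1 + S2).
  transitivity (\sum_(j < N.+1) ((e / 2 + M * s ^+ 2) * w s j
     - 2 * M * s * (w s j * ('X).[node j]) + M * (w s j * ('X^2).[node j]))).
    by apply: eq_bigr => j _; rewrite hornerX hornerXn; ring.
  rewrite big_split /= sumrB -!mulr_sumr w1 -/S1 -/S2; ring.
move: h1 h2; rewrite hornerX hornerXn !ler_norml => /andP[h1 h1'] /andP[h2 h2'].
case/andP: sB => s0 sB.
have : s ^+ 2 - 2 * s * S1 + S2 <= d * (1 + 2 * B).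
  have : s * (s - S1) <= B * d.
    by apply: (@le_trans _ _ (s * d)); [rewrite ler_wpM2l|rewrite ler_wpM2r// ltW].
  nra.
have -> : d * (1 + 2 * B) = e / 2 / (M + 1).
  by rewrite /d divfK// gt_eqF//; lra.
move=> h; have : M * (e / 2 / (M + 1)) <= e / 2.
  rewrite mulrCA -[leRHS]mulr1 ler_wpM2l ?(ltW e20)// ler_pdivrMr ?ltr_wpDl//.
  by rewrite mul1r lerDl.
have := ler_wpM2l M0 h; lra.
Qed.

End Bernstein.

Import numFieldNormedType.Exports.

(** * Approximation and expectations *)

Section Cdf.
Local Open Scope classical_set_scope.
Context {R : realType} (F : cumulativeBounded (0:R) (1:R)).

Let idR : measurableTypeR R -> R := idfun.

#[local] HB.instance Definition _ :=
  @isMeasurableFun.Build _ _ _ _ idR (@measurable_id _ _ setT).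

(** Taking the distribution of the identity transports the Lebesgue-Stieltjes measure from
    [measurableTypeR R] to [R]. *)
Lemma exists_probability_cdf :
  exists mu : probability R R, forall r, mu `]-oo, r] = (F r)%:E.
Proof.
pose P : probability (measurableTypeR R) R := lebesgue_stieltjes_measure F.
exists (distribution P (idR : {RV P >-> R})) => r.
exact: cdf_lebesgue_stieltjes_id.
Qed.

End Cdf.

Section CompactApproximation.
Local Open Scope classical_set_scope.

Lemma exists_probability_of_cdf (R : realType) (F : R -> R) :
  nondecreasing F -> right_continuous F -> F @ -oo --> (0 : R) -> F @ +oo --> (1 : R) ->
  exists mu : probability R R, forall r, mu `]-oo, r] = (F r)%:E.
Proof.
move=> h1 h2 h3 h4.
pose C1 := isCumulative.Build R _ R F h1 h2.
pose C2 := isCumulativeBounded.Build R 0 1 F h3 h4.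
pose G : cumulativeBounded (0:R) (1:R) := HB.pack F C1 C2.
exact: (exists_probability_cdf G).
Qed.

Section ContinuousReal.
Variable R : realType.
Implicit Types f g : R -> R.

Lemma continuous_cst_real (c : R) : continuous (fun _ : R => c).
Proof. by move=> x; exact: cvg_cst. Qed.

Lemma continuous_idr : continuous (fun s : R => s).
Proof. by move=> x; exact: cvg_id. Qed.

Lemma continuous_subr f g : continuous f -> continuous g -> continuous (fun s => f s - g s).
Proof. by move=> cf cg x; apply: cvgB; [exact: cf|exact: cg]. Qed.

Lemma continuous_mulr f g : continuous f -> continuous g -> continuous (fun s => f s * g s).
Proof. by move=> cf cg x; apply: cvgM; [exact: cf|exact: cg]. Qed.

Lemma continuous_minr f g : continuous f -> continuous g -> continuous (fun s => Num.min (f s) (g s)).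
Proof. by move=> cf cg x; exact: continuous_min (cf x) (cg x). Qed.

Lemma continuous_maxr f g : continuous f -> continuous g -> continuous (fun s => Num.max (f s) (g s)).
Proof. by move=> cf cg x; exact: continuous_max (cf x) (cg x). Qed.

Lemma continuous_sqrtr f : continuous f -> continuous (fun s => Num.sqrt (f s)).
Proof.
move=> cf x; apply: (@continuous_comp _ _ _ f (@Num.sqrt R)); first exact: cf.
exact: sqrt_continuous.
Qed.

Lemma continuous_invr f : continuous f -> (forall s, f s != 0) -> continuous (fun s => (f s)^-1).
Proof. by move=> cf f0 x; apply: cvgV => //; exact: cf. Qed.

End ContinuousReal.

(** Uniform continuity handles |s - u| <= d. Beyond that distance the bound 2K on the oscillation is
    at most (2K / d^2) (s - u)^2. *)
Lemma continuous_modulus (R : realType) (B : R) (f : R -> R) : 0 < B -> continuous f ->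
  forall e, 0 < e -> exists2 M, 0 <= M & forall s u, 0 <= s <= B -> 0 <= u <= B ->
     `|f s - f u| <= e + M * (s - u) ^+ 2.
Proof.
move=> B0 cf e e0.
have [K K0 hK] : exists2 K, 0 <= K & forall s, 0 <= s <= B -> `|f s| <= K.
  have cc : compact (f @` `[0, B]).
    by apply: continuous_compact; [exact: continuous_subspaceT|exact: segment_compact].
  have [M [_ hM]] := compact_bounded cc.
  exists (`|M| + 1) => [|s sB]; first by rewrite addr_ge0.
  apply: (hM (`|M| + 1)); first by rewrite ltr_pwDr// ler_norm.
  by exists s => //=; rewrite in_itv.
have /compact_near_coveringP/(_ R (0^'+) (fun d s => forall u, `|s - u| <= d -> `|f s - f u| <= e)) :=
  @segment_compact R 0 B.
case.
  move=> s _; have /cvgrPdist_le/(_ (e / 2)) := cf s.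
  rewrite divr_gt0// => /(_ isT) /nbhs_ballP[r /= r0 hr].
  exists (ball s (r / 2), [set d | d < r / 2]).
    split => /=; first by apply: nbhsx_ballx; rewrite divr_gt0.
    by apply: nbhs_right_lt; rewrite divr_gt0.
  move=> [v d] /= [bv dr] u vu.
  have h1 : `|f s - f v| <= e / 2.
    by apply: hr; apply: le_ball bv; lra.
  have h2 : `|f s - f u| <= e / 2.
    apply: hr; rewrite /ball /= in bv *.
    rewrite -(subrKA v) (splitr r); apply: le_lt_trans (ler_normD _ _) _.
    by apply: ltrD => //; apply: le_lt_trans vu _.
  rewrite -(subrKA (f s)) (splitr e); apply: le_trans (ler_normD _ _) _.
  by apply: lerD => //; rewrite distrC.
move=> d0 /= d00 hd.
pose d := d0 / 2.
have dp : 0 < d by rewrite divr_gt0.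
have hdd s u : 0 <= s <= B -> `|s - u| <= d -> `|f s - f u| <= e.
  move=> sB su; apply: (hd d) => //=.
  by rewrite sub0r normrN gtr0_norm// ltr_pdivrMr// ltr_pMr// ltr1n.
exists (2 * K / d ^+ 2) => [|s u sB uB].
  by rewrite divr_ge0 ?sqr_ge0// mulr_ge0.
have [su|su] := leP `|s - u| d.
  apply: le_trans (hdd _ _ sB su) _; rewrite lerDl mulr_ge0 ?sqr_ge0//.
  by rewrite divr_ge0 ?sqr_ge0// mulr_ge0.
apply: (@le_trans _ _ (2 * K)).
  apply: le_trans (ler_normB _ _) _.
  by have := hK _ sB; have := hK _ uB; lra.
apply: (@le_trans _ _ (2 * K / d ^+ 2 * (s - u) ^+ 2)); last by rewrite lerDr ltW.
rewrite mulrAC ler_pdivlMr ?exprn_gt0//; apply: ler_wpM2l; first by rewrite mulr_ge0.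
by rewrite -[(s - u) ^+ 2]real_normK ?num_real// ler_sqr ?nnegrE// ltW.
Qed.

Lemma weierstrass (R : realType) (B : R) (f : R -> R) (e : R) : 0 < B -> 0 < e -> continuous f ->
  exists q : {poly R}, forall s, 0 <= s <= B -> `|f s - q.[s]| <= e.
Proof.
move=> B0 e0 cf; apply: weierstrass_modulus => //; exact: continuous_modulus.
Qed.

End CompactApproximation.

(** * Integration against a probability carried by [0, B] *)

Section Expectation.
Local Open Scope classical_set_scope.
Variables (R : realType) (mu : probability R R) (B : R).
Hypothesis B0 : 0 < B.
Hypothesis muB : mu (~` `[0, B]) = 0%E.
Implicit Types (f g : R -> R) (q : {poly R}).

(** Restricting to [[0, B]] makes polynomials bounded, hence integrable; [expect_full] recovers the
    integral over the line. *)
Definition expect f : R := \int[mu]_(s in `[0, B]) f s.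

Definition bmeasurable f :=
  measurable_fun setT f /\ exists M, forall s, 0 <= s <= B -> `|f s| <= M.

Lemma bmeasurable_integrable f : bmeasurable f -> mu.-integrable `[0, B] (EFin \o f).
Proof.
move=> [mf [M hM]]; apply: measurable_bounded_integrable => //.
- by apply: le_lt_trans (probability_le1 _ _) _ => //; rewrite ltry.
- exact: measurable_funS mf.
- exists M; split; first exact: num_real.
  by move=> x Mx s /= sB; rewrite (le_trans _ (ltW Mx))// hM// -in_itv.
Qed.

Lemma continuous_bmeasurable f : continuous f -> bmeasurable f.
Proof.
move=> cf; split; first exact: continuous_measurable_fun.
have [K K0 hK] := @continuous_modulus R B f B0 cf 1 ltr01.
exists (`|f 0| + 1 + K * B ^+ 2) => s sB.
have h0 : (0 : R) <= 0 <= B by rewrite lexx ltW.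
have := hK s 0 sB h0; rewrite subr0 => h.
have : `|f s| <= `|f s - f 0| + `|f 0|.
  by rewrite -{1}(subrK (f 0) (f s)) ler_normD.
have : K * s ^+ 2 <= K * B ^+ 2.
  by case/andP: sB => s0 sB; rewrite ler_wpM2l// ler_sqr ?nnegrE// (le_trans s0).
lra.
Qed.

Lemma bmeasurable_cst c : bmeasurable (fun=> c).
Proof. exact/continuous_bmeasurable/continuous_cst_real. Qed.

Lemma bmeasurableD f g : bmeasurable f -> bmeasurable g -> bmeasurable (fun s => f s + g s).
Proof.
move=> [mf [M hM]] [mg [K hK]]; split; first exact: measurable_funD.
by exists (M + K) => s sB; apply: le_trans (ler_normD _ _) _; rewrite lerD ?hM ?hK.
Qed.

Lemma bmeasurableZ c f : bmeasurable f -> bmeasurable (fun s => c * f s).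
Proof.
move=> [mf [M hM]]; split; first exact: measurable_funM.
by exists (`|c| * M) => s sB; rewrite normrM ler_wpM2l// hM.
Qed.

Lemma bmeasurable_sum n (f : 'I_n -> R -> R) :
  (forall i, bmeasurable (f i)) -> bmeasurable (fun s => \sum_(i < n) f i s).
Proof.
elim: n f => [|n IH] f hf.
  rewrite (_ : (fun _ => _) = fun=> 0); first exact: bmeasurable_cst.
  by apply/funext => s; rewrite big_ord0.
rewrite (_ : (fun _ => _) = fun s => \sum_(i < n) f (widen_ord (leqnSn n) i) s + f ord_max s).
  by apply: bmeasurableD => //; exact: IH.
by apply/funext => s; rewrite big_ord_recr.
Qed.

Lemma expectD f g : bmeasurable f -> bmeasurable g ->
  expect (fun s => f s + g s) = expect f + expect g.
Proof. by move=> hf hg; rewrite /expect RintegralD//; exact: bmeasurable_integrable. Qed.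

Lemma expectZ c f : bmeasurable f -> expect (fun s => c * f s) = c * expect f.
Proof. by move=> hf; rewrite /expect RintegralZl//; exact: bmeasurable_integrable. Qed.

Lemma le_expect f g : bmeasurable f -> bmeasurable g ->
  (forall s, 0 <= s <= B -> f s <= g s) -> expect f <= expect g.
Proof.
move=> hf hg fg; rewrite /expect le_Rintegral//; try exact: bmeasurable_integrable.
Qed.

Lemma mu_segment : mu `[0, B] = 1%E.
Proof.
have h : mu setT = (mu `[0%R, B] + mu (~` `[0%R, B]))%E.
  rewrite -measureU ?setUv// ?setICr//; exact: measurableC.
by move: h; rewrite muB adde0 probability_setT.
Qed.

Lemma expect_cst c : expect (fun=> c) = c.
Proof. 
rewrite /expect Rintegral_cst// -[RHS]mulr1; congr (_ * _).
exact: (congr1 fine mu_segment). Qed.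

Lemma expect_full f : measurable_fun setT f ->
  fine (\int[mu]_s (f s)%:E) = expect f.
Proof.
move=> mf; rewrite /expect /Rintegral [in RHS]integral_mkcond; congr fine.
apply: ae_eq_integral => //=.
- exact/measurable_EFinP.
- by apply/(measurable_restrictT _ _).1 => //; apply/measurable_EFinP; exact: measurable_funS mf.
exists (~` `[0, B]); split => //; first exact: measurableC.
move=> s /= hs /= sB; apply: hs => _; rewrite patchE.
by case: ifPn => // /negP; rewrite inE.
Qed.

Lemma expect_sum n (f : 'I_n -> R -> R) : (forall i, bmeasurable (f i)) ->
  expect (fun s => \sum_(i < n) f i s) = \sum_(i < n) expect (f i).
Proof.
elim: n f => [|n IH] f hf.
  rewrite big_ord0 -[RHS](expect_cst 0).
  by congr expect; apply/funext => s; rewrite big_ord0.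
rewrite big_ord_recr /= -(IH (fun i => f (widen_ord (leqnSn n) i)))// -expectD//; last exact: bmeasurable_sum.
by congr expect; apply/funext => s; rewrite big_ord_recr.
Qed.

End Expectation.

(** * The Hausdorff moment problem *)

Section Hausdorff.
Local Open Scope classical_set_scope.
Variables (R : realType) (B : R) (L : {poly R} -> R).
Hypotheses (B0 : 0 < B) (hL : bernstein_positive B L).
Implicit Types (p q g : {poly R}) (s u : R).

Let LD := bpD hL.
Let LZ := bpZ hL.

Let LN p : L (- p) = - L p.
Proof. by rewrite -scaleN1r LZ mulN1r. Qed.

Let LB p q : L (p - q) = L p - L q.
Proof. by rewrite LD LN. Qed.

Let LC c : L c%:P = c.
Proof. by rewrite -[c%:P]mulr1 mul_polyC LZ (bp1 hL) mulr1. Qed.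

Let le_L p q : (forall u, 0 <= u <= B -> p.[u] <= q.[u]) -> L p <= L q.
Proof.
move=> h; rewrite -subr_ge0 -LB; apply: bernstein_positive_ge0 B0 hL _ => u /h.
by rewrite !hornerE subr_ge0.
Qed.

(** Polynomials that majorise on [0, B] the indicator of ]-oo, s]. The infimum of [L] over them is
    the upper measure of this half-line, as in Daniell's construction, and serves as distribution
    function. *)
Definition dominates_tail s : set {poly R} := [set p |
  (forall u, 0 <= u <= B -> 0 <= p.[u]) /\
  (forall u, 0 <= u <= B -> u <= s -> 1 <= p.[u])].

Definition moment_cdf s : R := inf (L @` dominates_tail s).

Let F := moment_cdf.

Let dominates1 s : dominates_tail s 1.
Proof. by split=> u _; rewrite hornerE. Qed.

Let lb0 s : lbound (L @` dominates_tail s) 0.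
Proof. by move=> _ [p [p0 _] <-]; exact: bernstein_positive_ge0 p0. Qed.

Let has_infF s : has_inf (L @` dominates_tail s).
Proof. by split; [exists (L 1), 1|exists 0; exact: lb0]. Qed.

Let F_le s p : dominates_tail s p -> F s <= L p.
Proof. by move=> h; apply: ge_inf; [exact: (has_infF s).2|exists p]. Qed.

Let F_approx s (e : R) : 0 < e -> exists2 p, dominates_tail s p & L p <= F s + e.
Proof.
move=> e0; have [_ [p hp <-] h] := inf_adherent e0 (has_infF s).
by exists p => //; exact: ltW.
Qed.

Let F_ge0 s : 0 <= F s.
Proof. by apply: lb_le_inf; [exact: (has_infF s).1|exact: lb0]. Qed.

Let F_le1 s : F s <= 1.
Proof. by rewrite -(bp1 hL); apply: F_le; exact: dominates1. Qed.

Let F_nondecreasing : nondecreasing F.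
Proof.
move=> s u su; apply: lb_le_inf; first exact: (has_infF u).1.
move=> _ [p [p0 p1] <-]; apply: F_le; split=> // v vB vs.
by apply: p1 => //; exact: le_trans su.
Qed.

Let F_lt0 s : s < 0 -> F s = 0.
Proof.
move=> s0; apply/le_anti; rewrite F_ge0 andbT -[leRHS](LC 0) F_le//.
split=> u; rewrite hornerC// => /andP[u0 _] us.
by have := lt_le_trans s0 u0; rewrite ltNge us.
Qed.

Let F_geB s : B <= s -> F s = 1.
Proof.
move=> Bs; apply/le_anti; rewrite F_le1 /=; apply: lb_le_inf; first exact: (has_infF s).1.
move=> _ [p [p0 p1] <-]; rewrite -(bp1 hL); apply: le_L => u uB; rewrite hornerE p1//.
by case/andP: uB => _ /le_trans; apply.
Qed.

Let F_right_continuous : right_continuous F.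
Proof.
move=> x; apply/cvgrPdist_le => e e0; have e20 : 0 < e / 2 by rewrite divr_gt0.
have [p [p0 p1] hp] := F_approx x e20.
(* A nearly optimal majorant for [x], raised by e/2, still works slightly to the right of [x]. Only
   points of [0, B] count: there are none just right of x if x < 0 or B <= x, and otherwise [p] is
   continuous with p(x) >= 1. *)
have [d d0 hd] : exists2 d : R, 0 < d & forall u, x < u < x + d -> 0 <= u <= B -> 1 <= p.[u] + e / 2.
  have [x0|x0] := ltP x 0.
    exists (- x); first by rewrite oppr_gt0.
    by move=> u /andP[_]; rewrite subrr => u0 /andP[]; rewrite leNgt u0.
  have [xB|Bx] := ltP x B; last first.
    by exists 1 => // u /andP[xu _] /andP[_ uB]; have := lt_le_trans xu uB; rewrite ltNge Bx.
  have /cvgrPdist_le/(_ _ e20) := @continuous_horner _ p x.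
  move=> /nbhs_ballP[d /= d0 hd]; exists d => // u /andP[xu ud] uB.
  have : `|p.[x] - p.[u]| <= e / 2.
    by apply: hd; rewrite /ball /= ltr_distlC; apply/andP; split; lra.
  have : 1 <= p.[x] by apply: p1; rewrite ?x0 ?lexx// ltW.
  by rewrite ler_norml => h /andP[_ h2]; lra.
have : \forall y \near x^'+, x < y < x + d.
  near=> y; apply/andP; split; first by near: y; exact: nbhs_right_gt.
  by near: y; apply: nbhs_right_lt; rewrite ltrDl.
apply: filterS => y /andP[xy yd].
rewrite distrC ger0_norm; last by rewrite subr_ge0 F_nondecreasing// ltW.
rewrite lerBlDl; apply: (@le_trans _ _ (L (p + (e / 2)%:P))); last first.
  by rewrite LD LC; lra.
apply: F_le; split=> u uB; rewrite hornerD hornerC.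
  by rewrite addr_ge0 ?p0// ltW.
move=> uy; have [ux|xu] := leP u x; first by rewrite ler_wpDr ?p1// ltW.
by apply: hd => //; rewrite xu (le_lt_trans uy).
Unshelve. all: by end_near.
Qed.

Let F_Ny : F @ -oo --> (0 : R).
Proof.
apply: cvg_near_cst; near=> s; apply: F_lt0.
by near: s; apply: nbhs_ninfty_lt; exact: num_real.
Unshelve. all: by end_near.
Qed.

Let F_y : F @ +oo --> (1 : R).
Proof.
apply: cvg_near_cst; near=> s; apply: F_geB.
by near: s; apply: nbhs_pinfty_ge; exact: num_real.
Unshelve. all: by end_near.
Qed.

(** * Stieltjes sums on a uniform grid *)

Section Grid.
Variables (g : {poly R}) (N : nat).
Hypothesis g_mono : forall s u, 0 <= s -> s <= u -> g.[s] <= g.[u].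
Hypothesis N0 : (0 < N)%N.

Let c (i : nat) : R := B / N%:R * i%:R.
Let D (i : nat) : R := g.[c i.+1] - g.[c i].

Let c_ge0 i : 0 <= c i.
Proof. by rewrite /c mulr_ge0// divr_ge0// ltW. Qed.

Let c_le i : c i <= c i.+1.
Proof. by rewrite /c ler_wpM2l ?ler_nat// divr_ge0// ltW. Qed.

Let D_ge0 i : 0 <= D i.
Proof. by rewrite subr_ge0 g_mono. Qed.

Let cN : c N = B.
Proof. by rewrite /c divfK// pnatr_eq0 -lt0n. Qed.

Let telescope_g u : 0 <= u <= B ->
  g.[B] - g.[u] = \sum_(i < N) (g.[Num.max (c i.+1) u] - g.[Num.max (c i) u]).
Proof.
move=> /andP[u0 uB].
rewrite -(big_mkord xpredT (fun i => g.[Num.max (c i.+1) u] - g.[Num.max (c i) u])).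
rewrite telescope_sumr// cN (max_idPl uB) /c mulr0.
by rewrite (max_idPr u0).
Qed.

(** Cell i contributes all of [D i] to g(B) - g(u) when u <= c_i and nothing when u >= c_(i+1). Up
    to one cell, g(B) - g is thus a positive combination of indicators of half-lines, which is what
    [F] measures. *)
Lemma grid_lower (f : 'I_N -> R) u : 0 <= u <= B ->
  (forall i, f i <= 1) -> (forall i : 'I_N, c i < u -> f i <= 0) ->
  \sum_(i < N) D i * f i <= g.[B] - g.[u].
Proof.
move=> uB f1 f0; rewrite telescope_g//; apply: ler_sum => i _.
have u0 : 0 <= u by case/andP: uB.
have [ui|ui] := leP u (c i).
  rewrite (max_idPl (le_trans ui (c_le i))).
  by rewrite -/(D i) -[leRHS]mulr1 ler_wpM2l.
apply: (@le_trans _ _ 0); first by rewrite mulr_ge0_le0// f0.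
rewrite subr_ge0; by apply: g_mono; rewrite // le_max lexx orbT.
Qed.

Lemma grid_upper (f : 'I_N -> R) u : 0 <= u <= B ->
  (forall i, 0 <= f i) -> (forall i : 'I_N, u <= c i.+1 -> 1 <= f i) ->
  g.[B] - g.[u] <= \sum_(i < N) D i * f i.
Proof.
move=> uB f0 f1; rewrite telescope_g//; apply: ler_sum => i _.
have u0 : 0 <= u by case/andP: uB.
have [ui|ui] := leP u (c i.+1).
  apply: (@le_trans _ _ (D i)); last by rewrite -[leLHS]mulr1 ler_wpM2l// f1.
  by rewrite lerB// g_mono// le_max lexx.
rewrite (max_idPr (le_trans (c_le i) (ltW ui))) subrr.
by rewrite mulr_ge0.
Qed.

Lemma L_grid_upper : g.[B] - L g <= \sum_(i < N) D i * F (c i.+1).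
Proof.
apply/ler_addgt0Pr => e e0; pose d := e / (\sum_(i < N) D i + 1).
have S0 : 0 <= \sum_(i < N) D i by apply: sumr_ge0.
have d0 : 0 < d by rewrite divr_gt0// ltr_wpDl.
have /choice[p hp] : forall i : 'I_N, exists p, dominates_tail (c i.+1) p /\ L p <= F (c i.+1) + d.
  by move=> i; have [p] := F_approx (c i.+1) d0; exists p.
apply: (@le_trans _ _ (L (\sum_(i < N) D i *: p i))).
  rewrite -[g.[B]]LC -LB; apply: le_L => u uB; rewrite !hornerE horner_sum.
  under [leRHS]eq_bigr do rewrite hornerZ.
  apply: (grid_upper (f := fun i => (p i).[u])) => // i.
    by have [[h _] _] := hp i; apply: h.
  by have [[_ h] _] := hp i; apply: h.
rewrite (bp_sum _ _ hL); under eq_bigr do rewrite LZ.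
apply: (@le_trans _ _ (\sum_(i < N) (D i * F (c i.+1) + D i * d))).
  by apply: ler_sum => i _; rewrite -mulrDr ler_wpM2l//; have [] := hp i.
rewrite big_split /= lerD2l -mulr_suml mulrC /d mulrAC ler_pdivrMr ?ltr_wpDl//.
by rewrite ler_pM2l// lerDl.
Qed.

(* A continuous cutoff equal to 1 left of [c i - B / N] and to 0 right of [c i]
   is approximated by polynomials. *)
Lemma L_grid_lower : \sum_(i < N) D i * F (c i - B / N%:R) <= g.[B] - L g.
Proof.
apply/ler_addgt0Pr => e e0; pose d := e / (\sum_(i < N) D i + 1) / 2.
have S0 : 0 <= \sum_(i < N) D i by apply: sumr_ge0.
have d0 : 0 < d by rewrite !divr_gt0// ltr_wpDl.
have BN : 0 < B / N%:R by rewrite divr_gt0// ltr0n.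
pose phi (i : 'I_N) (u : R) : R := Num.min 1 (Num.max 0 ((c i - u) / (B / N%:R))).
have cphi i : continuous (phi i).
  apply: continuous_minr; first exact: continuous_cst_real.
  apply: continuous_maxr; first exact: continuous_cst_real.
  apply: continuous_mulr; last exact: continuous_cst_real.
  by apply: continuous_subr; [exact: continuous_cst_real|exact: continuous_idr].
have /choice[q hq] : forall i : 'I_N, exists q : {poly R}, forall u, 0 <= u <= B -> `|phi i u - q.[u]| <= d.
  by move=> i; apply: weierstrass.
have {}hq i u : 0 <= u <= B -> phi i u - d <= (q i).[u] <= phi i u + d.
  by move=> uB; have := hq i u uB; rewrite ler_norml => /andP[h1 h2]; apply/andP; split; lra.
have hF (i : 'I_N) : F (c i - B / N%:R) <= L (q i) + d.
  rewrite -[d in leRHS]LC -LD; apply: F_le; split=> u uB; rewrite hornerD hornerC.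
    have /andP[h _] := hq i u uB; have : 0 <= phi i u by rewrite /phi le_min ler01 le_max lexx.
    lra.
  move=> uc; have /andP[h _] := hq i u uB.
  have : 1 <= phi i u.
    by rewrite /phi le_min lexx /= le_max ler_pdivlMr// mul1r; apply/orP; right; lra.
  lra.
apply: (@le_trans _ _ (L (\sum_(i < N) D i *: q i) + \sum_(i < N) D i * d)).
  rewrite (bp_sum _ _ hL) -big_split /=; apply: ler_sum => i _.
  by rewrite LZ -mulrDr ler_wpM2l.
apply: (@le_trans _ _ (L (g.[B]%:P - g + (\sum_(i < N) D i * d)%:P) + \sum_(i < N) D i * d)).
  rewrite lerD2r; apply: le_L => u uB; rewrite !hornerE horner_sum.
  apply: (@le_trans _ _ (\sum_(i < N) D i * phi i u + \sum_(i < N) D i * d)).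
    rewrite -big_split /=; apply: ler_sum => i _; rewrite hornerZ -mulrDr ler_wpM2l//.
    by have /andP[] := hq i u uB.
  rewrite lerD2r; apply: grid_lower => // i; first by rewrite /phi ge_min lexx.
  by move=> ci; rewrite /phi ge_min ge_max lexx /= ler_pdivrMr// mul0r subr_le0 (ltW ci) orbT.
rewrite LD LB !LC -addrA lerD2l -mulr_suml /d.
set S := \sum_(i < N) D i in S0 *.
have -> : S * (e / (S + 1) / 2) + S * (e / (S + 1) / 2) = S / (S + 1) * e.
  by field; lra.
by rewrite -[leRHS]mul1r; apply: ler_wpM2r; [exact: ltW|rewrite ler_pdivrMr; lra].
Qed.

(** * The same bounds for the measure with distribution function [F] *)

Section GridMeasure.
Variable mu : probability R R.
Hypothesis muB : mu (~` `[0, B]) = 0%E.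
Hypothesis muF : forall r, mu `]-oo, r] = (F r)%:E.
Local Notation E := (expect mu B).

Let ind (r : R) : R -> R := \1_(`]-oo, r]).

Let indE r u : ind r u = ((u <= r)%R)%:R.
Proof. by rewrite /ind indicE mem_setE in_itv. Qed.

Let ind_bmeas r : bmeasurable B (ind r).
Proof.
split; first by apply: measurable_indic; exact: measurable_itv.
by exists 1 => s _; rewrite indE; case: (s <= r); rewrite ?normr1 ?normr0.
Qed.

Let E_ind r : E (ind r) = F r.
Proof.
rewrite -expect_full//; last by have [] := ind_bmeas r.
rewrite (_ : integral _ _ _ = (F r)%:E)//.
by rewrite integral_indic// setIT; exact: muF.
Qed.

Let sum_bmeas (f : 'I_N -> R) :
  bmeasurable B (fun s => \sum_(i < N) D i * ind (f i) s).
Proof. by apply: bmeasurable_sum => // i; exact: bmeasurableZ. Qed.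

Let E_sum (f : 'I_N -> R) :
  E (fun s => \sum_(i < N) D i * ind (f i) s) = \sum_(i < N) D i * F (f i).
Proof.
rewrite expect_sum//; last by move=> i; exact: bmeasurableZ.
by apply: eq_bigr => i _; rewrite expectZ ?E_ind.
Qed.

Let hg : bmeasurable B (horner g).
Proof. by apply: continuous_bmeasurable => //; exact: continuous_horner. Qed.

Let Bg_bmeas : bmeasurable B (fun s => g.[B] + (-1) * g.[s]).
Proof. by apply: bmeasurableD; [exact: bmeasurable_cst|exact: bmeasurableZ]. Qed.

Let E_Bg : E (fun s => g.[B] + (-1) * g.[s]) = g.[B] - E (horner g).
Proof.
rewrite expectD//; [|exact: bmeasurable_cst|exact: bmeasurableZ].
by rewrite expect_cst// expectZ// mulN1r.
Qed.

Lemma E_grid_upper : g.[B] - E (horner g) <= \sum_(i < N) D i * F (c i.+1).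
Proof.
rewrite -E_Bg -E_sum; apply: le_expect => // u uB; rewrite mulN1r.
apply: grid_upper => // i; rewrite indE.
by move=> ->.
Qed.

Lemma E_grid_lower : \sum_(i < N) D i * F (c i - B / N%:R) <= g.[B] - E (horner g).
Proof.
rewrite -E_Bg -E_sum; apply: le_expect => // u uB; rewrite mulN1r.
apply: grid_lower => // i; rewrite indE; first by case: (u <= _); rewrite ?ler01 ?lexx.
move=> ciu; rewrite (_ : (u <= _) = false)//; apply/negbTE; rewrite -ltNge.
by apply: le_lt_trans ciu; rewrite gerBl divr_ge0// ltW.
Qed.

(** Both g(B) - L g and g(B) - E g lie between the Stieltjes sums that sample [F] at c_i - B/N and
    at c_(i+1). The samples are two steps apart and [F] stays in [0, 1], so these sums differ by at
    most 2e. *)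
Lemma grid_gap (e : R) : (forall i : 'I_N, D i <= e) ->
  `|L g - E (horner g)| <= 2 * e.
Proof.
move=> De.
have h : \sum_(i < N) D i * F (c i.+1) - \sum_(i < N) D i * F (c i - B / N%:R) <= 2 * e.
  rewrite -sumrB.
  apply: (@le_trans _ _ (\sum_(i < N) e * ((F (c i.+1) - F (c i)) + (F (c i) - F (c i - B / N%:R))))).
    apply: ler_sum => i _; rewrite -mulrBr addrA subrK; apply: ler_wpM2r => //.
    rewrite subr_ge0 F_nondecreasing//; apply: le_trans (c_le i).
    by rewrite gerBl divr_ge0// ltW.
  have e0 : 0 <= e by apply: le_trans (De (Ordinal N0)).
  rewrite -mulr_sumr mulrC ler_wpM2r// big_split /=.
  rewrite -(big_mkord xpredT (fun i => F (c i.+1) - F (c i))) telescope_sumr//.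
  rewrite -(big_mkord xpredT (fun i => F (c i) - F (c i - B / N%:R))).
  pose c' (i : nat) := F (B / N%:R * (i%:R - 1)).
  rewrite (eq_bigr (fun i => c' i.+1 - c' i)); last first.
    move=> i _; rewrite /c' -natr1 addrK /c; congr (_ - F _); ring.
  rewrite telescope_sumr//.
  have := F_le1 (c N); have := F_ge0 (c 0%N).
  have := F_le1 (B / N%:R * (N%:R - 1)); have := F_ge0 (B / N%:R * (0%:R - 1)).
  rewrite /c'; lra.
have := E_grid_lower; have := E_grid_upper; have := L_grid_upper; have := L_grid_lower.
by rewrite ler_norml => *; apply/andP; split; lra.
Qed.

End GridMeasure.
End Grid.

Lemma hausdorff_moment :
  exists mu : probability R R, mu (~` `[0, B]) = 0%E /\
    forall k, expect mu B (fun s => s ^+ k) = L 'X^k.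
Proof.
have [mu muF] := exists_probability_of_cdf F_nondecreasing F_right_continuous F_Ny F_y.
have muB : mu (~` `[0, B]) = 0%E.
  apply/negligibleP; first exact: measurableC.
  (* There may be an atom at 0, so the negative half-line is exhausted by closed half-lines on which
     [F] vanishes. *)
  pose U : set R := (\bigcup_n `]-oo, - n.+1%:R^-1]) `|` ~` `]-oo, B].
  apply: (@negligibleS _ _ _ _ U).
    move=> s /= sB; have [Bs|sB'] := ltP B s.
      by right => /=; rewrite in_itv /= leNgt Bs.
    left; have s0 : s < 0 by rewrite ltNge; apply: contra_notN sB => s0; rewrite in_itv /= s0.
    exists (Num.truncn (- s)^-1) => //=; rewrite in_itv /= lerNr.
    rewrite invf_ple ?posrE ?ltr0n ?oppr_gt0// ltW//; exact: truncnS_gt.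
  apply: negligibleU.
    apply: negligible_bigcup => n; apply/negligibleP => //.
    by rewrite [LHS]muF F_lt0// oppr_lt0 invr_gt0.
  apply/negligibleP; first exact: measurableC.
  by rewrite [LHS]probability_setC// [X in (1 - X)%E]muF F_geB// subee.
exists mu; split=> // k; apply/eqP; rewrite eq_sym -subr_eq0 -normr_le0; apply/ler_addgt0Pr => e e0.
have e4 : 0 < e / 4 by rewrite divr_gt0.
have [M M0 hM] := @continuous_modulus R B (fun s => s ^+ k) B0 (@exprn_continuous R k) _ e4.
(* Then M (B/N)^2 <= e/4, and s^k grows by at most e/2 across each cell. *)
pose N := (Num.truncn (M * B ^+ 2 / (e / 4))).+1.
have hN : M * B ^+ 2 / (e / 4) < N%:R by exact: truncnS_gt.
have N0 : 0 < N%:R :> R by rewrite ltr0n.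
rewrite add0r; apply: (@le_trans _ _ (2 * (e / 2))); last by lra.
have -> : (fun s => s ^+ k) = horner 'X^k :> (R -> R).
  by apply/funext => s; rewrite hornerXn.
apply: (@grid_gap _ N _ _ mu muB muF) => // [s u s0 su|i].
  by rewrite !hornerXn lerXn2r ?nnegrE// (le_trans s0).
rewrite !hornerXn; set a := _ * _; set b := _ * _.
have node (j : nat) : (j <= N)%N -> 0 <= B / N%:R * j%:R <= B.
  move=> jN; rewrite mulr_ge0 ?divr_ge0 ?(ltW B0)//=.
  by rewrite mulrAC ler_pdivrMr// ler_wpM2l ?(ltW B0)// ler_nat.
have := hM a b (node _ (ltn_ord i)) (node _ (ltnW (ltn_ord i))).
have -> : a - b = B / N%:R by rewrite /a /b -mulrBr -natr1 addrAC subrr add0r mulr1.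
move=> h; apply: le_trans (ler_norm _) (le_trans h _).
suff : M * (B / N%:R) ^+ 2 <= e / 4 by lra.
apply: (@le_trans _ _ (M * B ^+ 2 / N%:R)).
  rewrite expr_div_n mulrA ler_wpM2l ?mulr_ge0 ?(ltW B0)//.
  by rewrite lef_pV2 ?posrE ?exprn_gt0// expr2 -natrM ler_nat leq_pmull.
by move: hN; rewrite ltr_pdivrMr// ler_pdivrMr// => hN; lra.
Qed.

End Hausdorff.

(** * Interpolation *)

Section Cutoffs.
Local Open Scope classical_set_scope.
Variable R : realType.
Implicit Types (B c k e s : R) (f g : R -> R) (p q : {poly R}).

(** The two factors are approximated separately because [tr_dual_horner] needs p^2 and q^2 as well
    as the product. *)
Lemma weierstrass_pair B f g e : 0 < B -> 0 < e -> continuous f -> continuous g ->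
  exists p q, forall s, 0 <= s <= B ->
    [/\ `|p.[s] * q.[s] - f s * g s| <= e,
        `|p.[s] ^+ 2 - f s ^+ 2| <= e & `|q.[s] ^+ 2 - g s ^+ 2| <= e].
Proof.
move=> B0 e0 cf cg.
have bnd (h : R -> R) : continuous h -> exists2 K, 0 <= K & forall s, 0 <= s <= B -> `|h s| <= K.
  move=> ch; have [_ [K hK]] := continuous_bmeasurable B0 ch; exists K => //.
  by apply: le_trans (hK 0 _); rewrite // lexx ltW.
have [K K0 hK] := bnd _ cf; have [M M0 hM] := bnd _ cg.
pose d := Num.min 1 (e / (K + M + K + M + 1)).
have D0 : 0 < K + M + K + M + 1 by lra.
have d0 : 0 < d by rewrite lt_min ltr01 divr_gt0.
have d1 : d <= 1 by rewrite ge_min lexx.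
have dD : d * (K + M + K + M + 1) <= e.
  by rewrite -ler_pdivlMr// ge_min lexx orbT.
have [p hp] := weierstrass B0 d0 cf; have [q hq] := weierstrass B0 d0 cg.
exists p, q => s sB.
move: (hp s sB) (hq s sB) (hK s sB) (hM s sB); rewrite distrC (distrC (g s)).
move: (f s) (g s) p.[s] q.[s] => u v a b au bv uK vM.
have key (x y z t X Y : R) : `|x - z| <= d -> `|y - t| <= d -> `|z| <= X -> `|t| <= Y ->
    0 <= X -> 0 <= Y -> X + Y <= K + M + K + M -> `|x * y - z * t| <= e.
  move=> xz yt zX tY X0 Y0 XY; apply: le_trans dD.
  rewrite (_ : _ - _ = (x - z) * (y - t) + (z * (y - t) + (x - z) * t)); last by ring.
  apply: le_trans (ler_normD _ _) _.
  have : `|(x - z) * (y - t)| <= d * 1 by rewrite normrM ler_pM// (le_trans yt).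
  have : `|z * (y - t) + (x - z) * t| <= X * d + d * Y.
    by apply: le_trans (ler_normD _ _) _; rewrite !normrM lerD// ler_pM.
  nra.
rewrite !expr2; split.
- by apply: (@key a b u v K M) => //; lra.
- by apply: (@key a a u u K K) => //; lra.
- by apply: (@key b b v v M M) => //; lra.
Qed.

(** A continuous version of f / sqrt s; the maximum changes nothing when [f] vanishes for sqrt s <
    k. *)
Lemma continuous_over_max k f : 0 < k -> continuous f ->
  continuous (fun s => f s / Num.max (Num.sqrt s) k).
Proof.
move=> k0 cf; apply: continuous_mulr => //; apply: continuous_invr.
  by apply: continuous_maxr; [exact/continuous_sqrtr/continuous_idr|exact: continuous_cst_real].
by move=> s; rewrite gt_eqF// lt_max k0 orbT.
Qed.

Lemma sqrt_le_bound B s : 0 <= s <= B ->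
  [/\ 0 <= Num.sqrt s, Num.sqrt s ^+ 2 = s & Num.sqrt s <= 1 + B].
Proof.
move=> /andP[s0 sB]; have v2 := sqr_sqrtr s0; have v0 := sqrtr_ge0 s.
by split => //; nra.
Qed.

(* [p * q] approximates a smoothing of the function equal to [1 / sqrt s] for
   [sqrt s > k] and to [0] elsewhere, so that [x * (p * q)(x^* x)] is close to the
   partial isometry supported on the spectral subspace [|x| > k]. *)
Lemma dual_cutoff B k e : 0 < B -> 0 < k -> 0 < e ->
  exists p q, forall s, 0 <= s <= B ->
    s * (p.[s] * q.[s]) ^+ 2 <= (1 + e) ^+ 2 /\
    Num.max 0 (Num.sqrt s - k) <=
      s * (p.[s] * q.[s]) - k * ((q.[s] ^+ 2 + s * p.[s] ^+ 2) / 2) + e.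
Proof.
move=> B0 k0 e0.
have e20 : 0 < e / 2 by rewrite divr_gt0.
(* A ramp from 0 to 1 as sqrt s goes from k to k + e/2. With [q] close to th and [p] to th / sqrt s,
   the right-hand side of the second bound is close to (sqrt s - k) th^2 + e. *)
pose th s := Num.min 1 (Num.max 0 ((Num.sqrt s - k) / (e / 2))).
have cth : continuous th.
  apply: continuous_minr; first exact: continuous_cst_real.
  apply: continuous_maxr; first exact: continuous_cst_real.
  apply: continuous_mulr; last exact: continuous_cst_real.
  apply: continuous_subr; last exact: continuous_cst_real.
  exact/continuous_sqrtr/continuous_idr.
(* The approximation errors s n and k n (1 + s) / 2 then add up to at most e/2. *)
pose n := e / 2 / ((1 + B) * (1 + k)).
have n0 : 0 < n by rewrite divr_gt0// mulr_gt0//; lra.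
have nE : n * ((1 + B) * (1 + k)) = e / 2.
  by rewrite /n divfK// gt_eqF// mulr_gt0//; lra.
clearbody n.
have [p [q h]] := weierstrass_pair B0 n0 (continuous_over_max k0 cth) cth.
exists p, q => s sB; have [] := h s sB.
have [v0 v2 vB] := sqrt_le_bound sB.
have [s0 sB'] := andP sB.
have m_gt0 : 0 < Num.max (Num.sqrt s) k by rewrite lt_max k0 orbT.
have th01 : 0 <= th s <= 1.
  by rewrite /th le_min ler01 le_max lexx ge_min lexx.
have thm : th s = 0 \/ Num.max (Num.sqrt s) k = Num.sqrt s.
  have [vk|vk] := leP (Num.sqrt s) k; last by right.
  left; rewrite /th (max_idPl _) ?(min_idPr _)//.
  by rewrite ler_pdivrMr// mul0r subr_le0.
have thk : Num.max 0 (Num.sqrt s - k) - e / 2 <= (Num.sqrt s - k) * th s ^+ 2.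
  have [vk|vk] := leP (Num.sqrt s) k.
    rewrite (max_idPl _); last by rewrite subr_le0.
    rewrite /th (max_idPl _) ?(min_idPr _)//; last first.
      by rewrite ler_pdivrMr// mul0r subr_le0.
    by rewrite expr0n mulr0; lra.
  rewrite (max_idPr _); last by rewrite subr_ge0 ltW.
  have [h1|h1] := leP 1 ((Num.sqrt s - k) / (e / 2)).
    rewrite /th (max_idPr _) ?(min_idPl _)// ?(le_trans _ h1)//; lra.
  move: h1; rewrite ltr_pdivrMr// mul1r => h1.
  have : 0 <= (Num.sqrt s - k) * th s ^+ 2 by rewrite mulr_ge0 ?sqr_ge0// subr_ge0 ltW.
  lra.
move: thm m_gt0 thk th01; set m := Num.max (Num.sqrt s) k; move: (th s) => t.
set v := Num.sqrt s in v0 v2 vB *; clearbody v m.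
move: p.[s] q.[s] => a b thm m0 thk /andP[t0 t1].
rewrite -v2 in s0 sB' *.
have tm : v * (t / m) = t.
  case: thm => [->|mv]; first by rewrite mul0r mulr0.
  by rewrite mv mulrCA divff ?mulr1// -mv gt_eqF.
move: tm; move: (t / m) => w vw {thm}.
rewrite !ler_norml => /andP[h1 h2] /andP[h3 h4] /andP[h5 h6].
have vn : v * n <= e.
  have : v * n <= (1 + B) * n by rewrite ler_wpM2r// ltW.
  have : 0 <= k * (n * (1 + B)) by rewrite mulr_ge0 ?(ltW k0)// mulr_ge0 ?(ltW n0)//; lra.
  lra.
have Bn : v ^+ 2 * n <= B * n by rewrite ler_wpM2r// ltW.
split.
  rewrite -exprMn -[leLHS]real_normK ?num_real// ler_sqr ?nnegrE//; last lra.
  have tt : v * (w * t) = t ^+ 2 by rewrite mulrA vw expr2.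
  have tt1 : t ^+ 2 <= 1 by rewrite expr_le1.
  have : v * (a * b) <= v * (w * t + n) by rewrite ler_wpM2l//; lra.
  have : v * (w * t - n) <= v * (a * b) by rewrite ler_wpM2l//; lra.
  have := sqr_ge0 t.
  by rewrite ler_norml mulrBr mulrDr tt => *; apply/andP; split; lra.
have tt : v ^+ 2 * (w * t) = v * t ^+ 2 by rewrite -vw; ring.
have tt' : v ^+ 2 * w ^+ 2 = t ^+ 2 by rewrite -exprMn vw.
have i1 : v ^+ 2 * (w * t - n) <= v ^+ 2 * (a * b) by rewrite ler_wpM2l//; lra.
have i2 : v ^+ 2 * a ^+ 2 <= v ^+ 2 * (w ^+ 2 + n) by rewrite ler_wpM2l//; lra.
rewrite mulrBr tt in i1; rewrite mulrDr tt' in i2.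
have i3 : k * ((b ^+ 2 + v ^+ 2 * a ^+ 2) / 2) <= k * ((t ^+ 2 + n + (t ^+ 2 + B * n)) / 2).
  by rewrite ler_wpM2l ?(ltW k0)//; lra.
have i4 : 0 <= k * n * (1 + B) by rewrite mulr_ge0 ?mulr_ge0 ?(ltW n0) ?(ltW k0)//; lra.
lra.
Qed.

(* Here [x * (p * q)(x^* x)] is close to [u (|x| - c)_+] for the polar
   decomposition [x = u |x|]. *)
Lemma primal_cutoff B c e : 0 < B -> 0 < c -> 0 < e ->
  exists p q, forall s, 0 <= s <= B ->
    s * (1 - p.[s] * q.[s]) ^+ 2 <= (c + e) ^+ 2 /\
    (q.[s] ^+ 2 + s * p.[s] ^+ 2) / 2 <= Num.max 0 (Num.sqrt s - c) + e.
Proof.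
move=> B0 c0 e0.
(* With [q] close to h and [p] to h / sqrt s, both q^2 and s p^2 approximate the hinge h^2, while s
   (1 - pq)^2 approximates min(sqrt s, c)^2. *)
pose h s := Num.sqrt (Num.max 0 (Num.sqrt s - c)).
have ch : continuous h.
  apply: continuous_sqrtr; apply: continuous_maxr; first exact: continuous_cst_real.
  apply: continuous_subr; last exact: continuous_cst_real.
  exact/continuous_sqrtr/continuous_idr.
pose n := e / (1 + B).
have B1 : 0 < 1 + B by lra.
have n0 : 0 < n by rewrite divr_gt0.
have nE : n * (1 + B) = e by rewrite /n divfK// gt_eqF.
clearbody n.
have [p [q H]] := weierstrass_pair B0 n0 (continuous_over_max c0 ch) ch.
exists p, q => s sB; have [] := H s sB.
have [v0 v2 vB] := sqrt_le_bound sB.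
have [s0 sB'] := andP sB.
have m_gt0 : 0 < Num.max (Num.sqrt s) c by rewrite lt_max c0 orbT.
have h2 : h s ^+ 2 = Num.max 0 (Num.sqrt s - c) by rewrite sqr_sqrtr// le_max lexx.
have thm : (h s = 0 /\ Num.max (Num.sqrt s) c = c /\ Num.sqrt s <= c) \/
    (Num.max (Num.sqrt s) c = Num.sqrt s /\ h s ^+ 2 = Num.sqrt s - c /\ c < Num.sqrt s).
  have [vk|vk] := leP (Num.sqrt s) c; [left|right].
    by split=> //; rewrite /h (max_idPl _) ?sqrtr0// subr_le0.
  by rewrite h2 (max_idPr _)// subr_ge0 ltW.
rewrite -h2; move: thm m_gt0; set m := Num.max (Num.sqrt s) c; move: (h s) => t.
set v := Num.sqrt s in v0 v2 vB *; clearbody v m.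
move: p.[s] q.[s] => a b thm m0.
rewrite -v2 in s0 sB' *.
have tm : v * (t / m) = t.
  case: thm => [[-> _]|[mv _]]; first by rewrite mul0r mulr0.
  by rewrite mv mulrCA divff ?mulr1// -mv gt_eqF.
have t2 : 0 <= v - t ^+ 2 <= c.
  case: thm => [[-> [_ vc]]|[_ [-> _]]]; last by rewrite opprB addrC subrK lexx ltW.
  by rewrite expr0n subr0 v0.
move: tm; move: (t / m) => w vw {thm}.
rewrite !ler_norml => /andP[h1 h1'] /andP[h3 h4] /andP[h5 h6].
have vn : v * n <= e.
  have : v * n <= (1 + B) * n by rewrite ler_wpM2r// ltW.
  lra.
have Bn : v ^+ 2 * n <= B * n by rewrite ler_wpM2r// ltW.
split.
  rewrite -exprMn -[leLHS]real_normK ?num_real// ler_sqr ?nnegrE//; last lra.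
  have tt : v * (w * t) = t ^+ 2 by rewrite mulrA vw expr2.
  have : v * (a * b) <= v * (w * t + n) by rewrite ler_wpM2l//; lra.
  have : v * (w * t - n) <= v * (a * b) by rewrite ler_wpM2l//; lra.
  case/andP: t2 => t2 t2'.
  by rewrite ler_norml !mulrBr mulrDr tt mulr1 => *; apply/andP; split; lra.
have tt' : v ^+ 2 * w ^+ 2 = t ^+ 2 by rewrite -exprMn vw.
have i2 : v ^+ 2 * a ^+ 2 <= v ^+ 2 * (w ^+ 2 + n) by rewrite ler_wpM2l//; lra.
rewrite mulrDr tt' in i2.
have := n0; lra.
Qed.

End Cutoffs.

(** * Spectral distributions and the hinge inequality *)

Section SpectralMeasure.
Local Open Scope classical_set_scope.
Variables (R : realType) (A : algType R) (star : A -> A) (tr : A -> R).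
Hypothesis T : tracial star tr.
Implicit Types (x y z : A) (B c e : R) (p q : {poly R}) (mu nu : probability R R).

Local Notation "x ^#" := (star x) (at level 2, format "x ^#").

Definition spectral x mu B := [/\ 0 < B, mu (~` `[0, B]) = 0%E &
  forall k, expect mu B (fun s => s ^+ k) = tr ((x^# * x) ^+ k)].

Lemma spectral_exists x c : 0 < c -> opbound star tr x c ->
  exists mu, spectral x mu (c ^+ 2).
Proof.
move=> c0 hx; pose L q := tr (horner_alg (x^# * x) q).
have c20 : 0 < c ^+ 2 by rewrite exprn_gt0.
have hL : bernstein_positive (c ^+ 2) L.
  split=> [p q|b p||j k]; rewrite /L.
  - by rewrite rmorphD /= (tracial_trD T).
  - by rewrite linearZ /= -scalerAl mul1r (tracial_trZ T).
  - by rewrite rmorph1 (tracial_tr1 T).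
  - exact: (tr_bernstein_ge0 T).
have [mu [muB h]] := hausdorff_moment c20 hL.
exists mu; split=> // k; by rewrite h /L rmorphXn /= horner_algX.
Qed.

Lemma horner_bmeasurable B q : 0 < B -> bmeasurable B (horner q).
Proof. by move=> B0; apply: continuous_bmeasurable => //; exact: continuous_horner. Qed.

Lemma spectral_horner x mu B q : spectral x mu B ->
  tr (horner_alg (x^# * x) q) = expect mu B (horner q).
Proof.
move=> [B0 muB h].
have bX i : bmeasurable B (fun s => s ^+ i : R).
  by apply: continuous_bmeasurable => //; exact: exprn_continuous.
rewrite -[in LHS](coefK q) poly_def rmorph_sum /= (tr_sum T).
rewrite (_ : horner q = fun s => \sum_(i < size q) q`_i * s ^+ i); last first.
  by apply/funext => s; rewrite horner_coef.
rewrite expect_sum//; last by move=> i; exact: bmeasurableZ.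
apply: eq_bigr => i _; rewrite expectZ// h linearZ /= -scalerAl mul1r (tracial_trZ T).
by rewrite rmorphXn /= horner_algX.
Qed.

(** In place of the spectral mapping theorem: the moments of x q(a) are the integrals of (s
    q(s)^2)^k, at most c^(2k), and [opbound_mul_horner] turns this growth into an operator bound. *)
Lemma spectral_opbound x mu B q c : spectral x mu B -> 0 < c ->
  (forall s, 0 <= s <= B -> s * q.[s] ^+ 2 <= c ^+ 2) ->
  opbound star tr (x * horner_alg (x^# * x) q) c.
Proof.
move=> hx c0 h; have [B0 muB _] := hx; apply: (opbound_mul_horner T (K := 1)) => // k.
rewrite (spectral_horner _ hx) mul1r -[leRHS](expect_cst muB).
apply: le_expect => //; [exact: horner_bmeasurable|exact: bmeasurable_cst|] => s sB.
rewrite horner_exp hornerM hornerX horner_exp; have [s0 _] := andP sB.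
by apply: lerXn2r; rewrite ?h// nnegrE ?sqr_ge0// mulr_ge0// sqr_ge0.
Qed.

Lemma continuous_hinge c : continuous (fun s : R => Num.max 0 (Num.sqrt s - c)).
Proof.
apply: continuous_maxr; first exact: continuous_cst_real.
apply: continuous_subr; last exact: continuous_cst_real.
exact/continuous_sqrtr/continuous_idr.
Qed.

Lemma hinge_bmeasurable B c : 0 < B -> bmeasurable B (fun s => Num.max 0 (Num.sqrt s - c)).
Proof. by move=> B0; apply: continuous_bmeasurable => //; exact: continuous_hinge. Qed.

Section Interpolation.
Variables (M : A -> A) (C : R).
Hypothesis C0 : 0 < C.
Hypothesis MD : forall x y, M (x + y) = M x + M y.
Hypothesis M_sym : forall x y, tr ((M x)^# * y) = tr (x^# * M y).
Hypothesis M_op : forall x c, 0 < c -> opbound star tr x c -> opbound star tr (M x) (C * c).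

(* Split [x = x1 + x2] at height [c] of [|x|] and test [M x] against [z], close to
   the partial isometry on [|M x| > C c]: the piece [M x2] is paired through the
   operator norm and [M x1], moved to [M z], through the trace norm of [x1]. *)
Lemma hinge_bound x mu nu B B' c : 0 < c ->
  spectral x mu B -> spectral (M x) nu B' ->
  expect nu B' (fun s => Num.max 0 (Num.sqrt s - C * c)) <=
  C * expect mu B (fun s => Num.max 0 (Num.sqrt s - c)).
Proof.
move=> c0 hx hy; have [B0 muB _] := hx; have [B'0 nuB _] := hy.
set Ey := expect nu B'; set Ex := expect mu B.
set Hx := Ex _.
have Hx0 : 0 <= Hx.
  rewrite -(expect_cst muB 0); apply: le_expect => //.
  - exact: bmeasurable_cst.
  - exact: hinge_bmeasurable.
  - by move=> s _; rewrite le_max lexx.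
suff main e : 0 < e -> e <= 1 ->
    Ey (fun s => Num.max 0 (Num.sqrt s - C * c)) <= C * ((1 + e) * (Hx + e)) + e + C * e.
  apply/ler_addgt0Pr => e e0.
  pose d := Num.min 1 (e / (C * (2 + Hx) + 1 + C)).
  have D0 : 0 < C * (2 + Hx) + 1 + C by rewrite addr_gt0// addr_gt0// mulr_gt0//; lra.
  have d0 : 0 < d by rewrite lt_min ltr01 divr_gt0.
  have d1 : d <= 1 by rewrite ge_min lexx.
  have dD : d * (C * (2 + Hx) + 1 + C) <= e.
    by rewrite -ler_pdivlMr// ge_min lexx orbT.
  apply: le_trans (main d d0 d1) _.
  have : C * (d * d) <= C * (d * 1) by rewrite ler_wpM2l ?(ltW C0)// ler_wpM2l// ltW.
  nra.
(* The bounded piece [x2] only has norm at most c + e, so [M x] is cut at C (c + e); moving the cut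
   back to C c costs C e. *)
move=> e0 e1; pose k := C * (c + e).
have k0 : 0 < k by rewrite mulr_gt0// addr_gt0.
have [p [q hpq]] := dual_cutoff B'0 k0 e0.
have [p' [q' hpq']] := primal_cutoff B0 c0 e0.
set y := M x in hy *.
pose ax := x^# * x; pose ay := y^# * y.
pose z := y * horner_alg ay (p * q).
pose x1 := x * horner_alg ax (p' * q').
pose x2 := x - x1.
have z_op : opbound star tr z (1 + e).
  apply: (spectral_opbound hy); first by rewrite addr_gt0.
  by move=> s /hpq[h _]; rewrite hornerM.
have x2_op : opbound star tr x2 (c + e).
  rewrite (_ : x2 = x * horner_alg ax (1 - p' * q')); last first.
    by rewrite rmorphB rmorph1 mulrBr mulr1.
  apply: (spectral_opbound hx); first by rewrite addr_gt0.
  move=> s /hpq'[h _]; rewrite hornerD hornerN hornerM hornerC. exact: h.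
have xE : x = x1 + x2 by rewrite /x2 addrC subrK.
(* [W] and [W'] dominate the trace norms of [z] and [x1]. The term k W subtracted by [dual_cutoff]
   is the bound on the pairing of [z] with [M x2], so only the cost C (1 + e) W' of [M x1]
   remains. *)
pose W := (tr (horner_alg ay (q ^+ 2)) + tr (horner_alg ay ('X * p ^+ 2))) / 2.
pose W' := (tr (horner_alg ax (q' ^+ 2)) + tr (horner_alg ax ('X * p' ^+ 2))) / 2.
have zy : tr (z^# * y) = tr (horner_alg ay ('X * (p * q))).
  rewrite -[X in _ * X]mulr1 -[X in _ * (_ * X)](rmorph1 (horner_alg ay)).
  by rewrite (star_mul_horner T) mulr1.
have b2 : tr (z^# * M x2) <= k * W.
  rewrite (tr_conjE T); apply: (tr_dual_horner T); first exact: ltW.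
  by apply: M_op => //; rewrite addr_gt0.
have b1 : tr (z^# * M x1) <= C * (1 + e) * W'.
  rewrite -M_sym; apply: (tr_dual_horner T); first by rewrite mulr_ge0 ?ltW// addr_gt0.
  by apply: M_op => //; rewrite addr_gt0.
have W'le : W' <= Hx + e.
  rewrite /W' !(spectral_horner _ hx) -expectD//; try exact: horner_bmeasurable.
  rewrite mulrC -expectZ//; last by apply: bmeasurableD; exact: horner_bmeasurable.
  rewrite /Hx -(expect_cst muB e) -expectD//; [|exact: hinge_bmeasurable|exact: bmeasurable_cst].
  apply: le_expect => //.
  - by apply: bmeasurableZ; apply: bmeasurableD; exact: horner_bmeasurable.
  - by apply: bmeasurableD; [exact: hinge_bmeasurable|exact: bmeasurable_cst].
  - by move=> s /hpq'[_]; rewrite !hornerE mulrC.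
have Eyle : Ey (fun s => Num.max 0 (Num.sqrt s - k)) <= tr (z^# * y) - k * W + e.
  have <- : Ey (horner ('X * (p * q) - (k / 2) *: (q ^+ 2 + 'X * p ^+ 2))) = tr (z^# * y) - k * W.
    rewrite /Ey -(spectral_horner _ hy) zy rmorphB /= (trB T) linearZ /= -scalerAl mul1r.
    by rewrite (tracial_trZ T) rmorphD /= (tracial_trD T) /W; congr (_ - _); lra.
  rewrite -[X in _ + X](expect_cst nuB) -expectD//; [|exact: horner_bmeasurable|exact: bmeasurable_cst].
  apply: le_expect => //.
  - exact: hinge_bmeasurable.
  - by apply: bmeasurableD; [exact: horner_bmeasurable|exact: bmeasurable_cst].
  - by move=> s /hpq[_ h]; rewrite !(hornerD, hornerN, hornerZ, hornerM, hornerX, horner_exp); lra.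
have : Ey (fun s => Num.max 0 (Num.sqrt s - C * c)) <=
    Ey (fun s => Num.max 0 (Num.sqrt s - k)) + C * e.
  rewrite -[X in _ + X](expect_cst nuB) -expectD//; [|exact: hinge_bmeasurable|exact: bmeasurable_cst].
  apply: le_expect => //; first exact: hinge_bmeasurable.
    by apply: bmeasurableD; [exact: hinge_bmeasurable|exact: bmeasurable_cst].
  move=> s _; rewrite ge_max; apply/andP; split.
    by rewrite addr_ge0 ?le_max ?lexx// mulr_ge0 ?ltW.
  apply: (@le_trans _ _ (Num.sqrt s - k + C * e)); first by rewrite /k; lra.
  by rewrite lerD2r le_max lexx orbT.
have : C * (1 + e) * W' <= C * ((1 + e) * (Hx + e)).
  by rewrite -mulrA ler_wpM2l ?(ltW C0)// ler_wpM2l// ltW// addr_gt0.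
have : tr (z^# * y) = tr (z^# * M x1) + tr (z^# * M x2).
  by rewrite -(tracial_trD T) -mulrDr -MD -xE.
lra.
Qed.

End Interpolation.
End SpectralMeasure.

(** * From hinges to powers *)

Section ConvexHinge.
Local Open Scope classical_set_scope.
Variables (R : realType) (phi : R -> R) (V K : R).
Hypotheses (V0 : 0 < V) (K0 : 0 <= K) (phi0 : phi 0 = 0).
Hypothesis phi_mono : forall u v, 0 <= u -> u <= v -> phi u <= phi v.
Hypothesis phi_mid : forall u v, 0 <= u -> 0 <= v -> 2 * phi ((u + v) / 2) <= phi u + phi v.
Hypothesis phi_lip : forall u v, 0 <= u -> u <= v -> v <= V -> phi v - phi u <= K * (v - u).

Section Grid.
Variable N : nat.
Hypothesis N0 : (0 < N)%N.
Let d : R := V / N%:R.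
Let c (i : nat) : R := d * i%:R.
Let slope (i : nat) : R := (phi (c i.+1) - phi (c i)) / d.
(** Slope increments, that is second differences: a discrete form of phi(v) = phi'(0) v + \int
    phi''(c) (v - c)_+ dc. *)
Let m (i : nat) : R := if i is j.+1 then slope i - slope j else slope 0.
Let hinge (v : R) (i : nat) : R := Num.max 0 (v - c i).

Let d0 : 0 < d.
Proof. by rewrite divr_gt0// ltr0n. Qed.

Let cS i : c i.+1 = c i + d.
Proof. by rewrite /c -natr1 mulrDr mulr1. Qed.

Let c0 : c 0 = 0.
Proof. by rewrite /c mulr0. Qed.

Let c_ge0 i : 0 <= c i.
Proof. by rewrite /c mulr_ge0// ltW. Qed.

Let c_le i : c i <= c i.+1.
Proof. by rewrite cS lerDl ltW. Qed.

Let cN : c N = V.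
Proof. by rewrite /c /d divfK// pnatr_eq0 -lt0n. Qed.

Lemma hinge_weight_ge0 i : 0 <= m i.
Proof.
case: i => [|i] /=; first by rewrite divr_ge0 ?(ltW d0)// subr_ge0 phi_mono.
rewrite -mulrBl divr_ge0 ?(ltW d0)//.
have := phi_mid (c_ge0 i) (c_ge0 i.+2).
have -> : (c i + c i.+2) / 2 = c i.+1 by rewrite !cS; lra.
lra.
Qed.

Let hinge_abel v n : \sum_(i < n.+1) m i * hinge v i =
  \sum_(i < n.+1) slope i * (hinge v i - hinge v i.+1) + slope n * hinge v n.+1.
Proof.
elim: n => [|n IH]; first by rewrite !big_ord_recr !big_ord0 /= !add0r; ring.
by rewrite big_ord_recr IH [in RHS]big_ord_recr /=; ring.
Qed.

Let telescope_phi v : 0 <= v <= V ->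
  phi v = \sum_(i < N) (phi (Num.min (c i.+1) v) - phi (Num.min (c i) v)).
Proof.
move=> /andP[v0 vV].
rewrite -(big_mkord xpredT (fun i => phi (Num.min (c i.+1) v) - phi (Num.min (c i) v))).
by rewrite telescope_sumr// cN (min_idPr vV) c0 (min_idPl v0) phi0 subr0.
Qed.

(** The error is charged only to the cell containing [v], through a difference of indicators. Hence
    the errors of all cells telescope to K d rather than N K d. *)
Let step v i : (i < N)%N -> 0 <= v ->
  `|slope i * (hinge v i - hinge v i.+1) - (phi (Num.min (c i.+1) v) - phi (Num.min (c i) v))|
  <= K * d * ((c i < v)%R%:R - (c i.+1 < v)%R%:R).
Proof.
move=> iN v0; rewrite /hinge.
have cNi : c i.+1 <= V by rewrite -cN /c ler_wpM2l ?(ltW d0)// ler_nat.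
have hs : slope i * d = phi (c i.+1) - phi (c i) by rewrite /slope divfK// gt_eqF.
have s0 : 0 <= slope i by rewrite divr_ge0 ?(ltW d0)// subr_ge0 phi_mono.
have hK : phi (c i.+1) - phi (c i) <= K * d.
  by apply: le_trans (phi_lip _ _ _) _ => //; rewrite cS addrAC subrr add0r.
have [vi|iv] := leP v (c i).
  rewrite (min_idPr (le_trans vi (c_le i))) !(max_idPl _) ?subr_le0 ?(le_trans vi)//.
  rewrite !subrr mulr0 subr0 normr0 ltNge (le_trans vi (c_le i)) /= subrr mulr0.
  done.
rewrite (max_idPr _) ?subr_ge0 ?(ltW iv)//.
have [vi1|iv1] := leP v (c i.+1).
  rewrite (max_idPl _) ?subr_le0// !subr0 mulr1.
  have h1 : slope i * (v - c i) <= slope i * d by rewrite ler_wpM2l// lerBlDl -cS.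
  have h2 : 0 <= slope i * (v - c i) by rewrite mulr_ge0// subr_ge0 ltW.
  have h3 : phi (c i) <= phi v by rewrite phi_mono// ltW.
  have h4 : phi v <= phi (c i.+1) by rewrite phi_mono.
  by rewrite ler_norml; apply/andP; split; lra.
rewrite (max_idPr _) ?subr_ge0 ?(ltW iv1)//.
have -> : v - c i - (v - c i.+1) = d by rewrite cS; ring.
by rewrite hs !subrr normr0 mulr0.
Qed.

Lemma hinge_approx v : 0 <= v <= V -> `|\sum_(i < N) m i * hinge v i - phi v| <= K * d.
Proof.
move=> vV; have [v0 vV'] := andP vV.
have := hinge_abel v N.-1; rewrite (prednK N0) => ->; rewrite telescope_phi//.
have -> : hinge v N = 0 by apply/max_idPl; rewrite cN subr_le0.
rewrite mulr0 addr0.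
rewrite -sumrB; apply: le_trans (ler_norm_sum _ _ _) _.
apply: (@le_trans _ _ (\sum_(i < N) K * d * ((c i < v)%R%:R - (c i.+1 < v)%R%:R))).
  by apply: ler_sum => i _; apply: step.
rewrite -mulr_sumr -[leRHS]mulr1 ler_wpM2l//; first exact: mulr_ge0 (ltW d0).
rewrite -(big_mkord xpredT (fun i => (c i < v)%R%:R - (c i.+1 < v)%R%:R)).
rewrite (eq_bigr (fun i => - (c i.+1 < v)%R%:R - - (c i < v)%R%:R)); last first.
  by move=> i _; rewrite opprK addrC.
rewrite telescope_sumr// opprK.
by case: (c N < v)%R; case: (c 0 < v)%R; rewrite ?oppr0 ?addr0 ?add0r ?lexx ?ler01//; lra.
Qed.

End Grid.

Lemma convex_hinge_approx e : 0 < e -> exists N (m c : 'I_N -> R),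
  (forall i, 0 <= m i /\ 0 <= c i) /\
  forall v, 0 <= v <= V -> `|\sum_(i < N) m i * Num.max 0 (v - c i) - phi v| <= e.
Proof.
move=> e0; pose N := (Num.truncn (K * V / e)).+1.
have hN : K * V / e < N%:R by exact: truncnS_gt.
have N0 : (0 < N)%N by [].
clearbody N; have N0' : 0 < N%:R :> R by rewrite ltr0n.
exists N; eexists; eexists; split; last first.
  move=> v vV; apply: le_trans (hinge_approx N0 vV) _.
  rewrite mulrA ler_pdivrMr//; move: hN; rewrite ltr_pdivrMr// => hN; lra.
move=> i; split; first exact: (hinge_weight_ge0 N0).
by rewrite /= mulr_ge0// divr_ge0// ltW.
Qed.

End ConvexHinge.

Section Power.
Local Open Scope classical_set_scope.
Variable R : realType.
Implicit Types (p u v : R).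

Lemma powR_midpoint p u v : 1 <= p -> 0 <= u -> 0 <= v ->
  2 * powR ((u + v) / 2) p <= powR u p + powR v p.
Proof.
move=> p1 u0 v0.
suff : powR (2^-1 * u + (1 - 2^-1) * v) p <= 2^-1 * powR u p + (1 - 2^-1) * powR v p.
  have -> : 2^-1 * u + (1 - 2^-1) * v = (u + v) / 2 by lra.
  lra.
apply: (convex_powR p1 (Itv01 _ _)) => //=; rewrite ?inE /= ?in_itv /= ?u0 ?v0//; lra.
Qed.

Lemma powR_lipschitz p u v V : 1 <= p -> 0 <= u -> u <= v -> v <= V ->
  powR v p - powR u p <= p * powR V (p - 1) * (v - u).
Proof.
move=> p1 u0 uv vV.
have p10 : 0 <= p - 1 by rewrite subr_ge0.
have [->|uv'] := eqVneq u v; first by rewrite !subrr mulr0.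
have {uv'} uv' : u < v by rewrite lt_neqAle uv'.
have v0 : 0 < v by apply: le_lt_trans uv'.
have hV (w : R) : 0 <= w -> w <= v -> powR w (p - 1) <= powR V (p - 1).
  move=> w0 wv; apply: ge0_ler_powR => //; rewrite ?nnegrE//.
    by rewrite (le_trans (ltW v0)).
  exact: le_trans wv vV.
(* The mean value theorem is applied where [powR] is differentiable, u > 0; at u = 0 the bound is
   v^p = v^(p-1) v. *)
have [u00|u00] := eqVneq u 0.
  rewrite u00 powR0 ?subr0; last by rewrite gt_eqF// (lt_le_trans ltr01).
  have -> : powR v p = powR v (p - 1) * v.
    by rewrite -[X in _ * X](powRr1 (ltW v0)) -powRD ?subrK// (gt_eqF v0) implybT.
  rewrite ler_wpM2r ?(ltW v0)//; apply: le_trans (hV v (ltW v0) (lexx v)) _.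
  by rewrite ler_peMl// powR_ge0.
have u0' : 0 < u by rewrite lt_def u00.
have [||c + ->] := @MVT_segment R (fun x => powR x p) (fun x : R => p * powR x (p - 1)) u v uv.
- move=> x; rewrite in_itv /= => /andP[ux _]; apply: is_derive1_powR; exact: lt_trans ux.
- apply: derivable_within_continuous => x; rewrite in_itv /= => /andP[ux _].
  apply: derivable_powR; rewrite in_itv /= andbT; exact: lt_le_trans ux.
rewrite in_itv /= => /andP[uc cv].
rewrite ler_wpM2r ?subr_ge0// ler_wpM2l//; first by rewrite (le_trans ler01).
by rewrite hV// (le_trans u0).
Qed.

End Power.

(** * Integrating the hinge inequality to powers *)

Section HingePower.
Local Open Scope classical_set_scope.
Variables (R : realType) (mu nu : probability R R) (B B' C p : R).
Hypotheses (B0 : 0 < B) (B'0 : 0 < B') (C0 : 0 < C) (p1 : 1 <= p).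
Hypotheses (muB : mu (~` `[0, B]) = 0%E) (nuB : nu (~` `[0, B']) = 0%E).
Hypothesis hinge_le : forall c, 0 < c ->
  expect nu B' (fun s => Num.max 0 (Num.sqrt s - C * c)) <=
  C * expect mu B (fun s => Num.max 0 (Num.sqrt s - c)).

Lemma powR_sqrt s : 0 <= s -> powR s (p / 2) = powR (Num.sqrt s) p.
Proof. by move=> s0; rewrite -powR12_sqrt// -powRrM mulrC. Qed.

Lemma powR_bmeasurable b : 0 < b -> bmeasurable b (fun s => powR s (p / 2)).
Proof.
move=> b0; split; first exact: measurable_powR.
exists (powR b (p / 2)) => s /andP[s0 sb]; rewrite ger0_norm ?powR_ge0//.
have p20 : 0 <= p / 2 by rewrite divr_ge0// (le_trans _ p1).
by apply: ge0_ler_powR; rewrite ?nnegrE// ltW.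
Qed.

(** The first grid node is c = 0, which [hinge_le] excludes; the hinge at e / C replaces it at cost
    e. *)
Let hinge_le0 c : 0 <= c ->
  expect nu B' (fun s => Num.max 0 (Num.sqrt s - C * c)) <=
  C * expect mu B (fun s => Num.max 0 (Num.sqrt s - c)).
Proof.
rewrite le_eqVlt => /orP[/eqP <-|]; last exact: hinge_le.
apply/ler_addgt0Pr => e e0; have eC : 0 < e / C by rewrite divr_gt0.
have eCE : C * (e / C) = e by rewrite mulrCA divff ?mulr1// gt_eqF.
apply: (@le_trans _ _ (expect nu B' (fun s => Num.max 0 (Num.sqrt s - C * (e / C))) + e)).
  rewrite -[X in _ + X](expect_cst nuB) -expectD//; [|exact: hinge_bmeasurable|exact: bmeasurable_cst].
  apply: le_expect => //; first exact: hinge_bmeasurable.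
    by apply: bmeasurableD; [exact: hinge_bmeasurable|exact: bmeasurable_cst].
  move=> s _; rewrite eCE mulr0 subr0 (max_idPr (sqrtr_ge0 _)) -lerBlDr.
  by rewrite le_max lexx orbT.
rewrite lerD2r; apply: le_trans (hinge_le eC) _; rewrite ler_wpM2l ?(ltW C0)//.
apply: le_expect => //; try exact: hinge_bmeasurable.
move=> s _; rewrite subr0 (max_idPr (sqrtr_ge0 _)) ge_max sqrtr_ge0 /=.
by rewrite gerBl ltW.
Qed.

Lemma power_le : expect nu B' (fun s => powR s (p / 2)) <=
  powR C p * expect mu B (fun s => powR s (p / 2)).
Proof.
(* An interval [0, V] containing both sqrt s for s <= B and sqrt s / C for s <= B'. *)
pose V := Num.max (Num.sqrt B) (Num.sqrt B' / C).
have V0 : 0 < V by rewrite lt_max sqrtr_gt0 B0.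
pose phi (v : R) := powR v p.
have p0 : 0 < p by apply: lt_le_trans p1.
have Cp0 : 0 < powR C p by exact: powR_gt0.
have CpV : (powR C p)^-1 = powR C^-1 p.
  have Cp : powR C p != 0 by rewrite gt_eqF.
  by apply: (mulfI Cp); rewrite mulfV// -powRM ?invr_ge0 ?(ltW C0)// divff ?powR1// gt_eqF.
have K0 : 0 <= p * powR V (p - 1) by rewrite mulr_ge0 ?powR_ge0// ltW.
have ph0 : phi 0 = 0 by rewrite /phi powR0// gt_eqF.
have phm u v : 0 <= u -> u <= v -> phi u <= phi v.
  by move=> u0 uv; apply: ge0_ler_powR; rewrite ?nnegrE ?(ltW p0)// (le_trans u0).
have ph2 u v : 0 <= u -> 0 <= v -> 2 * phi ((u + v) / 2) <= phi u + phi v.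
  exact: powR_midpoint.
have phl u v : 0 <= u -> u <= v -> v <= V -> phi v - phi u <= p * powR V (p - 1) * (v - u).
  exact: powR_lipschitz.
(* After division by C^p, phi(sqrt s / C) under [nu] is compared with phi(sqrt s) under [mu], hinge
   by hinge, through (sqrt s / C - c)_+ = C^-1 (sqrt s - C c)_+. *)
rewrite -ler_pdivrMl// -expectZ//; last exact: powR_bmeasurable.
apply/ler_addgt0Pr => e e0; have e20 : 0 < e / 2 by rewrite divr_gt0.
have [N [m [c [mc h]]]] := convex_hinge_approx V0 K0 ph0 phm ph2 phl e20.
pose hx i s := m i * Num.max 0 (Num.sqrt s - c i).
pose hy i s := m i * C^-1 * Num.max 0 (Num.sqrt s - C * c i).
have hxb i : bmeasurable B (hx i) by apply: bmeasurableZ; exact: hinge_bmeasurable.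
have hyb i : bmeasurable B' (hy i) by apply: bmeasurableZ; exact: hinge_bmeasurable.
apply: (@le_trans _ _ (expect nu B' (fun s => \sum_(i < N) hy i s) + e / 2)).
  rewrite -[X in _ + X](expect_cst nuB) -expectD//; [|exact: bmeasurable_sum|exact: bmeasurable_cst].
  apply: le_expect => //.
  - by apply: bmeasurableZ; exact: powR_bmeasurable.
  - by apply: bmeasurableD; [exact: bmeasurable_sum|exact: bmeasurable_cst].
  move=> s /andP[s0 sB].
  have sV : 0 <= Num.sqrt s / C <= V.
    rewrite divr_ge0 ?sqrtr_ge0 ?(ltW C0)//= le_max ler_wpM2r ?invr_ge0 ?(ltW C0)// ?orbT//.
    by rewrite ler_wsqrtr.
  have := h _ sV; rewrite ler_norml => /andP[h1 _].
  rewrite (_ : \sum_(i < N) hy i s = \sum_(i < N) m i * Num.max 0 (Num.sqrt s / C - c i)); last first.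
    apply: eq_bigr => i _; rewrite /hy -mulrA maxr_pMr ?invr_ge0 ?(ltW C0)// mulr0.
    by congr (_ * Num.max _ _); field; rewrite gt_eqF.
  rewrite (_ : (powR C p)^-1 * powR s (p / 2) = phi (Num.sqrt s / C)); last first.
    by rewrite /phi powRM ?sqrtr_ge0 ?invr_ge0 ?(ltW C0)// powR_sqrt// mulrC CpV.
  lra.
rewrite expect_sum//.
apply: (@le_trans _ _ (expect mu B (fun s => \sum_(i < N) hx i s) + e / 2)).
  rewrite lerD2r expect_sum//; apply: ler_sum => i _; have [m0 ci0] := mc i.
  rewrite !expectZ//; try exact: hinge_bmeasurable.
  by rewrite -mulrA ler_wpM2l// ler_pdivrMl// hinge_le0.
rewrite [X in _ <= _ + X](splitr e) addrA lerD2r.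
rewrite -[X in _ + X](expect_cst muB) -expectD//; [|exact: powR_bmeasurable|exact: bmeasurable_cst].
apply: le_expect => //; first exact: bmeasurable_sum.
  by apply: bmeasurableD; [exact: powR_bmeasurable|exact: bmeasurable_cst].
move=> s /andP[s0 sB].
have sV : 0 <= Num.sqrt s <= V by rewrite sqrtr_ge0 le_max ler_wsqrtr.
have := h _ sV; rewrite ler_norml => /andP[_ h1].
rewrite powR_sqrt// /hx; rewrite /phi in h1; lra.
Qed.

End HingePower.

(** * Group algebras *)

Section GroupAlgebra.
Local Open Scope complex_scope.
Variables (R : realType) (G : groupType).
Local Notation C := R[i].
Implicit Types (phi psi : G -> C) (g h a b : G).

Definition finite_functional (F : (G -> C) -> C) : Prop :=
  exists l : seq (C * G), forall phi, F phi = \sum_(p <- l) p.1 * phi p.2.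

(* The element [\sum_g x_g g] is encoded as the functional
   [phi |-> \sum_g x_g phi(g)]; multiplication becomes convolution. *)
Record galg := GAlg { gfun :> (G -> C) -> C ; _ : finite_functional gfun }.

Lemma gfunP (F : galg) : finite_functional F.
Proof. by case: F. Qed.

Lemma galg_ext (F H : galg) : (forall phi, F phi = H phi) -> F = H.
Proof.
case: F H => [F hF] [H hH] /= /funext e.
by subst H; congr GAlg; exact: Prop_irrelevance.
Qed.

HB.instance Definition _ := gen_eqMixin galg.
HB.instance Definition _ := gen_choiceMixin galg.

Lemma galg_zero_subproof : finite_functional (fun=> 0).
Proof. by exists [::] => phi; rewrite big_nil. Qed.
Definition galg_zero := GAlg galg_zero_subproof.

Lemma galg_add_subproof (F H : galg) : finite_functional (fun phi => F phi + H phi).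
Proof.
have [l hl] := gfunP F; have [k hk] := gfunP H.
by exists (l ++ k) => phi; rewrite big_cat /= hl hk.
Qed.
Definition galg_add F H := GAlg (galg_add_subproof F H).

Lemma galg_opp_subproof (F : galg) : finite_functional (fun phi => - F phi).
Proof.
have [l hl] := gfunP F; exists [seq (- p.1, p.2) | p <- l] => phi.
by rewrite big_map hl -sumrN; apply: eq_bigr => p _; rewrite mulNr.
Qed.
Definition galg_opp F := GAlg (galg_opp_subproof F).

Lemma galg_mono_subproof (c : C) g : finite_functional (fun phi => c * phi g).
Proof. by exists [:: (c, g)] => phi; rewrite big_seq1. Qed.
Definition gmono c g := GAlg (galg_mono_subproof c g).

Lemma galg_mul_subproof (F H : galg) :
  finite_functional (fun phi => F (fun a => H (fun b => phi (a * b)%g))).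
Proof.
have [l hl] := gfunP F; have [k hk] := gfunP H.
exists [seq (p.1 * q.1, (p.2 * q.2)%g) | p <- l, q <- k] => phi.
rewrite hl big_allpairs_dep /=; apply: eq_bigr => p _; rewrite hk mulr_sumr.
by apply: eq_bigr => q _; rewrite mulrA.
Qed.
Definition galg_mul F H := GAlg (galg_mul_subproof F H).

Lemma galg_scale_subproof (r : R) (F : galg) : finite_functional (fun phi => r%:C * F phi).
Proof.
have [l hl] := gfunP F; exists [seq (r%:C * p.1, p.2) | p <- l] => phi.
by rewrite big_map hl mulr_sumr; apply: eq_bigr => p _; rewrite mulrA.
Qed.
Definition galg_scale r F := GAlg (galg_scale_subproof r F).

Lemma gfun_add (F : galg) phi psi : F (fun g => phi g + psi g) = F phi + F psi.
Proof.
have [l hl] := gfunP F; rewrite !hl -big_split /=.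
by apply: eq_bigr => p _; rewrite mulrDr.
Qed.

Lemma gfun_scale (F : galg) c phi : F (fun g => c * phi g) = c * F phi.
Proof.
have [l hl] := gfunP F; rewrite !hl mulr_sumr.
by apply: eq_bigr => p _; rewrite mulrCA.
Qed.

Lemma gfun_sum (F : galg) (I : Type) (r : seq I) (phi : I -> G -> C) :
  F (fun g => \sum_(i <- r) phi i g) = \sum_(i <- r) F (phi i).
Proof.
have [l hl] := gfunP F; rewrite hl; under [RHS]eq_bigr do rewrite hl.
by rewrite exchange_big /=; apply: eq_bigr => p _; rewrite mulr_sumr.
Qed.

Lemma gfun_exchange (F H : galg) (phi : G -> G -> C) :
  F (fun a => H (fun b => phi a b)) = H (fun b => F (fun a => phi a b)).
Proof.
have [l hl] := gfunP F; have [k hk] := gfunP H; rewrite hl hk.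
under eq_bigr do rewrite hk mulr_sumr.
rewrite exchange_big /=; apply: eq_bigr => q _; rewrite hl mulr_sumr.
by apply: eq_bigr => p _; rewrite mulrCA.
Qed.

Lemma galg_addA : associative galg_add.
Proof. by move=> F H K; apply: galg_ext => phi /=; rewrite addrA. Qed.
Lemma galg_addC : commutative galg_add.
Proof. by move=> F H; apply: galg_ext => phi /=; rewrite addrC. Qed.
Lemma galg_add0 : left_id galg_zero galg_add.
Proof. by move=> F; apply: galg_ext => phi /=; rewrite add0r. Qed.
Lemma galg_addN : left_inverse galg_zero galg_opp galg_add.
Proof. by move=> F; apply: galg_ext => phi /=; rewrite addNr. Qed.

HB.instance Definition _ := GRing.isZmodule.Build galg galg_addA galg_addC galg_add0 galg_addN.

Lemma galg_mulA : associative galg_mul.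
Proof.
move=> F H K; apply: galg_ext => phi /=.
by under eq_fun do under eq_fun do under eq_fun do rewrite mulgA.
Qed.
Lemma galg_mul1 : left_id (gmono 1 1%g) galg_mul.
Proof. by move=> F; apply: galg_ext => phi /=; rewrite mul1r; under eq_fun do rewrite mul1g. Qed.
Lemma galg_mulr1 : right_id (gmono 1 1%g) galg_mul.
Proof.
move=> F; apply: galg_ext => phi /=.
by under eq_fun do rewrite mul1r mulg1.
Qed.
Lemma galg_mulDl : left_distributive galg_mul galg_add.
Proof. by move=> F H K; apply: galg_ext. Qed.
Lemma galg_mulDr : right_distributive galg_mul galg_add.
Proof. by move=> F H K; apply: galg_ext => phi /=; rewrite gfun_add. Qed.
Lemma galg_1neq0 : gmono 1 1%g != galg_zero.
Proof.
apply/eqP => /(congr1 (fun F : galg => F (fun=> 1))) /= /eqP.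
by rewrite mulr1 oner_eq0.
Qed.

HB.instance Definition _ := GRing.Zmodule_isNzRing.Build galg
  galg_mulA galg_mul1 galg_mulr1 galg_mulDl galg_mulDr galg_1neq0.

Lemma galg_scaleA (r s : R) (F : galg) : galg_scale r (galg_scale s F) = galg_scale (r * s) F.
Proof. by apply: galg_ext => phi /=; rewrite rmorphM /= mulrA. Qed.
Lemma galg_scale1 : left_id 1 galg_scale.
Proof. by move=> F; apply: galg_ext => phi /=; rewrite mul1r. Qed.
Lemma galg_scaleDr : right_distributive galg_scale +%R.
Proof. by move=> r F H; apply: galg_ext => phi /=; rewrite mulrDr. Qed.
Lemma galg_scaleDl (F : galg) : {morph galg_scale^~ F : r s / r + s}.
Proof. by move=> r s; apply: galg_ext => phi /=; rewrite rmorphD /= mulrDl. Qed.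

HB.instance Definition _ := GRing.Zmodule_isLmodule.Build R galg
  galg_scaleA galg_scale1 galg_scaleDr galg_scaleDl.

Lemma galg_scaleAl (r : R) (F H : galg) : r *: (F * H) = r *: F * H.
Proof. exact: galg_ext. Qed.
HB.instance Definition _ := GRing.Lmodule_isLalgebra.Build R galg galg_scaleAl.

Lemma galg_scaleAr (r : R) (F H : galg) : r *: (F * H) = F * (r *: H).
Proof. by apply: galg_ext => phi /=; rewrite gfun_scale. Qed.
HB.instance Definition _ := GRing.Lalgebra_isAlgebra.Build R galg galg_scaleAr.


Lemma galg_mulE (F H : galg) phi : (F * H) phi = F (fun a => H (fun b => phi (a * b)%g)).
Proof. by []. Qed.

Definition gdelta g : G -> C := fun h => (h == g)%:R.

(** Allowing every larger list lets two elements be summed over one common support. *)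
Lemma gfun_support (F : galg) : exists S0 : seq G, forall S, uniq S -> {subset S0 <= S} ->
  forall phi, F phi = \sum_(g <- S) F (gdelta g) * phi g.
Proof.
have [l hl] := gfunP F; exists (map snd l) => S uS sub phi.
under eq_bigr do rewrite mulrC -gfun_scale.
rewrite -gfun_sum !hl big_seq [RHS]big_seq; apply: eq_bigr => p pl.
congr (_ * _); have pS : p.2 \in S by apply: sub; exact: map_f.
rewrite (bigD1_seq p.2) //= /gdelta eqxx mulr1 big1 ?addr0// => g gp.
by rewrite eq_sym (negbTE gp) mulr0.
Qed.

Lemma gfun_support2 (F H : galg) : exists S : seq G, [/\ uniq S,
  (forall phi, F phi = \sum_(g <- S) F (gdelta g) * phi g) &
  (forall phi, H phi = \sum_(g <- S) H (gdelta g) * phi g)].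
Proof.
have [S1 h1] := gfun_support F; have [S2 h2] := gfun_support H.
exists (undup (S1 ++ S2)); split; first exact: undup_uniq.
- by apply: h1 => [|g gS]; rewrite ?undup_uniq// mem_undup mem_cat gS.
- by apply: h2 => [|g gS]; rewrite ?undup_uniq// mem_undup mem_cat gS orbT.
Qed.

Lemma galg_coef_ext (F H : galg) : (forall g, F (gdelta g) = H (gdelta g)) -> F = H.
Proof.
move=> h; have [S [_ h1 h2]] := gfun_support2 F H.
by apply: galg_ext => phi; rewrite h1 h2; apply: eq_bigr => g _; rewrite h.
Qed.

Lemma gstar_subproof (F : galg) :
  finite_functional (fun phi => conjc (F (fun g => conjc (phi (g^-1)%g)))).
Proof.
have [l hl] := gfunP F; exists [seq (conjc p.1, (p.2^-1)%g) | p <- l] => phi.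
rewrite hl rmorph_sum big_map; apply: eq_bigr => p _ /=.
by rewrite rmorphM /= conjcK.
Qed.
Definition gstar F := GAlg (gstar_subproof F).

Definition gtr (F : galg) : R := complex.Re (F (gdelta 1%g)).

Lemma gdelta_mulC a b : gdelta 1%g (a * b)%g = gdelta 1%g (b * a)%g.
Proof. by rewrite /gdelta; congr ((_ : bool)%:R); rewrite !mulg_eq1 -(inj_eq invg_inj) invgK eq_sym. Qed.

Lemma gdelta_mulVg a b : gdelta 1%g (a^-1 * b)%g = gdelta a b.
Proof. by rewrite /gdelta; congr ((_ : bool)%:R); rewrite mulg_eq1 (inj_eq invg_inj) eq_sym. Qed.

Lemma gtrC (F H : galg) : gtr (F * H) = gtr (H * F).
Proof.
rewrite /gtr !galg_mulE gfun_exchange; congr (complex.Re _).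
by congr (H _); apply/funext => b; congr (F _); apply/funext => a; rewrite gdelta_mulC.
Qed.

Lemma gstar_mul_delta (F H : galg) :
  (gstar F * H) (gdelta 1%g) = conjc (F (fun g => conjc (H (gdelta g)))).
Proof.
rewrite galg_mulE /=; congr conjc; congr (F _); apply/funext => a; congr conjc.
by congr (H _); apply/funext => b; rewrite gdelta_mulVg.
Qed.

Lemma gtr_ip (F H : galg) (S : seq G) :
  (forall phi, F phi = \sum_(g <- S) F (gdelta g) * phi g) ->
  gtr (gstar F * H) = \sum_(g <- S) complex.Re (conjc (F (gdelta g)) * H (gdelta g)).
Proof.
move=> h; rewrite /gtr gstar_mul_delta h rmorph_sum raddf_sum; apply: eq_bigr => g _.
by rewrite rmorphM /= conjcK.
Qed.

Lemma conjc_mulE (z : C) : conjc z * z = (cabs2 z)%:C.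
Proof. by case: z => a b; rewrite /cabs2; simpc; congr (Complex _ _); ring. Qed.

Lemma gtr_sq (F : galg) (S : seq G) :
  (forall phi, F phi = \sum_(g <- S) F (gdelta g) * phi g) ->
  gtr (gstar F * F) = \sum_(g <- S) cabs2 (F (gdelta g)).
Proof. by move=> /gtr_ip ->; apply: eq_bigr => g _; rewrite conjc_mulE. Qed.

Lemma cabs2_ge0 (z : C) : 0 <= cabs2 z.
Proof. by case: z => a b; rewrite /cabs2 addr_ge0 ?sqr_ge0. Qed.

Lemma gstarK (F : galg) : gstar (gstar F) = F.
Proof.
apply: galg_ext => phi /=; rewrite conjcK; congr (F _); apply/funext => g.
by rewrite conjcK invgK.
Qed.

Lemma galg_tracial : tracial gstar gtr.
Proof.
split.
- by move=> F H; apply: galg_ext => phi /=; rewrite rmorphD.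
- move=> r F; apply: galg_ext => phi /=; rewrite rmorphM /=; congr (_ * _).
  by simpc.
- move=> F H; apply: galg_ext => phi; rewrite galg_mulE /= gfun_exchange; congr conjc.
  congr (H _); apply/funext => b; rewrite conjcK; congr (F _); apply/funext => a.
  by rewrite invgM.
- exact: gstarK.
- by move=> F H; rewrite /gtr raddfD.
- by move=> r F; rewrite /gtr /=; case: (F _) => a b; simpc.
- exact: gtrC.
- move=> F; rewrite /gtr /= /gdelta.
  have -> : (fun g : G => conjc (g^-1 == 1)%g%:R) = gdelta 1%g :> (G -> C).
    by apply/funext => g; rewrite conjc_nat invg_eq1.
  by case: (F _).
- move=> F; have [S [_ h _]] := gfun_support2 F F; rewrite (gtr_sq h).
  by apply: sumr_ge0 => g _; exact: cabs2_ge0.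
- by rewrite /gtr /= /gdelta eqxx mulr1.
Qed.

Lemma gstar_mono c g : gstar (gmono c g) = gmono (conjc c) (g^-1)%g.
Proof. by apply: galg_ext => phi /=; rewrite rmorphM /= conjcK. Qed.

Lemma gmonoM c d g h : gmono c g * gmono d h = gmono (c * d) (g * h)%g.
Proof. by apply: galg_ext => phi /=; rewrite mulrA. Qed.

(** The norm is |c|; the cruder |c|^2 + 1 avoids a square root and is positive even for c = 0. *)
Lemma gmono_opbound c g : opbound gstar gtr (gmono c g) (cabs2 c + 1).
Proof.
move=> y; have T := galg_tracial.
rewrite (tracial_starM T) -mulrA [gstar (gmono c g) * _]mulrA gstar_mono gmonoM.
rewrite conjc_mulE mulVg.
have -> : gmono (cabs2 c)%:C 1%g = cabs2 c *: 1 by apply: galg_ext => phi /=; rewrite mul1r.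
rewrite -scalerAl mul1r -scalerAr (tracial_trZ T) ler_wpM2r ?(tracial_ge0 T)//.
by have := cabs2_ge0 c; nra.
Qed.

Lemma galg_bounded (F : galg) : exists2 c, 0 < c & opbound gstar gtr F c.
Proof.
have T := galg_tracial; have [l hl] := gfunP F.
have -> : F = \sum_(p <- l) gmono p.1 p.2.
  apply: galg_ext => phi; rewrite hl; elim: (l) => [|p s IH]; first by rewrite !big_nil.
  by rewrite !big_cons IH.
elim: {hl} l => [|p l [c c0 hc]].
  exists 1 => // y; rewrite big_nil mul0r mulr0 (tr0 T) expr1n mul1r; exact: (tracial_ge0 T).
rewrite big_cons; exists (cabs2 p.1 + 1 + c).
  by rewrite addr_gt0// ltr_wpDl// cabs2_ge0.
apply: (opboundD T) => //; [|exact: ltW|exact: gmono_opbound].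
by rewrite addr_ge0// cabs2_ge0.
Qed.

End GroupAlgebra.

(** * Schur multipliers *)

Section Multiplier.
Local Open Scope complex_scope.
Variables (R : realType) (G : groupType).
Local Notation C := R[i].
Local Notation A := (galg R G).
Implicit Types (phi psi : G -> C) (g h : G) (f : G -> R) (x y z : A).
Local Notation sq x := (gtr (gstar x * x)).

Lemma gmult_subproof f x : finite_functional (fun phi => x (fun g => (f g)%:C * phi g)).
Proof.
have [l hl] := gfunP x; exists [seq ((f p.2)%:C * p.1, p.2) | p <- l] => phi.
by rewrite hl big_map; apply: eq_bigr => p _; rewrite mulrCA mulrA.
Qed.
Definition gmult f x : A := GAlg (gmult_subproof f x).

Lemma gmult_coef f x g : gmult f x (gdelta R g) = (f g)%:C * x (gdelta R g).
Proof.
rewrite /= -gfun_scale; congr (x _); apply/funext => h; rewrite /gdelta.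
by case: eqP => [->|_]; rewrite ?mulr0.
Qed.

Lemma gmultD f x y : gmult f (x + y) = gmult f x + gmult f y.
Proof. exact: galg_ext. Qed.

Lemma gmult_supportE f x (S : seq G) :
  (forall phi, x phi = \sum_(g <- S) x (gdelta R g) * phi g) ->
  forall phi, gmult f x phi = \sum_(g <- S) gmult f x (gdelta R g) * phi g.
Proof.
move=> h phi; rewrite [LHS]h; apply: eq_bigr => g _.
by rewrite gmult_coef mulrCA mulrA.
Qed.

Lemma Re_realM (r : R) (c : C) : complex.Re (r%:C * c) = r * complex.Re c.
Proof. by case: c => a b; simpc. Qed.

Lemma gmult_sym f x y : gtr (gstar (gmult f x) * y) = gtr (gstar x * gmult f y).
Proof.
have [S [_ hx _]] := gfun_support2 x y.
rewrite (gtr_ip _ hx) (gtr_ip _ (gmult_supportE f hx)); apply: eq_bigr => g _.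
rewrite !gmult_coef; case: (x _) => a b; case: (y _) => c d; simpc => /=; ring.
Qed.

Lemma cabs2_realM (r : R) (c : C) : cabs2 (r%:C * c) = r ^+ 2 * cabs2 c.
Proof. by case: c => a b; simpc; rewrite /cabs2; ring. Qed.

Lemma gmult_pairing f x y z (S : seq G) :
  (forall phi, z phi = \sum_(g <- S) z (gdelta R g) * phi g) ->
  (forall phi, y phi = \sum_(g <- S) y (gdelta R g) * phi g) ->
  gtr (gstar z * (gmult f x * y)) = \sum_(g <- S) \sum_(h <- S)
    f (g * h^-1)%g * complex.Re (conjc (z (gdelta R g)) * (y (gdelta R h) * x (gdelta R (g * h^-1)%g))).
Proof.
move=> hz hy; rewrite (gtr_ip _ hz); apply: eq_bigr => g _.
have -> : (gmult f x * y) (gdelta R g) =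
    \sum_(h <- S) y (gdelta R h) * ((f (g * h^-1)%g)%:C * x (gdelta R (g * h^-1)%g)).
  rewrite galg_mulE.
  under eq_fun do rewrite hy.
  rewrite gfun_sum; apply: eq_bigr => h _; rewrite gfun_scale -gmult_coef.
  congr (_ * gmult f x _); apply/funext => k; rewrite /gdelta; congr ((_ : bool)%:R).
  by rewrite -(can2_eq (mulgK h) (mulgVK h)).
rewrite mulr_sumr raddf_sum; apply: eq_bigr => h _.
by rewrite -Re_realM; congr complex.Re; ring.
Qed.

(* Schur's test: an approximate factorisation of the kernel [f (g h^-1)] splits the
   form [<z, (f x) y>] into forms [<alpha z, x (beta y)>]. *)
Lemma schur_opbound f K : 0 < K ->
  (forall (S : seq G) (e : R), 0 < e -> exists (I : Type) (r : seq I) (al be : I -> G -> R),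
    [/\ forall g, g \in S -> \sum_(i <- r) al i g ^+ 2 <= K,
        forall g, g \in S -> \sum_(i <- r) be i g ^+ 2 <= K &
        forall g h, g \in S -> h \in S ->
          `|f (g * h^-1)%g - \sum_(i <- r) al i g * be i h| <= e]) ->
  forall x c, 0 < c -> opbound (@gstar R G) (@gtr R G) x c ->
    opbound (@gstar R G) (@gtr R G) (gmult f x) (K * c).
Proof.
move=> K0 hf x c c0 hx; have T := galg_tracial R G.
have key z y : gtr (gstar z * (gmult f x * y)) <= K * c * ((sq z + sq y) / 2).
  have [S [_ hz hy]] := gfun_support2 z y.
  pose k g h := complex.Re (conjc (z (gdelta R g)) * (y (gdelta R h) * x (gdelta R (g * h^-1)%g))).
  pose W := \sum_(g <- S) \sum_(h <- S) `|k g h|.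
  have W0 : 0 <= W by apply: sumr_ge0 => g _; apply: sumr_ge0.
  apply/ler_addgt0Pr => e e0; have d0 : 0 < e / (W + 1) by rewrite divr_gt0// ltr_wpDl.
  have [I [r [al [be [h1 h2 h3]]]]] := hf S _ d0.
  have E (i : I) : gtr (gstar (gmult (al i) z) * (x * gmult (be i) y)) =
      \sum_(g <- S) \sum_(h <- S) al i g * be i h * k g h.
    (* Seen as the multiplier by 1, [x] falls under [gmult_pairing] too. *)
    have -> : x = gmult (fun=> 1) x by apply: galg_ext => phi /=; under eq_fun do rewrite mul1r.
    rewrite (gmult_pairing _ _ (gmult_supportE (al i) hz) (gmult_supportE (be i) hy)).
    apply: eq_bigr => g _; apply: eq_bigr => h _; rewrite mul1r !gmult_coef /k.
    case: (z _) => z1 z2; case: (y _) => y1 y2; move: (x _) => [x1 x2].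
    by simpc => /=; ring.
  have Ele : \sum_(i <- r) \sum_(g <- S) \sum_(h <- S) al i g * be i h * k g h <=
      K * c * ((sq z + sq y) / 2).
    apply: (@le_trans _ _ (\sum_(i <- r) c * ((sq (gmult (al i) z) + sq (gmult (be i) y)) / 2))).
      by apply: ler_sum => i _; rewrite -E; apply: (opbound_ip T _ _ (ltW c0) hx).
    rewrite -mulr_sumr -mulr_suml [K * c]mulrC -mulrA ler_wpM2l ?(ltW c0)// mulrA.
    rewrite ler_wpM2r ?invr_ge0// big_split mulrDr /=.
    have aux (w : A) (ga : I -> G -> R) : (forall phi, w phi = \sum_(g <- S) w (gdelta R g) * phi g) ->
        (forall g, g \in S -> \sum_(i <- r) ga i g ^+ 2 <= K) ->
        \sum_(i <- r) sq (gmult (ga i) w) <= K * sq w.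
      move=> hw hga; under eq_bigr do rewrite (gtr_sq (gmult_supportE _ hw)).
      rewrite exchange_big (gtr_sq hw) mulr_sumr big_seq [leRHS]big_seq.
      apply: ler_sum => g gS; under eq_bigr do rewrite gmult_coef cabs2_realM.
      by rewrite -mulr_suml ler_wpM2r ?cabs2_ge0// hga.
    by apply: lerD; apply: aux.
  rewrite (gmult_pairing _ _ hz hy) -/W.
  rewrite exchange_big /= in Ele; under eq_bigr do rewrite exchange_big /= in Ele.
  apply: le_trans (lerD Ele (_ : W * (e / (W + 1)) <= e)); last first.
    rewrite mulrCA ger_pMr// ler_pdivrMr ?ltr_wpDl// mul1r; lra.
  rewrite mulr_suml -big_split /= big_seq [leRHS]big_seq; apply: ler_sum => g gS.
  rewrite exchange_big mulr_suml -big_split /= big_seq [leRHS]big_seq; apply: ler_sum => h hS.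
  rewrite -mulr_suml -/(k g h) -lerBlDl -mulrBl.
  by apply: le_trans (ler_norm _) _; rewrite normrM mulrC ler_wpM2l// h3.
move=> y; set u := gmult f x * y.
have Kc : 0 < K * c by rewrite mulr_gt0.
(* This scaling of the test vector balances the two halves of the mean, which turns [key] into the
   squared norm bound. *)
have := key ((K * c)^-1 *: u) y; rewrite -/u (sqZ T) (tracial_starZ T) -scalerAl (tracial_trZ T).
move: (sq u) (sq y) => N M h.
have : N / (K * c) <= K * c * M.
  have e1 : (K * c)^-1 ^+ 2 * N * (K * c) = N / (K * c) by field; rewrite !gt_eqF.
  lra.
by rewrite ler_pdivrMr// => {}h; lra.
Qed.

End Multiplier.

(** * The free group and its tree *)

Section FreeGroup.
Variable n : nat.
Implicit Types (a b : letter n) (u v w : word n).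

Definition linv a : letter n := (a.1, ~~ a.2).

Lemma linvK : involutive linv.
Proof. by move=> [i s]; rewrite /linv /= negbK. Qed.

Lemma cancelsE a b : cancels a b = (b == linv a).
Proof.
case: a b => [i s] [j r]; rewrite /cancels /linv /= xpair_eqE eq_sym; congr (_ && _).
by case: s r => [] [].
Qed.

Lemma reduced_cons a w : reduced (a :: w) = (if w is b :: _ then ~~ cancels a b else true) && reduced w.
Proof. by case: w. Qed.

Lemma reduced_behead a w : reduced (a :: w) -> reduced w.
Proof. by rewrite reduced_cons => /andP[]. Qed.

Lemma reduced_cons_red a w : reduced w -> reduced (cons_red a w).
Proof.
case: w => // b w hw /=; case: ifP => [_|ab]; first exact: reduced_behead hw.
by rewrite reduced_cons ab hw.
Qed.

Lemma reduced_wmul u v : reduced v -> reduced (wmul u v).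
Proof. by move=> hv; elim: u => //= a u IH; exact: reduced_cons_red. Qed.

Lemma cons_red_reduced a w : reduced (a :: w) -> cons_red a w = a :: w.
Proof. by case: w => // b w; rewrite reduced_cons /= => /andP[/negbTE ->]. Qed.

Lemma cons_redK a w : reduced w -> cons_red (linv a) (cons_red a w) = w.
Proof.
case: w => [_|b w hw] /=; first by rewrite cancelsE linvK eqxx.
case: ifP => [|_]; last by rewrite /= cancelsE linvK eqxx.
by rewrite cancelsE => /eqP eb; rewrite -eb cons_red_reduced.
Qed.

(** The case where [a] cancels the head of [u] rests on [cons_redK], which needs the product to be
    reduced. Associativity then follows by induction. *)
Lemma wmul_cons_red a u v : reduced u -> reduced v ->
  wmul (cons_red a u) v = cons_red a (wmul u v).
Proof.
case: u => // b u hu hv /=; case: ifP => //.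
rewrite cancelsE => /eqP ->.
by have := cons_redK (linv a) (reduced_wmul u hv); rewrite linvK.
Qed.

Lemma wmulA u v w : reduced v -> reduced w -> wmul u (wmul v w) = wmul (wmul u v) w.
Proof.
move=> hv hw; elim: u => //= a u IH.
by rewrite wmul_cons_red ?IH// reduced_wmul.
Qed.

Lemma wmul_cat u v : reduced (u ++ v) -> wmul u v = u ++ v.
Proof.
elim: u => //= a u IH h; rewrite IH; last exact: reduced_behead h.
exact: cons_red_reduced.
Qed.

Lemma wmulw0 w : reduced w -> wmul w [::] = w.
Proof. by move=> h; rewrite wmul_cat cats0. Qed.

Lemma winv_rcons u a : winv (rcons u a) = linv a :: winv u.
Proof. by rewrite /winv map_rcons rev_rcons. Qed.

Lemma winv_cons u a : winv (a :: u) = rcons (winv u) (linv a).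
Proof. by rewrite /winv /= rev_cons. Qed.

Lemma winv_cat u v : winv (u ++ v) = winv v ++ winv u.
Proof. by rewrite /winv map_cat rev_cat. Qed.

Lemma winvK : involutive (@winv n).
Proof.
move=> w; rewrite /winv map_rev revK -map_comp.
by rewrite -[RHS]map_id; apply: eq_map => a; exact: linvK.
Qed.

Lemma reduced_cat u v : reduced (u ++ v) =
  [&& reduced u, reduced v & (if u is a :: u' then
     if v is b :: _ then ~~ cancels (last a u') b else true else true)].
Proof.
elim: u => [|a u IH] /=; first by rewrite andbT.
rewrite -/(reduced (a :: u)) -/(reduced (a :: (u ++ v))) !reduced_cons IH.
case: u IH => [|b u] IH /=.
  by case: v {IH} => [|c v] //=; rewrite andbT andbC.
by rewrite andbA.
Qed.

Lemma cancels_sym a b : cancels (linv b) (linv a) = cancels a b.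
Proof. by rewrite !cancelsE linvK eq_sym. Qed.

Lemma reduced_winv w : reduced w -> reduced (winv w).
Proof.
elim: w => // a w IH h; rewrite winv_cons -cats1 reduced_cat IH ?(reduced_behead h)//=.
case: w h {IH} => // b w /=; rewrite winv_cons => /andP[h _].
case: (winv w) => [|c s] /=; first by rewrite cancels_sym.
by rewrite last_rcons cancels_sym.
Qed.

Lemma wmulVw w : reduced w -> wmul (winv w) w = [::].
Proof.
elim: w => // a w IH h; have hw := reduced_behead h.
rewrite winv_cons -cats1 /wmul foldr_cat /= cancelsE linvK eqxx.
exact: IH.
Qed.

Lemma wmulwV w : reduced w -> wmul w (winv w) = [::].
Proof. by move=> h; rewrite -[X in wmul X _]winvK wmulVw// reduced_winv. Qed.

Record fgroup := FGroup { fword :> word n ; fwordP : reduced fword }.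
HB.instance Definition _ := [isSub for fword].
HB.instance Definition _ := [Choice of fgroup by <:].

Definition fg_mul (g h : fgroup) : fgroup := FGroup (reduced_wmul g (fwordP h)).
Definition fg_one : fgroup := @FGroup [::] isT.
Definition fg_inv (g : fgroup) : fgroup := FGroup (reduced_winv (fwordP g)).

Lemma fg_mulA : associative fg_mul.
Proof. by move=> g h k; apply: val_inj; rewrite /= wmulA ?fwordP. Qed.
Lemma fg_mul1 : left_id fg_one fg_mul.
Proof. by move=> g; apply: val_inj. Qed.
Lemma fg_mulr1 : right_id fg_one fg_mul.
Proof. by move=> g; apply: val_inj; rewrite /= wmulw0 ?fwordP. Qed.
Lemma fg_mulV : left_inverse fg_one fg_inv fg_mul.
Proof. by move=> g; apply: val_inj; rewrite /= wmulVw ?fwordP. Qed.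
Lemma fg_mulrV : right_inverse fg_one fg_inv fg_mul.
Proof. by move=> g; apply: val_inj; rewrite /= wmulwV ?fwordP. Qed.

HB.instance Definition _ := isGroup.Build fgroup fg_mulA fg_mul1 fg_mulr1 fg_mulV fg_mulrV.

(* The geodesic from [g] to the root [e] is continued along an infinite ray beyond
    the root, so that all such paths are infinite and any two merge. *)
Definition path_vertex (g : word n) (k : nat) : word n * nat := (drop k g, k - size g)%N.

Lemma path_vertex_inj g : injective (path_vertex g).
Proof.
move=> k l [e1 e2]; have := congr1 size e1; rewrite !size_drop; lia.
Qed.

(** Suffixes, because the path to the root drops letters from the front. The defaults [a] and [b]
    only give [last] a meaning on nonempty words. *)
Lemma max_common_suffix g h : exists g' h' s,
  [/\ g = g' ++ s, h = h' ++ s &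
  forall a b, g' <> [::] -> h' <> [::] -> last a g' <> last b h'].
Proof.
elim/last_ind: g h => [|g a IH] h; first by exists [::], h, [::]; rewrite !cats0.
case/lastP: h => [|h b]; first by exists (rcons g a), [::], [::]; rewrite !cats0.
have [ab|ab] := eqVneq a b.
  have [g' [h' [s [-> -> H]]]] := IH h.
  by exists g', h', (rcons s a); rewrite -ab !rcons_cat.
exists (rcons g a), (rcons h b), [::]; rewrite !cats0; split=> // c d _ _.
by rewrite !last_rcons; apply/eqP.
Qed.

(** [i] and [j] are the lengths of [g] and [h] once the longest common suffix is removed. The
    remainders do not cancel in g h^-1, and past them the two paths coincide up to the shift i -
    j. *)
Lemma path_merge (g h : fgroup) : exists i j : nat,
  [/\ (i <= size (fword g))%N, (j <= size (fword h))%N, size (fword (g * h^-1)%g) = (i + j)%N &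
  forall k l, path_vertex g k = path_vertex h l <-> (i <= k)%N /\ (k + j = l + i)%N].
Proof.
have [g' [h' [s [eg eh H]]]] := max_common_suffix (fword g) (fword h).
have rg := fwordP g; have rh := fwordP h.
exists (size g'), (size h'); split.
- by rewrite eg size_cat leq_addr.
- by rewrite eh size_cat leq_addr.
- have rg' : reduced g' by move: rg; rewrite eg reduced_cat => /and3P[].
  have rh' : reduced h' by move: rh; rewrite eh reduced_cat => /and3P[].
  have rs : reduced s by move: rg; rewrite eg reduced_cat => /and3P[].
  have red : reduced (g' ++ winv h').
    rewrite reduced_cat rg' reduced_winv//=.
    case: (g') H => // a u H; case/lastP: (h') H => // v b H.
    rewrite winv_rcons cancelsE; apply/eqP => /(can_inj linvK) e.
    by apply: (H a b) => //; rewrite ?last_rcons ?e//; case: (v).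
  rewrite /= eg eh winv_cat.
  have -> : wmul (g' ++ s) (winv s ++ winv h') = g' ++ winv h'.
    have -> : winv s ++ winv h' = wmul (winv s) (winv h').
      rewrite wmul_cat// -winv_cat -eh; exact: reduced_winv.
    have -> : wmul (g' ++ s) (wmul (winv s) (winv h')) = wmul g' (wmul s (wmul (winv s) (winv h'))).
      by rewrite /wmul foldr_cat.
    by rewrite [X in wmul g' X]wmulA ?reduced_winv// wmulwV//= wmul_cat.
  by rewrite size_cat /winv size_rev size_map.
- move=> k l; rewrite /path_vertex eg eh; split; last first.
    move=> [ik kl]; have -> : k = (size g' + (k - size g'))%N by rewrite subnKC.
    have -> : l = (size h' + (k - size g'))%N by lia.
    by rewrite !drop_cat !ltnNge !leq_addr /= !addKn !size_cat !subnDl.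
  case=> e1 e2; have := congr1 size e1; rewrite !size_drop !size_cat in e2 * => e3.
  have kl : (k + size h' = l + size g')%N by lia.
  (* A meeting before the branching point would equate nonempty ends of g' and h', hence their last
     letters. *)
  split=> //; rewrite leqNgt; apply/negP => kg.
  have lh : (l < size h')%N by lia.
  move: e1; rewrite !drop_cat kg lh => /eqP.
  have hs : (size g' - k)%N = (size h' - l)%N by lia.
  rewrite eqseq_cat; last by rewrite !size_drop.
  rewrite eqxx andbT => /eqP e.
  case: (g') kg H e => // a u kg H e; case: (h') lh H e => // b v lh H e.
  apply: (H a b) => //.
  have la (c : letter n) w m : (m < size w)%N -> last c w = last c (drop m w).
    move=> mw; rewrite -[in LHS](cat_take_drop m w) last_cat.
    by case: (drop m w) (size_drop m w) => //= ; lia.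
  rewrite (la a _ _ kg) (la b _ _ lh) e.
  have lh' : (0 < size (b :: v) - l)%N by rewrite subn_gt0.
  by rewrite -size_drop in lh'; case: (drop l (b :: v)) lh'.
Qed.

End FreeGroup.

(** * Radial multipliers *)

Section Hankel.
Variables (R : realType) (n : nat).
Implicit Types (g h : fgroup n) (f : nat -> R).

Lemma path_pairing g h (K : nat) (Vs : seq (word n * nat)) (a b : nat -> R) :
  uniq Vs -> (forall k, (k < K)%N -> path_vertex g k \in Vs) ->
  \sum_(v <- Vs) (\sum_(k < K) (path_vertex g k == v)%:R * a k) *
                 (\sum_(l < K) (path_vertex h l == v)%:R * b l) =
  \sum_(k < K) \sum_(l < K) (path_vertex g k == path_vertex h l)%:R * (a k * b l).
Proof.
move=> uV gV.
under eq_bigr => v _.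
  rewrite mulr_suml; under eq_bigr => k _ do rewrite mulr_sumr.
  over.
rewrite exchange_big /=; apply: eq_bigr => k _.
rewrite exchange_big /=; apply: eq_bigr => l _.
rewrite (bigD1_seq (path_vertex g k)) ?gV//= eqxx mul1r.
rewrite big1 ?addr0 => [|v vk]; last by rewrite eq_sym (negbTE vk) !mul0r.
by rewrite mulrCA eq_sym.
Qed.

Lemma path_pairing_sq g (K : nat) (Vs : seq (word n * nat)) (a : nat -> R) :
  uniq Vs -> (forall k, (k < K)%N -> path_vertex g k \in Vs) ->
  \sum_(v <- Vs) (\sum_(k < K) (path_vertex g k == v)%:R * a k) ^+ 2 =
  \sum_(k < K) a k ^+ 2.
Proof.
move=> uV gV; under eq_bigr do rewrite expr2.
rewrite path_pairing//; apply: eq_bigr => k _.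
rewrite (bigD1 k) //= eqxx mul1r -expr2 big1 ?addr0 // => l lk.
by rewrite (inj_eq (@path_vertex_inj _ _)) eq_sym (inj_eq val_inj) (negbTE lk) mul0r.
Qed.

(** The pairs in [P] are k = i + m, l = j + m, and the cut at [K] keeps K - max(i, j) of them. The
    difference at such a pair moves the index i + j + 2m by two. *)
Lemma path_merge_telescope f (K i j : nat) (P : nat -> nat -> bool) :
  (i <= K)%N -> (j <= K)%N ->
  (forall k l, P k l <-> (i <= k)%N /\ (k + j = l + i)%N) ->
  \sum_(k < K) \sum_(l < K) (P k l)%:R * (f (k + l)%N - f (k + l).+2) =
  f (i + j)%N - f (i + j + (K - maxn i j).*2)%N.
Proof.
move=> iK jK hP; set M := (K - maxn i j)%N.
(* The telescoping value reached after the rows below [k], constant before row [i] and from row i +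
   M on, where rows contain no pair. *)
pose D k := f (i + j + (minn k (i + M) - i).*2)%N.
have -> : f (i + j)%N = D 0%N by rewrite /D min0n sub0n addn0.
have -> : f (i + j + M.*2)%N = D K by rewrite /D; congr f; rewrite /M; lia.
have -> : D 0%N - D K = \sum_(0 <= k < K) (D k - D k.+1).
  rewrite (eq_bigr (fun k => - D k.+1 - - D k)) => [|k _]; last by rewrite opprK addrC.
  by rewrite telescope_sumr// opprK addrC.
rewrite big_mkord; apply: eq_bigr => -[k kK] _ /=.
have [ik|ki] := leqP i k; last first.
  rewrite (_ : D k.+1 = D k) ?subrr; last by rewrite /D; congr f; lia.
  rewrite big1// => l _; case: (P k l) (hP k l) => [|_]; last by rewrite mul0r.
  by move=> [/(_ isT) [h _] _]; move: h; rewrite leqNgt ki.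
have [lK|Kl] := ltnP (k - i + j)%N K.
  rewrite (bigD1 (Ordinal lK)) //= big1 ?addr0 => [|l lk].
    have -> : P k (k - i + j)%N by apply/hP; split => //; lia.
    rewrite mul1r; congr (_ - _); rewrite /D; congr f; rewrite /M; lia.
  case: (P k l) (hP k l) => [|_]; last by rewrite mul0r.
  move=> [/(_ isT) [_ h] _]; exfalso; move/eqP: lk; apply; apply: val_inj => /=; lia.
rewrite (_ : D k.+1 = D k) ?subrr; last by rewrite /D; congr f; rewrite /M; lia.
rewrite big1// => l _; case: (P k l) (hP k l) => [|_]; last by rewrite mul0r.
move=> [/(_ isT) [_ h] _]; have := ltn_ord l; lia.
Qed.

(* A trace-class factorisation of the Hankel matrix [f(i+j) - f(i+j+2)] gives a Schur
   factorisation of the kernel [f |g h^-1|]: the paths of [g] and [h] share exactly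
   their vertices beyond the branching point, and the sum of
   [f(i+j+2m) - f(i+j+2m+2)] over the common vertices telescopes to [f(i+j)]. *)
Lemma hankel_opbound f C : 0 < C ->
  (forall e, 0 < e -> exists N, forall k, (N <= k)%N -> `|f k| <= e) ->
  (forall N, exists (K T : nat) (a b : nat -> nat -> R),
    [/\ (N <= K)%N, \sum_(t < T) \sum_(k < K) a t k ^+ 2 <= C,
        \sum_(t < T) \sum_(k < K) b t k ^+ 2 <= C &
        forall i j, (i < K)%N -> (j < K)%N ->
          \sum_(t < T) a t i * b t j = f (i + j)%N - f (i + j).+2]) ->
  forall (x : galg R (fgroup n)) c, 0 < c ->
    opbound (@gstar R _) (@gtr R _) x c ->
    opbound (@gstar R _) (@gtr R _) (gmult (fun g => f (size (fword g))) x) (C * c).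
Proof.
move=> C0 f0 hf; apply: schur_opbound => // S e e0.
have [N hN] := f0 e e0.
pose L := \max_(g <- S) size (fword g).
have hL g : g \in S -> (size (fword g) <= L)%N by move=> gS; exact: leq_bigmax_seq.
(* Branching indices are at most [L], so K >= N + L pushes the telescoping remainder past [N], where
   |f| <= e. *)
have [K [T [a [b [NK ha hb hab]]]]] := hf (N + L)%N.
pose Vs := undup [seq path_vertex (fword g) k | g <- S, k <- iota 0 K].
have gV g k : g \in S -> (k < K)%N -> path_vertex (fword g) k \in Vs.
  by move=> gS kK; rewrite mem_undup; apply: allpairs_f; rewrite // mem_iota.
have uV : uniq Vs by exact: undup_uniq.
pose ga (c : nat -> nat -> R) (i : (word n * nat) * nat) (g : fgroup n) :=
  \sum_(k < K) (path_vertex (fword g) k == i.1)%:R * c i.2 k.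
exists ((word n * nat) * nat)%type, [seq (v, t) | v <- Vs, t <- iota 0 T], (ga a), (ga b).
have sumE (F : (word n * nat) * nat -> R) :
    \sum_(i <- [seq (v, t) | v <- Vs, t <- iota 0 T]) F i =
    \sum_(t < T) \sum_(v <- Vs) F (v, nat_of_ord t).
  rewrite big_allpairs_dep exchange_big /=; rewrite -(big_mkord xpredT (fun t => \sum_(v <- Vs) F (v, t))).
  by rewrite /index_iota subn0.
have sq_le (c : nat -> nat -> R) g : g \in S ->
    \sum_(t < T) \sum_(k < K) c t k ^+ 2 <= C ->
    \sum_(i <- [seq (v, t) | v <- Vs, t <- iota 0 T]) ga c i g ^+ 2 <= C.
  move=> gS hc; rewrite sumE; apply: le_trans hc; apply: ler_sum => t _.
  by rewrite /ga /= (path_pairing_sq (c t) uV)// => k; exact: gV.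
split; [by move=> g gS; exact: sq_le|by move=> g gS; exact: sq_le|].
move=> g h gS hS; rewrite sumE /ga /=.
under eq_bigr => t _ do rewrite (path_pairing _ (a t) (b t) uV (fun k => gV g k gS)).
rewrite exchange_big /=; under eq_bigr do rewrite exchange_big /=.
have [i [j [ig jh -> hP]]] := path_merge g h.
have iL := leq_trans ig (hL _ gS); have jL := leq_trans jh (hL _ hS).
rewrite (eq_bigr (fun k : 'I_K => \sum_(l < K)
   (path_vertex (fword g) k == path_vertex (fword h) l)%:R * (f (k + l)%N - f (k + l).+2))); last first.
  move=> k _; apply: eq_bigr => l _; rewrite -mulr_sumr; congr (_ * _); exact: hab.
rewrite (@path_merge_telescope f K i j (fun k l => path_vertex (fword g) k == path_vertex (fword h) l)).
- by rewrite opprB addrC subrK; apply: hN; lia.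
- lia.
- lia.
- by move=> k l; split => [/eqP/hP|/hP/eqP].
Qed.

End Hankel.

(** * Factorisations of two Hankel matrices *)

Section Factorisations.
Local Open Scope classical_set_scope.
Variable R : realType.

Lemma sum_single_le (K t : nat) (c : R) : 0 <= c ->
  \sum_(k < K) (if (k : nat) == t then c else 0) <= c.
Proof.
move=> c0; have [tK|Kt] := ltnP t K.
  rewrite (bigD1 (Ordinal tK)) //= eqxx big1 ?addr0// => k kt.
  by case: eqP => // e; move/eqP: kt; case; apply: val_inj.
rewrite big1// => k _; case: eqP => // e; have := ltn_ord k; by rewrite e ltnNge Kt.
Qed.

Lemma sum_geometric_tail (q : R) (K s : nat) : 0 <= q -> q <= 1 ->
  (1 - q) * \sum_(k < K) (if (s <= k)%N then q ^+ k else 0) <= q ^+ s.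
Proof.
move=> q0 q1.
have : (1 - q) * \sum_(k < K) (if (s <= k)%N then q ^+ k else 0) =
    if (s <= K)%N then q ^+ s - q ^+ K else 0.
  elim: K => [|K IH]; first by rewrite big_ord0 mulr0; case: s => //=; rewrite subrr.
  rewrite big_ord_recr /= mulrDr IH [(s <= K.+1)%N]leq_eqVlt ltnS.
  have [sK|Ks] := leqP s K.
    by rewrite orbT exprS; ring.
  by rewrite mulr0 addr0 orbF; case: eqP => // ->; rewrite subrr.
move=> ->; case: ifP => _; last exact: exprn_ge0.
by rewrite gerBl exprn_ge0.
Qed.

(** * The heat symbol *)

Section Heat.
Variables (r : R) (d : nat).
Hypotheses (r0 : 0 < r) (r1 : r < 1).

(* Only the values at [k >= d] matter; those below make [f(k) - f(k+2)] vanish there. *)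
Definition heat_symbol (k : nat) : R :=
  if (d <= k)%N then r ^+ k else r ^+ (d + odd (d - k)).

Lemma heat_symbol_diff k : heat_symbol k - heat_symbol k.+2 =
  if (d <= k)%N then (1 - r ^+ 2) * r ^+ k else 0.
Proof.
rewrite /heat_symbol; have [dk|kd] := leqP d k.
  by rewrite (leq_trans dk (leqW (leqnSn k))) !exprS expr0; ring.
case: leqP => h; last first.
  have -> : (d - k = (d - k.+2).+2)%N by lia.
  by rewrite /= negbK subrr.
have [e|e] : (d = k.+1 \/ d = k.+2)%N by lia.
  by rewrite e subSnn addn1 subrr.
by rewrite e (_ : (k.+2 - k = 2)%N) ?addn0 ?subrr//; lia.
Qed.

Lemma heat_symbol_cvg (e : R) : 0 < e -> exists N, forall k, (N <= k)%N -> `|heat_symbol k| <= e.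
Proof.
move=> e0; have /cvgrPdist_le/(_ e e0) : (fun n : nat => r ^+ n) @ \oo --> (0 : R).
  by apply: cvg_expr; rewrite gtr0_norm.
move=> [N _ hN]; exists (maxn N d) => k; rewrite geq_max => /andP[Nk dk].
by have := hN k Nk; rewrite /heat_symbol dk /= sub0r normrN.
Qed.

(** The matrix is (1 - r^2) r^(i+j) on i + j >= d and 0 elsewhere. Each row i < d is a piece of its
    own; the rows i >= d are full and form a single rank one block, stored at t = d. *)
Lemma heat_factorisation N : exists (K T : nat) (a b : nat -> nat -> R),
    [/\ (N <= K)%N, \sum_(t < T) \sum_(k < K) a t k ^+ 2 <= d.+1%:R * r ^+ d,
        \sum_(t < T) \sum_(k < K) b t k ^+ 2 <= d.+1%:R * r ^+ d &
        forall i j, (i < K)%N -> (j < K)%N ->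
          \sum_(t < T) a t i * b t j = heat_symbol (i + j)%N - heat_symbol (i + j).+2].
Proof.
have rd : 0 < r ^+ d by rewrite exprn_gt0.
have q0 : 0 <= r ^+ 2 by exact: sqr_ge0.
have q1 : r ^+ 2 < 1 by rewrite expr_lt1// ltW.
have q1' : 0 < 1 - r ^+ 2 by rewrite subr_gt0.
(* [A] and [mu] scale the two factors of each piece so that both squared norms are at most r^d, for
   the rows and the block respectively. *)
pose A := Num.sqrt (r ^+ d).
pose mu := Num.sqrt ((1 - r ^+ 2) / r ^+ d).
have A0 : 0 < A by rewrite sqrtr_gt0.
have mu0 : 0 < mu by rewrite sqrtr_gt0 divr_gt0.
have A2 : A ^+ 2 = r ^+ d by rewrite sqr_sqrtr// ltW.
have mu2 : mu ^+ 2 = (1 - r ^+ 2) / r ^+ d by rewrite sqr_sqrtr// divr_ge0// ltW.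
have geo (K s : nat) : (1 - r ^+ 2) * \sum_(k < K) (if (s <= k)%N then (r ^+ k) ^+ 2 else 0) <= (r ^+ s) ^+ 2.
  rewrite (eq_bigr (fun k : 'I_K => if (s <= k)%N then (r ^+ 2) ^+ k else 0)) => [|k _].
    by rewrite -!exprM mulnC exprM sum_geometric_tail// ltW.
  by rewrite -!exprM mulnC.
pose a (t k : nat) : R := if t == d then (if (d <= k)%N then r ^+ k * mu else 0)
  else (if k == t then A else 0).
pose b (t k : nat) : R := if t == d then (1 - r ^+ 2) * r ^+ k / mu
  else (if (d - t <= k)%N then (1 - r ^+ 2) * r ^+ t * r ^+ k / A else 0).
have sumT (c : nat -> nat -> R) K B : (forall t, (t < d)%N -> \sum_(k < K) c t k ^+ 2 <= B) ->
    \sum_(k < K) c d k ^+ 2 <= B ->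
    \sum_(t < d.+1) \sum_(k < K) c t k ^+ 2 <= d.+1%:R * B.
  move=> h1 h2; rewrite big_ord_recr /= -natr1 mulrDl mul1r; apply: lerD => //.
  apply: (@le_trans _ _ (\sum_(t < d) B)); first by apply: ler_sum => t _; exact: h1.
  by rewrite sumr_const card_ord mulr_natl.
exists N, d.+1, a, b; split=> //.
- apply: sumT => [t td|]; rewrite /a ?eqxx ?ltn_eqF//.
    rewrite (eq_bigr (fun k : 'I_N => if (k : nat) == t then r ^+ d else 0)).
      by apply: sum_single_le; exact: ltW.
    by move=> k _; case: eqP => _; rewrite ?A2 ?expr0n.
  rewrite (eq_bigr (fun k : 'I_N => mu ^+ 2 * (if (d <= k)%N then (r ^+ k) ^+ 2 else 0))) => [|k _].
    rewrite -mulr_sumr mu2 mulrAC ler_pdivrMr//; apply: le_trans (geo _ _) _.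
    by rewrite expr2.
  by case: ifP => _; rewrite ?expr0n ?mulr0// exprMn mulrC.
- apply: sumT => [t td|]; rewrite /b ?eqxx ?ltn_eqF//.
    rewrite (eq_bigr (fun k : 'I_N => (1 - r ^+ 2) ^+ 2 * (r ^+ t) ^+ 2 / r ^+ d *
        (if (d - t <= k)%N then (r ^+ k) ^+ 2 else 0))) => [|k _]; last first.
      by case: ifP => _; rewrite ?expr0n ?mulr0// -A2; field; rewrite gt_eqF.
    rewrite -mulr_sumr; have := geo N (d - t)%N.
    set S := \sum_(k < N) _ => h.
    have e : (r ^+ t) ^+ 2 * (r ^+ (d - t)) ^+ 2 = r ^+ d * r ^+ d.
      by rewrite -[LHS]exprMn -[in LHS]exprD subnKC ?(ltnW td)// expr2.
    have h' : (r ^+ t) ^+ 2 * ((1 - r ^+ 2) * S) <= r ^+ d * r ^+ d.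
      by rewrite -e ler_wpM2l// sqr_ge0.
    rewrite mulrAC ler_pdivrMr//.
    apply: (@le_trans _ _ ((1 - r ^+ 2) * ((r ^+ t) ^+ 2 * ((1 - r ^+ 2) * S)))).
      by rewrite le_eqVlt; apply/orP; left; apply/eqP; ring.
    apply: (@le_trans _ _ ((1 - r ^+ 2) * (r ^+ d * r ^+ d))).
      by rewrite ler_wpM2l// ltW.
    by rewrite -[leRHS]mul1r ler_wpM2r ?mulr_ge0 ?(ltW rd)//; lra.
  rewrite (eq_bigr (fun k : 'I_N => (1 - r ^+ 2) * r ^+ d * (if (0 <= k)%N then (r ^+ k) ^+ 2 else 0))) => [|k _].
    rewrite -mulr_sumr mulrAC -[leRHS]mul1r ler_wpM2r ?(ltW rd)//.
    by apply: le_trans (geo _ 0%N) _; rewrite expr0 expr1n.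
  rewrite /= !exprMn exprVn mu2; field; rewrite !gt_eqF//.
move=> i j iN jN; rewrite heat_symbol_diff big_ord_recr /= /a /b eqxx.
have [di|id] := leqP d i.
  rewrite big1 ?add0r => [|t _]; last first.
    by rewrite ltn_eqF// (gtn_eqF (leq_trans (ltn_ord t) di)) mul0r.
  rewrite (leq_trans di (leq_addr j i)) exprD; field; rewrite gt_eqF//.
rewrite mul0r addr0 (bigD1 (Ordinal id)) //= eqxx ltn_eqF// big1 ?addr0 => [|t ti]; last first.
  by rewrite ltn_eqF//; case: eqP => [e|_]; rewrite ?mul0r//; move/eqP: ti; case; apply: val_inj.
rewrite leq_subLR; case: ifP => _; rewrite ?mulr0// exprD; field; rewrite gt_eqF//.
Qed.

End Heat.

(** * The symbol of the inverse of L *)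

Section Inverse.
Variable d : nat.
Hypothesis d0 : (0 < d)%N.

(** Equal to 1/m - 1/(m+2) for m = max(k, d). *)
Definition inv_step (k : nat) : R := 2 / ((maxn k d)%:R * ((maxn k d)%:R + 2)).

(* Only the values at [k >= d] matter; those below continue the last step
   [f(d) - f(d+2)], which [inv_factorisation] needs. *)
Definition inv_symbol (k : nat) : R :=
  if (d <= k)%N then k%:R^-1
  else (d + odd (d - k))%:R^-1 + (uphalf (d - k))%:R * inv_step 0.

Let pos (k : nat) : (0 < k)%N -> 0 < k%:R :> R.
Proof. by rewrite ltr0n. Qed.

Lemma inv_symbol_diff k : inv_symbol k - inv_symbol k.+2 = inv_step k.
Proof.
rewrite /inv_symbol /inv_step max0n; have [dk|kd] := leqP d k.
  rewrite (leq_trans dk (leqW (leqnSn k))) -addn2 natrD.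
  have k0 : 0 < k%:R :> R by apply: pos; lia.
  by field; rewrite !gt_eqF//; lra.
have D0 := pos d0.
case: leqP => h; last first.
  have -> : (d - k = (d - k.+2).+2)%N by lia.
  by rewrite /= negbK -natr1; lra.
have [e|e] : (d = k.+1 \/ d = k.+2)%N by lia.
  rewrite (_ : (d - k = 1)%N); last lia.
  by rewrite (_ : k.+2 = d + 1)%N /=; [lra|lia].
rewrite (_ : (d - k = 2)%N); last lia.
by rewrite (_ : k.+2 = d)%N /= ?addn0; [lra|lia].
Qed.

Lemma inv_symbol_cvg (e : R) : 0 < e -> exists N, forall k, (N <= k)%N -> `|inv_symbol k| <= e.
Proof.
move=> e0; exists (maxn d (Num.truncn e^-1).+1) => k; rewrite geq_max => /andP[dk ek].
rewrite /inv_symbol dk gtr0_norm ?invr_gt0; last by apply: pos; lia.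
rewrite invf_ple ?posrE//; last by apply: pos; lia.
by apply: ltW; apply: (lt_le_trans (truncnS_gt _)); rewrite ler_nat.
Qed.

Let g (s : nat) : R := inv_step s - inv_step s.+1.
Let m (t : nat) : R := (maxn t d)%:R.

Let m_gt0 t : 0 < m t.
Proof. by apply: pos; rewrite leq_max d0 orbT. Qed.

Let mS t : m t.+1 = m t /\ g t = 0 \/ m t.+1 = m t + 1.
Proof.
rewrite /m /g /inv_step; have [td|dt] := ltnP t d.
  by left; rewrite (maxn_idPr td) subrr.
by right; rewrite (maxn_idPl (leqW dt)) -natr1.
Qed.

(** g(t)^2 behaves like 16 / m^6, and the difference on the right like (35/2) / m^6. The shape m^2
    (m+1)^3 is chosen so that division by the weights [al2] leaves a multiple of 1 / (m (m+1)). *)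
Lemma inv_step_gap_sq t : g t ^+ 2 <=
  7 / 2 / (m t ^+ 2 * (m t + 1) ^+ 3) - 7 / 2 / (m t.+1 ^+ 2 * (m t.+1 + 1) ^+ 3).
Proof.
have [[-> ->]|e] := mS t; first by rewrite subrr expr0n.
have m1 : 1 <= m t by rewrite ler1n leq_max d0 orbT.
rewrite /g /inv_step -/(m t) -/(m t.+1) e; move: (m t) m1 => x x1.
rewrite -subr_ge0.
rewrite (_ : _ - _ = (7 / 2 * (5 * x ^+ 2 + 12 * x + 8) * (x + 3) ^+ 2 - 4 * (2 * x + 3) ^+ 2 * (x + 1) * (x + 2)) /
   (x ^+ 2 * (x + 1) ^+ 3 * (x + 2) ^+ 3 * (x + 3) ^+ 2)); last first.
  by field; rewrite !gt_eqF//; lra.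
rewrite divr_ge0//; last first.
  by rewrite !mulr_ge0 ?exprn_ge0//; lra.
have h4 : 0 <= x ^+ 4 by rewrite exprn_ge0//; lra.
have h3 : 0 <= x ^+ 3 by rewrite exprn_ge0//; lra.
have h2 : 0 <= x ^+ 2 by rewrite exprn_ge0//; lra.
rewrite (_ : _ - _ = 3 / 2 * x ^+ 4 + 51 * x ^+ 3 + 451 / 2 * x ^+ 2 + 342 * x + 180); last by field.
lra.
Qed.

(** The d terms frozen at m = d add up to at most 1/d, and the later ones telescope to at most
    another 1/d. *)
Lemma inv_weights_sum (K : nat) : \sum_(t < K) (m t * (m t + 1))^-1 <= 2 / d%:R.
Proof.
have D0 := pos d0.
have small k : (k <= d)%N -> \sum_(t < k) (m t * (m t + 1))^-1 <= k%:R / d%:R ^+ 2.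
  elim: k => [_|k IH kd]; first by rewrite big_ord0 mul0r.
  rewrite big_ord_recr /= -natr1 mulrDl; apply: lerD; first exact/IH/ltnW.
  rewrite /m (maxn_idPr (ltnW kd)) mul1r expr2 lef_pV2 ?posrE; first by rewrite ler_pM2l//; lra.
    by rewrite mulr_gt0//; lra.
  by rewrite mulr_gt0.
have large k : \sum_(t < d + k) (m t * (m t + 1))^-1 <= 2 / d%:R - (d + k)%:R^-1.
  elim: k => [|k IH].
    rewrite addn0; apply: le_trans (small _ (leqnn d)) _.
    by rewrite le_eqVlt; apply/orP; left; apply/eqP; field; rewrite gt_eqF.
  rewrite addnS big_ord_recr /=; apply: le_trans (lerD IH (lexx _)) _.
  rewrite /m (maxn_idPl (leq_addr k d)).
  have : 0 < (d + k)%:R :> R by apply: pos; lia.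
  rewrite -[(d + k).+1]addn1 [(d + k + 1)%:R]natrD; move: (d + k)%:R => x x0.
  rewrite (_ : (x * (x + 1))^-1 = x^-1 - (x + 1)^-1); first lra.
  by field; rewrite !gt_eqF//; lra.
have [Kd|dK] := leqP K d.
  apply: le_trans (small K Kd) _.
  apply: (@le_trans _ _ (1 / d%:R)); last by rewrite ler_pM2r ?invr_gt0//; lra.
  rewrite expr2 invfM mulrA ler_pM2r ?invr_gt0// ler_pdivrMr// mul1r ler_nat//.
rewrite -(subnKC (ltnW dK)); apply: le_trans (large _) _.
by rewrite gerBl invr_ge0.
Qed.

(* The step [h] of the symbol is frozen below [d] and the Hankel matrix [h(i+j)] is cut
   into the rank one pieces [1_(i <= t) (h(t+j) - h(t+1+j))], balanced by the
   weights [al t]; the last piece removes the truncation at [t < K]. *)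
Lemma inv_factorisation N : exists (K T : nat) (a b : nat -> nat -> R),
    [/\ (N <= K)%N, \sum_(t < T) \sum_(k < K) a t k ^+ 2 <= 4 / d%:R,
        \sum_(t < T) \sum_(k < K) b t k ^+ 2 <= 4 / d%:R &
        forall i j, (i < K)%N -> (j < K)%N ->
          \sum_(t < T) a t i * b t j = inv_symbol (i + j)%N - inv_symbol (i + j).+2].
Proof.
have D0 := pos d0.
(* The factor 8 keeps the cost 2/K of the last piece below 1/(4d). *)
pose K := (N + 8 * d)%N.
have K0 : 0 < K%:R :> R by apply: pos; rewrite /K; lia.
have K8 : 8 * d%:R <= K%:R :> R by rewrite -natrM ler_nat /K leq_addl.
have KN : (N <= K)%N by rewrite leq_addr.
have dK : (d <= K)%N by rewrite /K; lia.
clearbody K.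
have eps : 2 / K%:R <= 1 / 4 / d%:R :> R.
  rewrite ler_pdivrMr// mulrAC ler_pdivlMr//; lra.
(* The two sides cost 15/8 and (7/2) / (15/8) = 28/15 times 2/d, so 15/8 leaves room for 1/(4d)
   below 4/d on both. *)
pose al2 t : R := 15 / 8 / (m t * (m t + 1) ^+ 2).
have m1 t : 0 < m t + 1 by rewrite addr_gt0.
have al20 t : 0 < al2 t by rewrite divr_gt0 ?mulr_gt0 ?exprn_gt0.
pose al t := Num.sqrt (al2 t).
have al0 t : 0 < al t by rewrite sqrtr_gt0.
have alE t : al t ^+ 2 = al2 t by rewrite sqr_sqrtr// ltW.
(* [inv_step] is at most 2 / K^2 from [K] on, so both factors of the last piece have squared norm at
   most 2/K. *)
pose nu : R := Num.sqrt (2 / K%:R ^+ 2).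
have nu0 : 0 < nu by rewrite sqrtr_gt0 divr_gt0 ?exprn_gt0.
have nuE : nu ^+ 2 = 2 / K%:R ^+ 2 by rewrite sqr_sqrtr// divr_ge0 ?exprn_ge0 ?ltW.
pose a (t k : nat) : R := if t == K then nu else if (k <= t)%N then al t else 0.
pose b (t k : nat) : R := if t == K then inv_step (K + k) / nu else g (t + k) / al t.
have split_last (c : nat -> nat -> R) B :
    \sum_(t < K) \sum_(k < K) c t k ^+ 2 <= B -> \sum_(k < K) c K k ^+ 2 <= 2 / K%:R ->
    \sum_(t < K.+1) \sum_(k < K) c t k ^+ 2 <= B + 1 / 4 / d%:R.
  by move=> h1 h2; rewrite big_ord_recr /= lerD// (le_trans h2).
have DV : 0 < d%:R^-1 :> R by rewrite invr_gt0.
exists K, K.+1, a, b; split=> //.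
- apply: (@le_trans _ _ (15 / 8 * (2 / d%:R) + 1 / 4 / d%:R)); last by lra.
  apply: split_last.
    apply: le_trans (ler_wpM2l _ (inv_weights_sum K)); last by lra.
    rewrite mulr_sumr; apply: ler_sum => t _.
    rewrite (eq_bigr (fun k : 'I_K => if (k <= t)%N then al2 t else 0)) => [|k _]; last first.
      by rewrite /a ltn_eqF//; case: ifP => _; rewrite ?alE ?expr0n.
    have -> : \sum_(k < K) (if (k <= t)%N then al2 t else 0) = t.+1%:R * al2 t.
      rewrite -(big_mkord xpredT (fun k => if (k <= t)%N then al2 t else 0)).
      rewrite (big_cat_nat _ (n := t.+1)) //=.
      rewrite [X in _ + X]big1_seq ?addr0; last first.
        by move=> k /=; rewrite mem_index_iota => /andP[tk _]; rewrite leqNgt tk.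
      rewrite big_mkord (eq_bigr (fun=> al2 t)) => [|k _]; last by rewrite -ltnS ltn_ord.
      by rewrite sumr_const card_ord mulr_natl.
    have mt : t.+1%:R <= m t + 1 by rewrite natr1 ler_nat ltnS leq_maxl.
    apply: le_trans (ler_wpM2r (ltW (al20 t)) mt) _.
    rewrite le_eqVlt; apply/orP; left; apply/eqP; rewrite /al2; field.
    by rewrite !(gt_eqF (m1 _), gt_eqF (m_gt0 _)).
  rewrite (eq_bigr (fun=> nu ^+ 2)) => [|k _]; last by rewrite /a eqxx.
  rewrite sumr_const card_ord nuE -mulr_natl.
  by rewrite le_eqVlt; apply/orP; left; apply/eqP; field; rewrite gt_eqF.
- apply: (@le_trans _ _ (28 / 15 * (2 / d%:R) + 1 / 4 / d%:R)); last by lra.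
  apply: split_last.
    apply: le_trans (ler_wpM2l _ (inv_weights_sum K)); last by lra.
    rewrite mulr_sumr; apply: ler_sum => t _.
    rewrite (eq_bigr (fun k : 'I_K => g (t + k) ^+ 2 / al2 t)) => [|k _]; last first.
      by rewrite /b ltn_eqF// expr_div_n alE.
    rewrite -mulr_suml ler_pdivrMr//.
    apply: (@le_trans _ _ (7 / 2 / (m t ^+ 2 * (m t + 1) ^+ 3))).
      pose Phi s : R := 7 / 2 / (m s ^+ 2 * (m s + 1) ^+ 3).
      apply: (@le_trans _ _ (\sum_(k < K) (Phi (t + k)%N - Phi (t + k).+1))).
        by apply: ler_sum => k _; exact: inv_step_gap_sq.
      rewrite -(big_mkord xpredT (fun k => Phi (t + k)%N - Phi (t + k).+1)).
      rewrite (eq_bigr (fun k => - Phi (t + k.+1)%N - - Phi (t + k)%N)) => [|k _]; last first.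
        by rewrite opprK addrC addnS.
      rewrite telescope_sumr// opprK addn0 addrC gerBl.
      by rewrite divr_ge0 ?mulr_ge0 ?exprn_ge0 ?ltW.
    rewrite le_eqVlt; apply/orP; left; apply/eqP; rewrite /al2; field.
    by rewrite !(gt_eqF (m1 _), gt_eqF (m_gt0 _)).
  apply: (@le_trans _ _ (\sum_(k < K) 2 / K%:R ^+ 2)).
    apply: ler_sum => k _; rewrite /b eqxx expr_div_n nuE.
    have st : 0 <= inv_step (K + k) <= 2 / K%:R ^+ 2.
      rewrite /inv_step (maxn_idPl (leq_trans dK (leq_addr _ _))).
      have h1 : K%:R <= (K + k)%:R :> R by rewrite ler_nat leq_addr.
      rewrite divr_ge0 ?mulr_ge0 ?addr_ge0//= ler_pM2l// lef_pV2 ?posrE ?exprn_gt0//.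
        by rewrite expr2 ler_pM// ?ltW//; lra.
      by rewrite mulr_gt0//; lra.
    have K20 : 0 < 2 / K%:R ^+ 2 :> R by rewrite divr_gt0 ?exprn_gt0.
    case/andP: st => st0 st1; rewrite ler_pdivrMr// -expr2 ler_sqr ?nnegrE// ltW//.
  rewrite sumr_const card_ord -mulr_natl.
  by rewrite le_eqVlt; apply/orP; left; apply/eqP; field; rewrite gt_eqF.
move=> i j iK jK; rewrite inv_symbol_diff big_ord_recr /= /a /b eqxx.
have -> : nu * (inv_step (K + j) / nu) = inv_step (K + j) by field; rewrite gt_eqF.
rewrite (eq_bigr (fun t : 'I_K => if (i <= t)%N then g (t + j) else 0)) => [|t _]; last first.
  by rewrite ltn_eqF//; case: ifP => _; rewrite ?mul0r//; field; rewrite gt_eqF.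
rewrite -(big_mkord xpredT (fun t => if (i <= t)%N then g (t + j) else 0)).
rewrite (big_cat_nat _ (n := i)) //=; last exact: ltnW.
rewrite big1_seq ?add0r; last first.
  by move=> k /=; rewrite mem_index_iota /= => ki; rewrite leqNgt ki.
rewrite (eq_big_nat _ _ (F2 := fun t => - inv_step (t.+1 + j) - - inv_step (t + j))); last first.
  by move=> k /andP[-> _]; rewrite /g opprK addrC addSn.
by rewrite telescope_sumr ?(ltnW iK)// opprK addrAC addNr add0r.
Qed.

End Inverse.
End Factorisations.

(** * Group algebra elements attached to polynomials *)

Section Embedding.
Local Open Scope classical_set_scope.
Local Open Scope complex_scope.
Variables (R : realType) (n : nat).
Local Notation C := R[i].
Local Notation G := (fgroup n).
Local Notation A := (galg R G).
Implicit Types (x y : fpoly R n) (g h : G) (w : word n) (F : A).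
Local Notation star := (@gstar R G).
Local Notation tr := (@gtr R G).
Local Notation sq F := (tr (star F * F)).

Definition nf w : G := insubd (fg_one n) w.

Lemma nfK w : reduced w -> fword (nf w) = w.
Proof. by move=> h; rewrite -[fword _]/(val _) insubdK. Qed.

Lemma fwordK g : nf (fword g) = g.
Proof. by apply: val_inj; rewrite /= nfK// fwordP. Qed.

Lemma mem_supp x w : (w \in supp x) = reduced w && (w \in fsupp x).
Proof. by rewrite mem_filter mem_undup. Qed.

Lemma supp_uniq x : uniq (supp x).
Proof. by rewrite filter_uniq// undup_uniq. Qed.

Lemma coef_notin x w : w \notin supp x -> coef x w = 0.
Proof. by rewrite mem_supp andbC /coef => /negbTE ->. Qed.

Lemma emb_subproof x :
  finite_functional (fun phi : G -> C => \sum_(w <- supp x) coef x w * phi (nf w)).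
Proof. by exists [seq (coef x w, nf w) | w <- supp x] => phi; rewrite big_map. Qed.
Definition emb x : A := GAlg (emb_subproof x).

Lemma nf_eq w g : reduced w -> (nf w == g) = (w == fword g).
Proof. by move=> h; rewrite -(inj_eq val_inj) /= nfK. Qed.

Lemma emb_coef x g : emb x (gdelta R g) = coef x (fword g).
Proof.
rewrite /=; have [gx|gx] := boolP (fword g \in supp x).
  rewrite (bigD1_seq _ gx (supp_uniq x)) /= fwordK /gdelta eqxx mulr1.
  rewrite big1_seq ?addr0// => w /andP[wg wx].
  move: wx; rewrite mem_supp => /andP[rw _].
  by rewrite nf_eq// (negbTE wg) mulr0.
rewrite coef_notin// big1_seq// => w /andP[_ wx]; rewrite /gdelta nf_eq; last first.
  by move: wx; rewrite mem_supp => /andP[].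
by case: eqP => [e|_]; rewrite ?mulr0//; move: gx; rewrite -e wx.
Qed.

Lemma emb_supportE x (phi : G -> C) :
  emb x phi = \sum_(g <- map nf (supp x)) emb x (gdelta R g) * phi g.
Proof.
rewrite [LHS]/= big_map big_seq [RHS]big_seq; apply: eq_bigr => w wx.
rewrite emb_coef nfK//.
by move: wx; rewrite mem_supp => /andP[].
Qed.

Lemma emb_mul x y : emb (pmul x y) = emb x * emb y.
Proof.
apply: galg_coef_ext => g; rewrite emb_coef galg_mulE.
have -> : emb x (fun a => emb y (fun b => gdelta R g (a * b)%g)) =
    \sum_(a <- supp x) \sum_(b <- supp y | wmul a b == fword g) coef x a * coef y b.
  rewrite /= big_seq [RHS]big_seq; apply: eq_bigr => a ax.
  rewrite mulr_sumr [RHS]big_mkcond /= big_seq [RHS]big_seq; apply: eq_bigr => b bx.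
  have ra : reduced a by move: ax; rewrite mem_supp => /andP[].
  have rb : reduced b by move: bx; rewrite mem_supp => /andP[].
  rewrite /gdelta -(inj_eq val_inj) /= !nfK//.
  by case: eqP => _; rewrite ?mulr1 ?mulr0.
rewrite /coef fwordP andbT; case: ifP => // /negbT gN.
symmetry; apply: big1_seq => a /andP[_ ax]; apply: big1_seq => b /andP[/eqP e bx].
by move: gN; rewrite /= -e allpairs_f.
Qed.

Lemma cconjE (z : C) : cconj z = conjc z.
Proof. by case: z. Qed.

Lemma emb_adj x : emb (padj x) = star (emb x).
Proof.
apply: galg_coef_ext => g; rewrite emb_coef.
have -> : star (emb x) (gdelta R g) = conjc (emb x (gdelta R (g^-1)%g)).
  rewrite /=; congr conjc; apply: eq_bigr => w _; congr (_ * _).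
  by rewrite /gdelta conjc_nat -(inj_eq invg_inj) invgK.
rewrite emb_coef /coef /= fwordP andbT.
have rg := reduced_winv (fwordP g).
case: ifP => [_|gN]; first by rewrite cconjE /coef.
rewrite -/(coef x (winv (fword g))) coef_notin ?conjc0//.
apply: contraFN gN => h; apply/mapP; exists (winv (fword g)) => //.
by rewrite winvK.
Qed.

Lemma emb_one : emb (pone R n) = 1.
Proof.
apply: galg_coef_ext => g; rewrite emb_coef /coef /= fwordP andbT mem_seq1 mul1r /gdelta.
by rewrite -(inj_eq val_inj) /= eq_sym; case: eqP.
Qed.

Lemma emb_pow x k : emb (ppow x k) = emb x ^+ k.
Proof.
elim: k => [|k IH]; first exact: emb_one.
by rewrite exprS -IH -emb_mul.
Qed.

Lemma emb_surj F : exists x, emb x = F.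
Proof.
have [S [uS hF _]] := gfun_support2 F F.
exists (FPoly (map (@fword n) S) (fun w => F (gdelta R (nf w)))).
apply: galg_coef_ext => g; rewrite emb_coef /coef /= fwordP andbT fwordK.
case: ifP => // /negbT gS; rewrite [RHS]hF big1_seq// => h /andP[_ hS].
rewrite /gdelta; case: eqP => [e|_]; last by rewrite mulr0.
by move: gS; rewrite -e map_f.
Qed.

Lemma l2norm_sq x : l2norm x ^+ 2 = sq (emb x).
Proof.
rewrite sqr_sqrtr; last by apply: sumr_ge0 => w _; exact: cabs2_ge0.
rewrite (gtr_sq (emb_supportE x)) big_map big_seq [RHS]big_seq.
apply: eq_bigr => w wx; rewrite emb_coef nfK//.
by move: wx; rewrite mem_supp => /andP[].
Qed.

Lemma l2norm_ge0 x : 0 <= l2norm x.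
Proof. exact: sqrtr_ge0. Qed.

Lemma l2norm_le x c : 0 <= c -> (l2norm x <= c) = (sq (emb x) <= c ^+ 2).
Proof. by move=> c0; rewrite -l2norm_sq ler_sqr ?nnegrE ?l2norm_ge0. Qed.

Let opset x := [set l2norm (pmul x xi) | xi in [set xi | l2norm xi <= 1]].

Lemma opset_ub x c : 0 <= c -> opbound star tr (emb x) c -> ubound (opset x) c.
Proof.
move=> c0 hx _ [xi /= xi1 <-]; rewrite l2norm_le// emb_mul.
apply: le_trans (hx _) _; rewrite -[leRHS]mulr1 ler_wpM2l ?sqr_ge0//.
by rewrite -[1](expr1n _ 2) -l2norm_le.
Qed.

Lemma opset_nonempty x : opset x !=set0.
Proof.
exists (l2norm (pmul x (FPoly [::] (fun=> 0)))); exists (FPoly [::] (fun=> 0)) => //=.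
by rewrite /l2norm /supp /= big_nil sqrtr0.
Qed.

Lemma opnorm_le x c : 0 <= c -> opbound star tr (emb x) c -> opnorm x <= c.
Proof. by move=> c0 hx; apply: ge_sup; [exact: opset_nonempty|exact: opset_ub]. Qed.

Lemma has_sup_opset x : has_sup (opset x).
Proof.
split; first exact: opset_nonempty.
by have [c c0 hc] := galg_bounded (emb x); exists c; apply: opset_ub => //; exact: ltW.
Qed.

Lemma opnorm_ge0 x : 0 <= opnorm x.
Proof.
have [r hr] := opset_nonempty x.
apply: le_trans (ub_le_sup (has_sup_opset x).2 hr).
by case: hr => xi _ <-; exact: l2norm_ge0.
Qed.

(** By [emb_surj] the normalised [F] is an admissible vector in the supremum. When [sq F = 0] any
    finite bound on [x] suffices. *)
Lemma opbound_opnorm x : opbound star tr (emb x) (opnorm x).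
Proof.
have T := galg_tracial R G; move=> F.
have [c c0 hc] := galg_bounded (emb x).
have := tracial_ge0 T F; rewrite le_eqVlt => /orP[/eqP e|F0].
  by have := hc F; rewrite -e !mulr0.
have s0 : 0 < Num.sqrt (sq F) by rewrite sqrtr_gt0.
have s2 : Num.sqrt (sq F) ^+ 2 = sq F by rewrite sqr_sqrtr// ltW.
have [xi hxi] := emb_surj ((Num.sqrt (sq F))^-1 *: F).
have xi1 : l2norm xi <= 1.
  by rewrite l2norm_le// hxi (sqZ T) expr1n exprVn s2 mulVf// gt_eqF.
have : l2norm (pmul x xi) <= opnorm x.
  by apply: (ub_le_sup (has_sup_opset x).2); exists xi.
rewrite l2norm_le ?opnorm_ge0// emb_mul hxi -scalerAr (sqZ T) exprVn s2.
by rewrite ler_pdivrMl// mulrC.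
Qed.

(** [tau] is complex while [tr] is a real part; the powers of [x^# x] are self-adjoint, which kills
    the imaginary part. *)
Lemma tau_moment x k : tau (ppow (pmul (padj x) x) k) =
  (tr ((star (emb x) * emb x) ^+ k))%:C.
Proof.
rewrite /tau -[[::]]/(fword 1%g) -emb_coef emb_pow emb_mul emb_adj.
set F := _ ^+ k; have T := galg_tracial R G.
have : star F = F by rewrite (starX T) (tracial_starM T) (tracial_starK T).
move=> /(congr1 (fun H : A => H (gdelta R 1%g))) /=.
have -> : (fun g : G => (gdelta R 1%g (g^-1)%g)^*) = gdelta R 1%g.
  by apply/funext => g; rewrite /gdelta conjc_nat invg_eq1.
rewrite /gtr; case: (F _) => a b [] e; congr Complex; lra.
Qed.

Lemma spectral_distrP x (mu : probability R R) :
  spectral_distr x mu <-> exists B, spectral star tr (emb x) mu B.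
Proof.
have mX k : measurable_fun setT (fun s : R => s ^+ k).
  by apply: continuous_measurable_fun; exact: exprn_continuous.
split=> [[[B muB] h]|[B [B0 muB h]]]; last first.
  split; first by exists B.
  by move=> k; rewrite tau_moment -h (expect_full muB).
(* The [B] of [spectral_distr] carries no sign condition, whereas [spectral] asks for a positive
   one. *)
exists (`|B| + 1).
have muB' : mu (~` `[0, `|B| + 1]) = 0%E.
  apply: subset_measure0 muB; try exact: measurableC.
  apply: subsetC => s /=; rewrite !in_itv /= => /andP[-> sB] /=.
  apply: le_trans sB _; apply: le_trans (ler_norm _) _; lra.
split=> [||k] //.
by rewrite -(expect_full muB') //; have := h k; rewrite tau_moment => -[->].
Qed.

(** [lpnorm] is a choice with default value 0; the existence of a spectral distribution ensures that
    the chosen value meets the specification. *)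
Lemma lpnorm_attained x (p : \bar R) : (1 <= p)%E -> lpnorm_spec x p (lpnorm x p).
Proof.
move=> p1; rewrite /lpnorm; case: xgetP => [r -> //|h]; exfalso.
case: p p1 h => [q q1|_|//] h; last by apply: (h (opnorm x)).
have [c c0 hc] := galg_bounded (emb x).
have [mu hmu] := spectral_exists (galg_tracial R G) c0 hc.
apply: (h (powR (fine (\int[mu]_s (powR s (q / 2))%:E)) q^-1)).
by exists mu; split => //; apply/spectral_distrP; exists (c ^+ 2).
Qed.

Lemma lpnorm_ge0 x (p : \bar R) : (1 <= p)%E -> 0 <= lpnorm x p.
Proof.
move=> p1; have := lpnorm_attained x p1.
case: p p1 => [q q1|_|//] /=; last by move=> ->; exact: opnorm_ge0.
by case=> mu [_ ->]; exact: powR_ge0.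
Qed.

Lemma lpnorm_multiplier x y (f : G -> R) K (p : \bar R) : 0 < K -> (1 <= p)%E ->
  emb y = gmult f (emb x) ->
  (forall F c, 0 < c -> opbound star tr F c -> opbound star tr (gmult f F) (K * c)) ->
  lpnorm y p <= K * lpnorm x p.
Proof.
move=> K0 p1 yE hf; have T := galg_tracial R G.
have := lpnorm_attained y p1; have := lpnorm_attained x p1.
case: p p1 => [q q1|_|//] /=; last first.
  move=> -> ->; apply/ler_addgt0Pr => e e0.
  (* [hf] takes positive bounds only and [opnorm x] may be 0, hence the margin e / K. *)
  have eK : 0 < e / K by rewrite divr_gt0.
  apply: le_trans (opnorm_le (c := K * (opnorm x + e / K)) _ _) _.
  - by rewrite mulr_ge0 ?(ltW K0)// addr_ge0 ?opnorm_ge0// ltW.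
  - rewrite yE; apply: hf; first by rewrite ltr_wpDl ?opnorm_ge0.
    by apply: opbound_le (opbound_opnorm x); rewrite ?opnorm_ge0// lerDl ltW.
  - by rewrite mulrDr mulrCA divff ?mulr1// gt_eqF.
rewrite lee_fin in q1.
have q0 : 0 < q by apply: lt_le_trans q1.
move=> [mu [/spectral_distrP[B hmu] ->]] [nu [/spectral_distrP[B' hnu] ->]].
have [B0 muB _] := hmu; have [B'0 nuB _] := hnu.
rewrite (expect_full muB); last exact: measurable_powR.
rewrite (expect_full nuB); last exact: measurable_powR.
have E0 (P : probability R R) b : P (~` `[0, b]) = 0%E -> 0 < b -> 0 <= expect P b (fun s => powR s (q / 2)).
  move=> Pb b0; rewrite -(expect_cst Pb 0); apply: le_expect => //.
  - exact: bmeasurable_cst.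
  - exact: powR_bmeasurable.
  - by move=> s _; exact: powR_ge0.
have le : expect nu B' (fun s => powR s (q / 2)) <= powR K q * expect mu B (fun s => powR s (q / 2)).
  apply: power_le => // c c0; rewrite yE in hnu.
  apply: (hinge_bound T K0 (gmultD f) (gmult_sym f) _ c0 hmu hnu).
  by move=> F b; exact: hf.
apply: (@le_trans _ _ (powR (powR K q * expect mu B (fun s => powR s (q / 2))) q^-1)).
  apply: ge0_ler_powR => //; rewrite ?nnegrE ?invr_ge0 ?(ltW q0)//; first exact: E0.
  by rewrite mulr_ge0 ?powR_ge0 ?E0.
rewrite powRM ?powR_ge0 ?E0// -powRrM divff ?powRr1// ?gt_eqF// ltW//.
Qed.

Lemma emb_multiplier x (c : word n -> R) :
  emb (FPoly (supp x) (fun w => (c w)%:C * coef x w)) = gmult (fun g => c (fword g)) (emb x).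
Proof.
apply: galg_coef_ext => g; rewrite gmult_coef !emb_coef.
have [gx|gx] := boolP (fword g \in supp x); last first.
  by rewrite (coef_notin gx) mulr0 /coef /= (negbTE gx).
by rewrite {1}/coef /= gx fwordP.
Qed.

(** This is the freedom to redefine a symbol below length [d]. *)
Lemma gmult_congr (f f' : G -> R) x d : in_Pge d x ->
  (forall g, (d <= size (fword g))%N -> f g = f' g) ->
  gmult f (emb x) = gmult f' (emb x).
Proof.
move=> xd ff'; apply: galg_coef_ext => g; rewrite !gmult_coef emb_coef.
have [->|x0] := eqVneq (coef x (fword g)) 0; first by rewrite !mulr0.
by rewrite ff'//; exact: xd.
Qed.

End Embedding.

(** * The two inequalities *)

Theorem theorem1p5 (R : realType) (n : nat) (p : \bar R) (d : nat)
  (x : fpoly R n) (t : R) :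
  (0 < n)%N -> (1 <= p)%E -> (1 <= d)%N -> in_Pge d x -> 0 <= t ->
  lpnorm (Pt t x) p <= (d + 3)%:R * expR (- t * d%:R) * lpnorm x p /\
  d%:R / 4 * lpnorm x p <= lpnorm (Lop x) p.
Proof.
move=> _ p1 d1 xd t0; have D0 : 0 < d%:R :> R by rewrite ltr0n.
split.
  (* At t = 0 one has r = 1 and the symbol does not tend to 0, as [hankel_opbound] requires; there
     P_0 is the identity. *)
  have := t0; rewrite le_eqVlt => /orP[/eqP te|t_gt0].
    apply: (@le_trans _ _ (1 * lpnorm x p)).
      apply: (@lpnorm_multiplier _ _ _ _ (fun=> 1)) => //.
        rewrite /Pt (emb_multiplier x (fun w => expR (- t * (wlen w)%:R))).
        by congr gmult; apply/funext => g; rewrite -te oppr0 mul0r expR0.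
      move=> F c c0 hF; rewrite mul1r.
      rewrite (_ : gmult _ _ = F)//; apply: galg_ext => phi /=.
      by congr (F _); apply/funext => g; rewrite mul1r.
    rewrite -te oppr0 mul0r expR0 mulr1 ler_wpM2r ?lpnorm_ge0//.
    by rewrite ler1n addn3.
  pose r := expR (- t).
  have r0 : 0 < r by exact: expR_gt0.
  have r1 : r < 1 by rewrite /r -expR0 ltr_expR oppr_lt0.
  have rE (k : nat) : expR (- t * k%:R) = r ^+ k by rewrite expRM_natr.
  apply: (@le_trans _ _ (d.+1%:R * r ^+ d * lpnorm x p)); last first.
    rewrite ler_wpM2r ?lpnorm_ge0// rE ler_wpM2r ?exprn_ge0 ?(ltW r0)//.
    by rewrite ler_nat; lia.
  apply: (@lpnorm_multiplier _ _ _ _ (fun g => heat_symbol r d (size (fword g)))) => //.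
  - by rewrite mulr_gt0// exprn_gt0.
  - rewrite /Pt (emb_multiplier x (fun w => expR (- t * (wlen w)%:R))).
    by apply: (gmult_congr xd) => g dg; rewrite rE /heat_symbol dg.
  apply: hankel_opbound.
  - by rewrite mulr_gt0// exprn_gt0.
  - by move=> e; exact: heat_symbol_cvg.
  - by move=> N; exact: heat_factorisation.
have D4 : 0 < 4 / d%:R :> R by rewrite divr_gt0.
(* On words of length at least d the multiplier by [inv_symbol] inverts L, so it sends L x back to
   x. *)
have : lpnorm x p <= 4 / d%:R * lpnorm (Lop x) p.
  apply: (@lpnorm_multiplier _ _ _ _ (fun g => inv_symbol R d (size (fword g)))) => //.
    rewrite /Lop (emb_multiplier x (fun w => (wlen w)%:R)).
    rewrite (_ : gmult (fun g => inv_symbol R d (size (fword g))) _ =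
      gmult (fun g => inv_symbol R d (size (fword g)) * (size (fword g))%:R) (emb x)); last first.
      by apply: galg_ext => phi /=; apply: eq_bigr => w _; rewrite rmorphM /=; ring.
    rewrite [LHS](_ : _ = gmult (fun=> 1) (emb x)); last first.
      by apply: galg_ext => phi /=; apply: eq_bigr => w _; rewrite mul1r.
    apply: (gmult_congr xd) => g dg; rewrite /inv_symbol dg mulVf// pnatr_eq0; lia.
  apply: hankel_opbound => //.
  - by move=> e; exact: inv_symbol_cvg.
  - by move=> N; exact: inv_factorisation.
rewrite -ler_pdivrMl//; apply: le_trans.
by rewrite le_eqVlt; apply/orP; left; apply/eqP; field; rewrite gt_eqF.
Qed.
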